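(* Let $P=\mathcal{A}[\mathrm{SU}_q(2)]$, $H=\mathcal{A}[\mathrm{U}(1)]$, $M=\mathcal{A}[S^2_q]$, with the differential calculi $\Omega^1P$ and $\Omega^1S^2_q=\Omega^1M$ described in the context. The homogeneous space $S^2_q$ is a framed quantum manifold with cotangent bundle $$\Omega^1S^2_q\cong\mathcal{L}_{-2}\oplus\mathcal{L}_0\oplus\mathcal{L}_{+2}.$$ The isomorphism is given by the soldering form $$\theta(b_+)=q^2c^2\,\mathrm{d}b_- -q\mu\, ac\,\mathrm{d}b_0+a^2\,\mathrm{d}b_+=\omega_+,$$ $$\theta(b_0)=-q\,dc\,\mathrm{d}b_-+(1+\mu bc)\,\mathrm{d}b_0-q^{-1} ba\,\mathrm{d}b_+=\nu^2q^{-1}\omega_0,$$ $$\theta(b_-)=d^2\,\mathrm{d}b_--q^{-1}\mu\, bd\,\mathrm{d}b_0+q^{-2}b^2\,\mathrm{d}b_+=q\,\omega_-,$$ (where $b_\pm,b_0$ on the left denote the classes in $V$) and it makes $\Omega^1S^2_q$ projective as a left $\mathcal{A}[S^2_q]$-module.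
   Context: Fix $0<q<1$ and put $\mu=q+q^{-1}$, $\nu=q-q^{-1}$. **Algebras.** $P=\mathcal{A}[\mathrm{SU}_q(2)]$ is the unital $*$-algebra generated by $a,b,c,d$ with $ab=qba$, $ac=qca$, $bd=qdb$, $cd=qdc$, $bc=cb$, $ad-da=(q-q^{-1})bc$, $ad=1+qbc$, and $a^*=d$, $b^*=-qc$, $c^*=-q^{-1}b$, $d^*=a$. It is a Hopf $*$-algebra with matrix coproduct $\Delta(a)=a\otimes a+b\otimes c$, $\Delta(b)=a\otimes b+b\otimes d$, $\Delta(c)=c\otimes a+d\otimes c$, $\Delta(d)=c\otimes b+d\otimes d$, counit $\epsilon(a)=\epsilon(d)=1$, $\epsilon(b)=\epsilon(c)=0$, antipode $S(a)=d$, $S(d)=a$, $S(b)=-q^{-1}b$, $S(c)=-qc$. $H=\mathcal{A}[\mathrm{U}(1)]=\mathbb{C}[t,t^{-1}]$ with $t^*=t^{-1}$, $\Delta(t)=t\otimes t$. The Hopf map $\pi:P\to H$ is $\pi(a)=t$, $\pi(d)=t^*$, $\pi(b)=\pi(c)=0$, and $\delta_R=(\mathrm{id}\otimes\pi)\Delta$ is a right coaction of $H$ on $P$ (equivalently the $\mathbb{Z}$-grading with $\deg a=\deg c=1$, $\deg b=\deg d=-1$). $M=\mathcal{A}[S^2_q]$ is the subalgebra of degree-zero (coinvariant) elements, generated by $b_+=cd$, $b_-=ab$, $b_0=bc$. For $n\in\mathbb{Z}$, $\mathcal{L}_n=\{x\in P:\delta_R(x)=x\otimes t^{-n}\}$.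 **Enveloping algebra.** $\mathcal{U}_q(\mathfrak{su}(2))$ is generated by $K^{\pm1},E,F$ with $K^{\pm1}E=q^{\pm1}EK^{\pm1}$, $K^{\pm1}F=q^{\mp1}FK^{\pm1}$, $[E,F]=(q-q^{-1})^{-1}(K^2-K^{-2})$, $\Delta(K^{\pm1})=K^{\pm1}\otimes K^{\pm1}$, $\Delta(E)=E\otimes K+K^{-1}\otimes E$, $\Delta(F)=F\otimes K+K^{-1}\otimes F$, $\epsilon(K)=1$, $\epsilon(E)=\epsilon(F)=0$. It is dually paired with $P$ as Hopf algebras by $(K^{\pm1},a)=q^{\mp1/2}$, $(K^{\pm1},d)=q^{\pm1/2}$, $(E,c)=1$, $(F,b)=1$, all other pairings of generators zero. It acts on $P$ from the left by $X\triangleright p=p_{(1)}(X,p_{(2)})$. Put $L_-=q^{1/2}FK^{-1}$, $L_+=q^{-1/2}EK^{-1}$, $L_0=K^2+\nu^2q^{-1}FE-1$, $L_z=K^{-2}-1$. **Calculus on $P$.** $\Omega^1P$ is the (4D$_+$) left-covariant first order differential calculus determined by the right ideal $I_P\subset\ker\epsilon$ generated by $b^2$, $c^2$, $b(a-d)$, $c(a-d)$, $a^2+q^2d^2-(1+q^2)(ad+q^{-1}bc)$, $\mathsf{z}b$, $\mathsf{z}c$, $\mathsf{z}(a-d)$, $\mathsf{z}(q^2a+d-(q^2+1))$, with $\mathsf{z}=q^2a+d-(q^3+q^{-1})$. It is free as a left $P$-module with basis of left-invariant forms $\omega_-,\omega_0,\omega_+,\omega_z$ dual to $L_-,L_0,L_+,L_z$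 and $\mathrm{d}p=\sum_{j\in\{-,0,+,z\}}(L_j\triangleright p)\,\omega_j$. The bimodule relations are (matrix shorthand, entry by entry, $\mathbf{x}=\begin{pmatrix}a&b\\ c&d\end{pmatrix}$): $\omega_-\mathbf{x}=\mathbf{x}\omega_-+\nu^2q^{-1}\begin{pmatrix}b&0\\ d&0\end{pmatrix}\omega_0$; $\omega_+\mathbf{x}=\mathbf{x}\omega_++\nu^2q^{-1}\begin{pmatrix}0&a\\ 0&c\end{pmatrix}\omega_0$; $\omega_0\mathbf{x}=\begin{pmatrix}q^{-1}a&qb\\ q^{-1}c&qd\end{pmatrix}\omega_0$; $\omega_z\mathbf{x}=\begin{pmatrix}0&a\\ 0&c\end{pmatrix}\omega_-+\nu^2q^{-1}\begin{pmatrix}a&0\\ c&0\end{pmatrix}\omega_0+\begin{pmatrix}b&0\\ d&0\end{pmatrix}\omega_++\begin{pmatrix}qa&q^{-1}b\\ qc&q^{-1}d\end{pmatrix}\omega_z$. $\Omega^1H$ is the left-covariant calculus on $H$ given by the ideal $I_H=\pi(I_P)$. **Calculus on $M$.** $\Omega^1S^2_q=\Omega^1M$ is the restriction of $\Omega^1P$ to $M$: the span of $m\,\mathrm{d}n$, $m,n\in M$, inside $\Omega^1P$. **Framing.** An algebra $M$ is a framed quantum manifold if it is the base $M=P^H$ of a quantum principal bundle (with the given non-universal calculi) and there are a right $H$-comodule $V$ and a linear map (soldering form) $\theta:V\to P\,\Omega^1M$ such that $s_\theta:(P\otimes V)^H\to\Omega^1M$, $p\otimes v\mapsto p\,\theta(v)$,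 is an isomorphism, where $(P\otimes V)^H$ denotes coinvariants for the tensor product coaction. Here $V=(\ker\epsilon\cap M)/(I_P\cap M)$, which is three-dimensional with basis the classes of $b_+,b_0,b_-$; its coaction is $v\mapsto\tilde v_{(2)}\otimes S\pi(\tilde v_{(1)})$, i.e. $b_+\mapsto b_+\otimes t^2$, $b_0\mapsto b_0\otimes1$, $b_-\mapsto b_-\otimes t^{*2}$; and $\theta(v)=S(\tilde v_{(1)})\,\mathrm{d}\tilde v_{(2)}$ for any representative $\tilde v$ of $v$, with $\Delta(\tilde v)=\tilde v_{(1)}\otimes\tilde v_{(2)}$ the coproduct of $P$. *)

(* Defs.v *)
From HB Require Import structures.
From mathcomp Require Import all_boot all_order all_algebra.
From mathcomp Require Import boolp classical_sets reals.
From mathcomp Require Import complex ring.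

Set Implicit Arguments.
Unset Strict Implicit.
Unset Printing Implicit Defensive.

Import Order.TTheory GRing.Theory Num.Theory.
Local Open Scope ring_scope.
Local Open Scope quotient_scope.
Local Open Scope complex_scope.

(* Linear algebra with Prop-valued submodules *)

Record submodule (K : fieldType) (V : lmodType K) := Submodule {
  submod_set :> V -> Prop ;
  submod0 : submod_set 0 ;
  submodP : forall k x y, submod_set x -> submod_set y -> submod_set (k *: x + y) }.

Section Submodules.
Variables (K : fieldType) (V : lmodType K).

Lemma submodD (A : submodule V) x y : A x -> A y -> A (x + y).
Proof. by move=> Ax Ay; rewrite -[x]scale1r; exact: submodP. Qed.

Lemma submodZ (A : submodule V) k x : A x -> A (k *: x).
Proof. by move=> Ax; rewrite -[_ *: _]addr0; apply: submodP => //; exact: submod0. Qed.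

Lemma submodN (A : submodule V) x : A x -> A (- x).
Proof. by move=> Ax; rewrite -scaleN1r; exact: submodZ. Qed.

Lemma submod_sum (A : submodule V) n (f : 'I_n -> V) :
  (forall i, A (f i)) -> A (\sum_i f i).
Proof. by move=> Af; elim/big_ind: _ => //; [exact: submod0 | exact: submodD]. Qed.

Definition span_set (S : V -> Prop) (x : V) : Prop :=
  exists n (k : 'I_n -> K) (s : 'I_n -> V),
    (forall i, S (s i)) /\ x = \sum_i k i *: s i.

Fact span_set0 S : span_set S 0.
Proof. by exists 0%N, (fun=> 0), (fun=> 0); split=> [[]//|]; rewrite big_ord0. Qed.

Fact span_setP S k x y : span_set S x -> span_set S y -> span_set S (k *: x + y).
Proof.
move=> [n [a [s [Ss ->]]]] [m [b [t [St ->]]]].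
exists (n + m)%N.
exists (fun i => match split i with inl i => k * a i | inr j => b j end).
exists (fun i => match split i with inl i => s i | inr j => t j end).
split=> [i|]; first by case: split.
rewrite big_split_ord /= scaler_sumr; congr (_ + _).
  by apply: eq_bigr => i _; rewrite (unsplitK (inl _ i)) scalerA.
by apply: eq_bigr => i _; rewrite (unsplitK (inr _ i)).
Qed.

Definition span (S : V -> Prop) : submodule V :=
  Submodule (span_set0 S) (@span_setP S).

Lemma sub_span (S : V -> Prop) x : S x -> span S x.
Proof.
move=> Sx; exists 1%N, (fun=> 1), (fun=> x); split=> //.
by rewrite big_ord1 scale1r.
Qed.

Lemma span_min (S : V -> Prop) (A : submodule V) :
  (forall x, S x -> A x) -> forall x, span S x -> A x.
Proof.
move=> SA x [n [k [s [Ss ->]]]]; apply: submod_sum => i.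
by apply: submodZ; exact: SA.
Qed.

(* the type of elements of a submodule *)
Definition submod_pred (A : submodule V) : {pred V} := fun x => `[< A x >].
Record subm (A : submodule V) :=
  Subm { subm_val : V ; subm_valP : subm_val \in submod_pred A }.

Lemma submod_predP (A : submodule V) x : reflect (A x) (x \in submod_pred A).
Proof. exact: asboolP. Qed.

Fact submod_pred_closed (A : submodule V) : subsemimod_closed (submod_pred A).
Proof.
split; first split.
- by apply/submod_predP; exact: submod0.
- by move=> x y /submod_predP Ax /submod_predP Ay; apply/submod_predP; exact: submodD.
- by move=> k x /submod_predP Ax; apply/submod_predP; exact: submodZ.
Qed.

End Submodules.

HB.instance Definition _ (K : fieldType) (V : lmodType K) (A : submodule V) :=
  [isSub for @subm_val K V A].
HB.instance Definition _ (K : fieldType) (V : lmodType K) (A : submodule V) :=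
  [Choice of subm A by <:].
HB.instance Definition _ (K : fieldType) (V : lmodType K) (A : submodule V) :=
  GRing.SubChoice_isSubLmodule.Build K V (submod_pred A) (subm A)
    (submod_pred_closed A).

(* subquot A B is the subquotient A / (A :&: B) of V *)
Section Subquotient.
Variables (K : fieldType) (V : lmodType K) (A B : submodule V).

Definition subquot_rel (x y : subm A) : bool := `[< B (val x - val y) >].

Fact subquot_equiv : equiv_class_of subquot_rel.
Proof.
split=> [x|x y|y x z].
- by apply/asboolP; rewrite subrr; exact: submod0.
- by apply: asbool_equiv_eq; split=> /submodN; rewrite opprB.
- move=> /asboolP xy /asboolP yz; apply/asboolP.
  by have := submodD xy yz; rewrite addrA subrK.
Qed.

Canonical subquot_equiv_rel := EquivRelPack subquot_equiv.
Definition subquot : Type := {eq_quot subquot_equiv_rel}.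
HB.instance Definition _ := Choice.on subquot.
HB.instance Definition _ := EqQuotient.on subquot.

Definition subquot_pi (x : subm A) : subquot := \pi x.

Lemma subquot_eqP x y : (subquot_pi x = subquot_pi y) <-> B (val x - val y).
Proof. by split=> [/eqmodP/asboolP//|xy]; apply/eqmodP/asboolP. Qed.

Lemma subquot_reprK x : subquot_pi (repr x) = x.
Proof. exact: reprK. Qed.

Lemma subquot_pi_repr x : B (val (repr (subquot_pi x)) - val x).
Proof. by apply/subquot_eqP; rewrite subquot_reprK. Qed.

Definition subquot_add (x y : subquot) := subquot_pi (repr x + repr y).
Definition subquot_opp (x : subquot) := subquot_pi (- repr x).
Definition subquot_scale (k : K) (x : subquot) := subquot_pi (k *: repr x).

Lemma subquot_addE x y :
  subquot_add (subquot_pi x) (subquot_pi y) = subquot_pi (x + y).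
Proof.
apply/subquot_eqP; rewrite !raddfD /= addrACA.
by apply: submodD; exact: subquot_pi_repr.
Qed.

Lemma subquot_oppE x : subquot_opp (subquot_pi x) = subquot_pi (- x).
Proof.
apply/subquot_eqP; rewrite !raddfN /= -opprD.
by apply: submodN; exact: subquot_pi_repr.
Qed.

Lemma subquot_scaleE k x :
  subquot_scale k (subquot_pi x) = subquot_pi (k *: x).
Proof.
apply/subquot_eqP; rewrite !linearZ /= -scalerDr.
by apply: submodZ; exact: subquot_pi_repr.
Qed.

Lemma subquot_ind (P : subquot -> Prop) :
  (forall x, P (subquot_pi x)) -> forall x, P x.
Proof. by move=> Ppi x; rewrite -[x]subquot_reprK. Qed.

Fact subquot_addA : associative subquot_add.
Proof.
by elim/subquot_ind=> x; elim/subquot_ind=> y; elim/subquot_ind=> z;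
   rewrite !subquot_addE addrA.
Qed.
Fact subquot_addC : commutative subquot_add.
Proof.
by elim/subquot_ind=> x; elim/subquot_ind=> y; rewrite !subquot_addE addrC.
Qed.
Fact subquot_add0 : left_id (subquot_pi 0) subquot_add.
Proof. by elim/subquot_ind=> x; rewrite !subquot_addE add0r. Qed.
Fact subquot_addN : left_inverse (subquot_pi 0) subquot_opp subquot_add.
Proof.
by elim/subquot_ind=> x; rewrite subquot_oppE subquot_addE addNr.
Qed.

HB.instance Definition _ := GRing.isZmodule.Build subquot
  subquot_addA subquot_addC subquot_add0 subquot_addN.

Fact subquot_scaleA k l x :
  subquot_scale k (subquot_scale l x) = subquot_scale (k * l) x.
Proof. by elim/subquot_ind: x => x; rewrite !subquot_scaleE scalerA. Qed.
Fact subquot_scale1 : left_id 1 subquot_scale.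
Proof. by elim/subquot_ind=> x; rewrite !subquot_scaleE scale1r. Qed.
Lemma subquot_piD x y : subquot_pi (x + y) = subquot_pi x + subquot_pi y.
Proof. by rewrite -subquot_addE. Qed.

Fact subquot_scaleDr : right_distributive subquot_scale +%R.
Proof.
move=> k; elim/subquot_ind=> x; elim/subquot_ind=> y.
by rewrite -subquot_piD !subquot_scaleE -subquot_piD scalerDr.
Qed.
Fact subquot_scaleDl x : {morph subquot_scale^~ x : k l / k + l}.
Proof.
by elim/subquot_ind: x => x k l; rewrite /= !subquot_scaleE -subquot_piD scalerDl.
Qed.

HB.instance Definition _ := GRing.Zmodule_isLmodule.Build K subquot
  subquot_scaleA subquot_scale1 subquot_scaleDr subquot_scaleDl.

Fact subquot_pi_is_linear : linear subquot_pi.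
Proof.
by move=> k x y; rewrite subquot_piD -subquot_scaleE.
Qed.
HB.instance Definition _ :=
  GRing.isLinear.Build K (subm A) subquot *:%R subquot_pi subquot_pi_is_linear.

(* the class of x : V, with the junk value 0 when x is not in A *)
Definition cls (x : V) : subquot :=
  if insub x is Some u then subquot_pi u else 0.

Definition rep (x : subquot) : V := val (repr x).

Lemma clsE (x : subm A) : cls (val x) = subquot_pi x.
Proof. by rewrite /cls valK. Qed.

Lemma rep_in (x : subquot) : A (rep x).
Proof. exact/submod_predP/valP. Qed.

Lemma repK (x : subquot) : cls (rep x) = x.
Proof. by rewrite clsE subquot_reprK. Qed.

Lemma cls_eqP x y : A x -> A y -> (cls x = cls y <-> B (x - y)).
Proof.
move=> /submod_predP Ax /submod_predP Ay.
by have := subquot_eqP (Subm Ax) (Subm Ay); rewrite -!clsE.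
Qed.

Lemma rep_cls x : A x -> B (rep (cls x) - x).
Proof. by move=> Ax; apply/cls_eqP => //; rewrite ?repK //; exact: rep_in. Qed.

Lemma clsP k x y : A x -> A y -> cls (k *: x + y) = k *: cls x + cls y.
Proof.
move=> /submod_predP Ax /submod_predP Ay.
have -> : k *: x + y = val (k *: Subm Ax + Subm Ay) by rewrite linearP.
by rewrite -[x]/(val (Subm Ax)) -[y in RHS]/(val (Subm Ay)) !clsE linearP.
Qed.

Lemma clsD x y : A x -> A y -> cls (x + y) = cls x + cls y.
Proof. by move=> Ax Ay; rewrite -[x in LHS]scale1r clsP // scale1r. Qed.

Lemma clsZ k x : A x -> cls (k *: x) = k *: cls x.
Proof.
move=> /submod_predP Ax.
have -> : k *: x = val (k *: Subm Ax) by rewrite linearZ.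
by rewrite -[x in RHS]/(val (Subm Ax)) !clsE linearZ.
Qed.

End Subquotient.

Lemma lmod_ext_lin (K : fieldType) (U W : lmodType K) (f : U -> W) :
  linear f -> [/\ f 0 = 0, forall x y, f (x + y) = f x + f y &
                  forall k x, f (k *: x) = k *: f x].
Proof.
move=> fL.
have f0 : f 0 = 0.
  by have := fL (-1) 0 0; rewrite scaler0 addr0 scaleN1r addNr.
split=> // [x y|k x]; first by have := fL 1 x y; rewrite !scale1r.
by have := fL k x 0; rewrite !addr0 f0 addr0.
Qed.

(* Tensor product over a field: formal sums of pairs, two of them being
   identified when every bilinear map into every vector space takes the same
   value on them. *)
Section Tensor.
Variables (K : fieldType) (U V : lmodType K).

Definition bilinear_map (W : lmodType K) (f : U -> V -> W) : Prop :=
  (forall v, linear (f^~ v)) /\ (forall u, linear (f u)).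

Definition fsum (W : lmodType K) (f : U -> V -> W) (s : seq (U * V)) : W :=
  \sum_(x <- s) f x.1 x.2.

Definition tens_rel (s t : seq (U * V)) : bool :=
  `[< forall (W : lmodType K) (f : U -> V -> W),
        bilinear_map f -> fsum f s = fsum f t >].

Fact tens_equiv : equiv_class_of tens_rel.
Proof.
split=> [x|x y|y x z].
- by apply/asboolP.
- by apply: asbool_equiv_eq; split=> h W f fb; rewrite h.
- move=> /asboolP xy /asboolP yz; apply/asboolP => W f fb.
  by rewrite xy // yz.
Qed.

Canonical tens_equiv_rel := EquivRelPack tens_equiv.
Definition tens : Type := {eq_quot tens_equiv_rel}.
HB.instance Definition _ := Choice.on tens.
HB.instance Definition _ := EqQuotient.on tens.

(* the map induced by f on the tensor product, meaningful for bilinear f *)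
Definition tlift (W : lmodType K) (f : U -> V -> W) (x : tens) : W :=
  fsum f (repr x).

Definition tpi (s : seq (U * V)) : tens := \pi s.

Lemma tens_reprK x : tpi (repr x) = x. Proof. exact: reprK. Qed.

Lemma tlift_pi (W : lmodType K) (f : U -> V -> W) s :
  bilinear_map f -> tlift f (tpi s) = fsum f s.
Proof.
move=> fb; have /eqmodP/asboolP : tpi (repr (tpi s)) = tpi s by exact: tens_reprK.
exact.
Qed.

Lemma tens_ext (x y : tens) :
  (forall (W : lmodType K) (f : U -> V -> W),
     bilinear_map f -> tlift f x = tlift f y) -> x = y.
Proof.
by move=> xy; rewrite -[x]tens_reprK -[y]tens_reprK; apply/eqmodP/asboolP.
Qed.

Definition tadd (x y : tens) : tens := tpi (repr x ++ repr y).
Definition topp (x : tens) : tens := tpi [seq (- p.1, p.2) | p <- repr x].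
Definition tscale (k : K) (x : tens) : tens :=
  tpi [seq (k *: p.1, p.2) | p <- repr x].

Lemma tlift_tadd (W : lmodType K) (f : U -> V -> W) x y :
  bilinear_map f -> tlift f (tadd x y) = tlift f x + tlift f y.
Proof. by move=> fb; rewrite tlift_pi // /fsum big_cat. Qed.

Lemma tlift_tscale (W : lmodType K) (f : U -> V -> W) k x :
  bilinear_map f -> tlift f (tscale k x) = k *: tlift f x.
Proof.
move=> fb; rewrite tlift_pi // /fsum big_map scaler_sumr.
by apply: eq_bigr => -[u v] _ /=; case: (lmod_ext_lin (fb.1 v)).
Qed.

Lemma tlift_topp (W : lmodType K) (f : U -> V -> W) x :
  bilinear_map f -> tlift f (topp x) = - tlift f x.
Proof.
move=> fb; rewrite tlift_pi // /fsum big_map -sumrN.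
apply: eq_bigr => -[u v] _ /=; rewrite -scaleN1r -[RHS]scaleN1r.
by case: (lmod_ext_lin (fb.1 v)).
Qed.

Lemma tlift_t0 (W : lmodType K) (f : U -> V -> W) :
  bilinear_map f -> tlift f (tpi [::]) = 0.
Proof. by move=> fb; rewrite tlift_pi // /fsum big_nil. Qed.

Fact taddA : associative tadd.
Proof. by move=> x y z; apply: tens_ext => W f fb; rewrite !tlift_tadd ?addrA. Qed.
Fact taddC : commutative tadd.
Proof. by move=> x y; apply: tens_ext => W f fb; rewrite !tlift_tadd 1?addrC. Qed.
Fact tadd0 : left_id (tpi [::]) tadd.
Proof. by move=> x; apply: tens_ext => W f fb; rewrite tlift_tadd ?tlift_t0 ?add0r. Qed.
Fact taddN : left_inverse (tpi [::]) topp tadd.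
Proof.
by move=> x; apply: tens_ext => W f fb; rewrite tlift_tadd ?tlift_topp ?tlift_t0 ?addNr.
Qed.

HB.instance Definition _ := GRing.isZmodule.Build tens taddA taddC tadd0 taddN.

Lemma tliftD (W : lmodType K) (f : U -> V -> W) x y :
  bilinear_map f -> tlift f (x + y) = tlift f x + tlift f y.
Proof. exact: tlift_tadd. Qed.

Fact tscaleA k l x : tscale k (tscale l x) = tscale (k * l) x.
Proof. by apply: tens_ext => W f fb; rewrite !tlift_tscale ?scalerA. Qed.
Fact tscale1 : left_id 1 tscale.
Proof. by move=> x; apply: tens_ext => W f fb; rewrite tlift_tscale ?scale1r. Qed.
Fact tscaleDr : right_distributive tscale +%R.
Proof.
by move=> k x y; apply: tens_ext => W f fb; rewrite !(tliftD, tlift_tscale) ?scalerDr.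
Qed.
Fact tscaleDl x : {morph tscale^~ x : k l / k + l}.
Proof.
by move=> k l; apply: tens_ext => W f fb; rewrite !(tliftD, tlift_tscale) ?scalerDl.
Qed.

HB.instance Definition _ := GRing.Zmodule_isLmodule.Build K tens
  tscaleA tscale1 tscaleDr tscaleDl.

Lemma tlift_linear (W : lmodType K) (f : U -> V -> W) :
  bilinear_map f -> linear (tlift f).
Proof. by move=> fb k x y; rewrite tliftD //; congr (_ + _); exact: tlift_tscale. Qed.

Definition tpure (u : U) (v : V) : tens := tpi [:: (u, v)].

Lemma tlift_pure (W : lmodType K) (f : U -> V -> W) u v :
  bilinear_map f -> tlift f (tpure u v) = f u v.
Proof. by move=> fb; rewrite tlift_pi // /fsum big_seq1. Qed.

Lemma tpure_bilinear : bilinear_map tpure.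
Proof.
split=> [v|u] k x y; apply: tens_ext => W f fb;
  rewrite tlift_linear // !tlift_pure //; [exact: fb.1 | exact: fb.2].
Qed.

Lemma tens_sum (x : tens) : x = \sum_(p <- repr x) tpure p.1 p.2.
Proof.
apply: tens_ext => W f fb.
have [_ fD _] := lmod_ext_lin (tlift_linear fb).
have [f0 _ _] := lmod_ext_lin (tlift_linear fb).
rewrite (big_morph (tlift f) fD f0) {1}/tlift /fsum.
by apply: eq_bigr => p _; rewrite tlift_pure.
Qed.

Lemma tens_ind (P : tens -> Prop) :
  P 0 -> (forall x y, P x -> P y -> P (x + y)) ->
  (forall u v, P (tpure u v)) -> forall x, P x.
Proof. by move=> P0 PD Pp x; rewrite [x]tens_sum; elim/big_ind: _. Qed.

Lemma tens_eq (W : lmodType K) (f g : tens -> W) :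
  linear f -> linear g ->
  (forall u v, f (tpure u v) = g (tpure u v)) -> forall x, f x = g x.
Proof.
move=> /lmod_ext_lin[f0 fD _] /lmod_ext_lin[g0 gD _] fg.
elim/tens_ind=> [|x y fx fy|//]; first by rewrite f0 g0.
by rewrite fD gD fx fy.
Qed.

End Tensor.

Notation "u \ox v" := (tpure u v) (at level 40, left associativity) : ring_scope.

Section TensorLinearity.
Variables (K : fieldType) (U V : lmodType K).

Lemma tpureDl (x y : U) (z : V) : (x + y) \ox z = x \ox z + y \ox z.
Proof. by case: (lmod_ext_lin ((tpure_bilinear U V).1 z)). Qed.
Lemma tpureZl k (x : U) (z : V) : (k *: x) \ox z = k *: (x \ox z).
Proof. by case: (lmod_ext_lin ((tpure_bilinear U V).1 z)). Qed.
Lemma tpureDr (z : U) (x y : V) : z \ox (x + y) = z \ox x + z \ox y.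
Proof. by case: (lmod_ext_lin ((tpure_bilinear U V).2 z)). Qed.
Lemma tpureZr k (z : U) (x : V) : z \ox (k *: x) = k *: (z \ox x).
Proof. by case: (lmod_ext_lin ((tpure_bilinear U V).2 z)). Qed.
Lemma tpure0l (z : V) : (0 : U) \ox z = 0.
Proof. by case: (lmod_ext_lin ((tpure_bilinear U V).1 z)). Qed.
Definition tpureE := (tpureDl, tpureZl, tpureDr, tpureZr).

End TensorLinearity.

Section TensorMap.
Variables (K : fieldType) (U V U' V' : lmodType K).

(* the map f (x) g, meaningful for linear f and g *)
Definition tmap (f : U -> U') (g : V -> V') : tens U V -> tens U' V' :=
  tlift (fun u v => f u \ox g v).

Lemma tmap_bilinear (f : U -> U') (g : V -> V') :
  linear f -> linear g -> bilinear_map (fun u v => f u \ox g v).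
Proof.
move=> fL gL; split=> [v|u] k x y.
  by rewrite fL; exact: (tpure_bilinear _ _).1.
by rewrite gL; exact: (tpure_bilinear _ _).2.
Qed.

Lemma tmap_pure (f : U -> U') (g : V -> V') u v :
  linear f -> linear g -> tmap f g (u \ox v) = f u \ox g v.
Proof. by move=> fL gL; rewrite /tmap tlift_pure //; exact: tmap_bilinear. Qed.

Lemma tmap_linear (f : U -> U') (g : V -> V') :
  linear f -> linear g -> linear (tmap f g).
Proof. by move=> fL gL; apply: tlift_linear; exact: tmap_bilinear. Qed.

End TensorMap.

Definition tassoc (K : fieldType) (U V W : lmodType K) :
    tens (tens U V) W -> tens U (tens V W) :=
  tlift (fun x w => tlift (fun u v => u \ox (v \ox w)) x).

(* Algebras with a character; the character is the counit in the examples *)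
HB.mixin Record isAugmented (K : fieldType) A of GRing.Algebra K A := {
  counit : A -> K^o ;
  counit_linear : linear counit ;
  counit_monoid : monoid_morphism counit }.

#[short(type="augAlgType")]
HB.structure Definition AugAlgebra (K : fieldType) :=
  { A of GRing.Algebra K A & isAugmented K A }.

HB.instance Definition _ (K : fieldType) (A : augAlgType K) :=
  GRing.isLinear.Build K A K^o *:%R (@counit K A) (@counit_linear K A).
HB.instance Definition _ (K : fieldType) (A : augAlgType K) :=
  GRing.isMonoidMorphism.Build A K^o (@counit K A) (@counit_monoid K A).

Section TensorAlgebra.
Variables (K : fieldType) (A B : augAlgType K).
Local Notation T := (tens A B).

Definition tmul (x y : T) : T :=
  tlift (fun a b => tlift (fun a' b' => (a * a') \ox (b * b')) y) x.

Fact tmul_bil1 (a : A) (b : B) :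
  bilinear_map (fun a' b' => (a * a') \ox (b * b')).
Proof.
split=> [v|u] k x y; rewrite mulrDr -scalerAr;
  [exact: (tpure_bilinear _ _).1 | exact: (tpure_bilinear _ _).2].
Qed.

Fact tmul_bil2 (y : T) :
  bilinear_map (fun a b => tlift (fun a' b' => (a * a') \ox (b * b')) y).
Proof.
split=> [v|u] k x z; rewrite /tlift /fsum scaler_sumr -big_split;
  apply: eq_bigr => -[a b] _ /=; rewrite mulrDl -scalerAl;
  [exact: (tpure_bilinear _ _).1 | exact: (tpure_bilinear _ _).2].
Qed.

Lemma tmul_pure a b a' b' :
  tmul (a \ox b) (a' \ox b') = (a * a') \ox (b * b').
Proof.
by rewrite /tmul tlift_pure; [rewrite tlift_pure //; exact: tmul_bil1 | exact: tmul_bil2].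
Qed.

Lemma tmul_linl y : linear (tmul^~ y).
Proof. by apply: tlift_linear; exact: tmul_bil2. Qed.

Lemma tmul_linr x : linear (tmul x).
Proof.
move=> k y z; rewrite /tmul /tlift /fsum scaler_sumr -big_split.
by apply: eq_bigr => -[a b] _ /=; apply: (tlift_linear (tmul_bil1 a b)).
Qed.

Let linD (U W : lmodType K) (f : U -> W) (fL : linear f) x y :
  f (x + y) = f x + f y.
Proof. by case: (lmod_ext_lin fL). Qed.
Let lin0 (U W : lmodType K) (f : U -> W) (fL : linear f) : f 0 = 0.
Proof. by case: (lmod_ext_lin fL). Qed.
Let linZ (U W : lmodType K) (f : U -> W) (fL : linear f) k x :
  f (k *: x) = k *: f x.
Proof. by case: (lmod_ext_lin fL). Qed.

Fact tmulDl : left_distributive tmul +%R.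
Proof. by move=> x y z; exact: (linD (tmul_linl z)). Qed.
Fact tmulDr : right_distributive tmul +%R.
Proof. by move=> x y z; exact: (linD (tmul_linr x)). Qed.
Fact tmul0l x : tmul 0 x = 0. Proof. exact: (lin0 (tmul_linl x)). Qed.
Fact tmul0r x : tmul x 0 = 0. Proof. exact: (lin0 (tmul_linr x)). Qed.

Fact tmulA : associative tmul.
Proof.
move=> x y z.
elim/tens_ind: x => [|x x' hx hx'|a b]; rewrite ?tmul0l // ?tmulDl.
  by rewrite hx hx'.
elim/tens_ind: y => [|y y' hy hy'|a' b'].
- by rewrite tmul0l !tmul0r tmul0l.
- by rewrite tmulDl !tmulDr tmulDl hy hy'.
elim/tens_ind: z => [|z z' hz hz'|a'' b'']; rewrite ?tmul0r // ?tmulDr.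
  by rewrite hz hz'.
by rewrite !tmul_pure !mulrA.
Qed.

Fact tmul1l : left_id (1 \ox 1) tmul.
Proof.
move=> x; elim/tens_ind: x => [|x y hx hy|a b]; rewrite ?tmul0r ?tmulDr ?hx ?hy //.
by rewrite tmul_pure !mul1r.
Qed.

Fact tmul1r : right_id (1 \ox 1) tmul.
Proof.
move=> x; elim/tens_ind: x => [|x y hx hy|a b]; rewrite ?tmul0l ?tmulDl ?hx ?hy //.
by rewrite tmul_pure !mulr1.
Qed.

Definition tcounit : T -> K^o := tlift (fun a b => counit a * counit b : K^o).

Fact tcounit_bil : bilinear_map (fun (a : A) (b : B) => counit a * counit b : K^o).
Proof.
split=> [v|u] k x y; first by rewrite linearP mulrDl -scalerAl.
by rewrite linearP mulrDr -scalerAr.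
Qed.

Lemma tcounit_pure a b : tcounit (a \ox b) = counit a * counit b.
Proof. by rewrite /tcounit tlift_pure //; exact: tcounit_bil. Qed.

Fact tcounit_linear : linear tcounit.
Proof. by apply: tlift_linear; exact: tcounit_bil. Qed.

Fact tens_one_neq0 : (1 : A) \ox (1 : B) != 0.
Proof.
apply/eqP => /(congr1 tcounit); rewrite tcounit_pure !rmorph1 mulr1.
by rewrite (lin0 tcounit_linear) => /eqP; rewrite oner_eq0.
Qed.

HB.instance Definition _ := GRing.Zmodule_isNzRing.Build T
  tmulA tmul1l tmul1r tmulDl tmulDr tens_one_neq0.

Lemma tmulE a b a' b' : (a \ox b : T) * (a' \ox b') = (a * a') \ox (b * b').
Proof. exact: tmul_pure. Qed.

Lemma toneE : (1 : T) = 1 \ox 1. Proof. by []. Qed.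

Fact tscaleAl (k : K) (x y : T) : k *: (x * y) = (k *: x) * y.
Proof. by rewrite -[RHS]/(tmul _ _) (linZ (tmul_linl y)). Qed.
Fact tscaleAr (k : K) (x y : T) : k *: (x * y) = x * (k *: y).
Proof. by rewrite -[RHS]/(tmul _ _) (linZ (tmul_linr x)). Qed.

HB.instance Definition _ := GRing.Lmodule_isLalgebra.Build K T tscaleAl.
HB.instance Definition _ := GRing.Lalgebra_isAlgebra.Build K T tscaleAr.

Fact tcounit_monoid : monoid_morphism tcounit.
Proof.
split=> [|x y]; first by rewrite toneE tcounit_pure !rmorph1 mulr1.
have tD := linD tcounit_linear; have t0 := lin0 tcounit_linear.
elim/tens_ind: x => [|x x' hx hx'|a b]; rewrite ?mul0r ?t0 ?mul0r ?mulrDl ?tD //.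
  by rewrite hx hx' mulrDl.
elim/tens_ind: y => [|y y' hy hy'|a' b']; rewrite ?mulr0 ?t0 ?mulr0 ?mulrDr ?tD //.
  by rewrite hy hy' mulrDr.
by rewrite tmulE !tcounit_pure !rmorphM mulrACA.
Qed.

HB.instance Definition _ :=
  isAugmented.Build K T tcounit_linear tcounit_monoid.

End TensorAlgebra.

Lemma tmap_monoid (K : fieldType) (A B A' B' : augAlgType K)
    (f : {lrmorphism A -> A'}) (g : {lrmorphism B -> B'}) :
  monoid_morphism (tmap f g : tens A B -> tens A' B').
Proof.
have [t0 tD _] := lmod_ext_lin (tmap_linear (linearP f) (linearP g)).
have tp u v : tmap f g (u \ox v) = f u \ox g v.
  by apply: tmap_pure; exact: linearP.
split=> [|x y]; first by rewrite toneE tp !rmorph1.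
elim/tens_ind: x => [|x x' hx hx'|a b]; rewrite ?mul0r ?t0 ?mul0r ?mulrDl ?tD //.
  by rewrite hx hx' mulrDl.
elim/tens_ind: y => [|y y' hy hy'|a' b']; rewrite ?mulr0 ?t0 ?mulr0 ?mulrDr ?tD //.
  by rewrite hy hy' mulrDr.
by rewrite tmulE !tp tmulE !rmorphM.
Qed.

(* the opposite algebra *)
Section OppositeAlgebra.
Variables (K : fieldType) (A : algType K).

Fact conv_scaleA (k l : K) (x : A) : k *: (l *: x) = (k * l) *: x.
Proof. exact: scalerA. Qed.
HB.instance Definition _ := GRing.Zmodule_isLmodule.Build K A^c
  conv_scaleA (@scale1r K A) (@scalerDr K A) (@scalerDl K A).
Fact conv_scaleAl (k : K) (x y : A^c) : k *: (x * y) = (k *: x) * y.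
Proof. exact: (@scalerAr K A k y x). Qed.
Fact conv_scaleAr (k : K) (x y : A^c) : k *: (x * y) = x * (k *: y).
Proof. exact: (@scalerAl K A k y x). Qed.
HB.instance Definition _ := GRing.Lmodule_isLalgebra.Build K A^c conv_scaleAl.
HB.instance Definition _ := GRing.Lalgebra_isAlgebra.Build K A^c conv_scaleAr.

End OppositeAlgebra.

(* Unital associative algebras presented by generators and relations *)
Inductive term (K I : Type) :=
  | Gen of I | Cst of K
  | Add of term K I & term K I | Mul of term K I & term K I.
Arguments Gen {K I}. Arguments Cst {K I}.
Arguments Add {K I}. Arguments Mul {K I}.
Definition term_rel K I := (term K I * term K I)%type.

HB.instance Definition _ (K I : Type) := gen_eqMixin (term K I).
HB.instance Definition _ (K I : Type) := gen_choiceMixin (term K I).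

Section Eval.
Variables (K : fieldType) (I : Type) (A : algType K) (v : I -> A).

Fixpoint eval (t : term K I) : A :=
  match t with
  | Gen i => v i
  | Cst k => k%:A
  | Add s t => eval s + eval t
  | Mul s t => eval s * eval t
  end.

Fixpoint satisfies (rels : seq (term_rel K I)) : Prop :=
  if rels is r :: rels' then eval r.1 = eval r.2 /\ satisfies rels' else True.

End Eval.

(* the last two fields say that the presented algebra has a character *)
Record presentation (K : fieldType) := Presentation {
  generator : Type ;
  relations : seq (term_rel K generator) ;
  character : generator -> K^o ;
  characterP : satisfies character relations }.

(* Two terms are identified when they take the same value in every algebra in
   which the relations hold. *)
Section PresentedAlgebra.
Variables (K : fieldType) (D : presentation K).
Local Notation I := (generator D).
Local Notation rels := (relations D).

Definition palg_rel (s t : term K I) : bool :=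
  `[< forall (A : algType K) (v : I -> A),
        satisfies v rels -> eval v s = eval v t >].

Fact palg_equiv : equiv_class_of palg_rel.
Proof.
split=> [x|x y|y x z].
- by apply/asboolP.
- by apply: asbool_equiv_eq; split=> h A v hv; rewrite h.
- move=> /asboolP xy /asboolP yz; apply/asboolP => A v hv.
  by rewrite xy // yz.
Qed.

Canonical palg_equiv_rel := EquivRelPack palg_equiv.
Definition palg : Type := {eq_quot palg_equiv_rel}.
HB.instance Definition _ := Choice.on palg.
HB.instance Definition _ := EqQuotient.on palg.

Definition palg_pi (t : term K I) : palg := \pi t.
Definition gen (i : I) : palg := palg_pi (Gen i).

(* the map sending each generator i to v i; it is a morphism of algebras when
   v satisfies the relations *)
Definition palg_lift (A : algType K) (v : I -> A) (x : palg) : A :=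
  eval v (repr x).

Lemma palg_reprK x : palg_pi (repr x) = x. Proof. exact: reprK. Qed.

Lemma palg_lift_pi (A : algType K) (v : I -> A) t :
  satisfies v rels -> palg_lift v (palg_pi t) = eval v t.
Proof.
by move=> hv; have /eqmodP/asboolP := palg_reprK (palg_pi t); exact.
Qed.

Lemma palg_ext (x y : palg) :
  (forall (A : algType K) (v : I -> A),
     satisfies v rels -> palg_lift v x = palg_lift v y) -> x = y.
Proof.
by move=> xy; rewrite -[x]palg_reprK -[y]palg_reprK; apply/eqmodP/asboolP.
Qed.

Definition padd (x y : palg) := palg_pi (Add (repr x) (repr y)).
Definition pmul (x y : palg) := palg_pi (Mul (repr x) (repr y)).
Definition pscale (k : K) (x : palg) := palg_pi (Mul (Cst k) (repr x)).

Section LiftOps.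
Variables (A : algType K) (v : I -> A) (hv : satisfies v rels).
Lemma lift_cst k : palg_lift v (palg_pi (Cst k)) = k%:A.
Proof. by rewrite palg_lift_pi. Qed.
Lemma lift_padd x y : palg_lift v (padd x y) = palg_lift v x + palg_lift v y.
Proof. by rewrite palg_lift_pi. Qed.
Lemma lift_pmul x y : palg_lift v (pmul x y) = palg_lift v x * palg_lift v y.
Proof. by rewrite palg_lift_pi. Qed.
Lemma lift_pscale k x : palg_lift v (pscale k x) = k *: palg_lift v x.
Proof. by rewrite palg_lift_pi //= -scalerAl mul1r. Qed.
Definition liftE := (lift_cst, lift_padd, lift_pmul, lift_pscale).
End LiftOps.

Fact paddA : associative padd.
Proof. by move=> x y z; apply: palg_ext => A v hv; rewrite !(liftE hv) addrA. Qed.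
Fact paddC : commutative padd.
Proof. by move=> x y; apply: palg_ext => A v hv; rewrite !(liftE hv) addrC. Qed.
Fact padd0 : left_id (palg_pi (Cst 0)) padd.
Proof. by move=> x; apply: palg_ext => A v hv; rewrite !(liftE hv) scale0r add0r. Qed.
Fact paddN : left_inverse (palg_pi (Cst 0)) (pscale (-1)) padd.
Proof.
by move=> x; apply: palg_ext => A v hv; rewrite !(liftE hv) scale0r scaleN1r addNr.
Qed.
HB.instance Definition _ := GRing.isZmodule.Build palg paddA paddC padd0 paddN.

Fact pmulA : associative pmul.
Proof. by move=> x y z; apply: palg_ext => A v hv; rewrite !(liftE hv) mulrA. Qed.
Fact pmul1l : left_id (palg_pi (Cst 1)) pmul.
Proof. by move=> x; apply: palg_ext => A v hv; rewrite !(liftE hv) scale1r mul1r. Qed.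
Fact pmul1r : right_id (palg_pi (Cst 1)) pmul.
Proof. by move=> x; apply: palg_ext => A v hv; rewrite !(liftE hv) scale1r mulr1. Qed.
Fact pmulDl : left_distributive pmul padd.
Proof. by move=> x y z; apply: palg_ext => A v hv; rewrite !(liftE hv) mulrDl. Qed.
Fact pmulDr : right_distributive pmul padd.
Proof. by move=> x y z; apply: palg_ext => A v hv; rewrite !(liftE hv) mulrDr. Qed.
Fact pone_neq0 : palg_pi (Cst 1) != palg_pi (Cst 0).
Proof.
apply/eqP => /(congr1 (palg_lift (@character _ D))).
rewrite !(lift_cst (@characterP _ D)) scale0r scale1r => /eqP.
by rewrite oner_eq0.
Qed.
HB.instance Definition _ := GRing.Zmodule_isNzRing.Build palg
  pmulA pmul1l pmul1r pmulDl pmulDr pone_neq0.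

Fact pscaleA k l x : pscale k (pscale l x) = pscale (k * l) x.
Proof. by apply: palg_ext => A v hv; rewrite !(liftE hv) scalerA. Qed.
Fact pscale1 : left_id 1 pscale.
Proof. by move=> x; apply: palg_ext => A v hv; rewrite !(liftE hv) scale1r. Qed.
Fact pscaleDr : right_distributive pscale padd.
Proof. by move=> k x y; apply: palg_ext => A v hv; rewrite !(liftE hv) scalerDr. Qed.
Fact pscaleDl x : {morph pscale^~ x : k l / k + l >-> padd k l}.
Proof. by move=> k l; apply: palg_ext => A v hv; rewrite !(liftE hv) scalerDl. Qed.
HB.instance Definition _ := GRing.Zmodule_isLmodule.Build K palg
  pscaleA pscale1 pscaleDr pscaleDl.

Fact pscaleAl k (x y : palg) : pscale k (pmul x y) = pmul (pscale k x) y.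
Proof. by apply: palg_ext => A v hv; rewrite !(liftE hv) scalerAl. Qed.
HB.instance Definition _ := GRing.Lmodule_isLalgebra.Build K palg pscaleAl.
Fact pscaleAr k (x y : palg) : pscale k (pmul x y) = pmul x (pscale k y).
Proof. by apply: palg_ext => A v hv; rewrite !(liftE hv) scalerAr. Qed.
HB.instance Definition _ := GRing.Lalgebra_isAlgebra.Build K palg pscaleAr.

Lemma palg_lift_linear (A : algType K) (v : I -> A) :
  satisfies v rels -> linear (palg_lift v).
Proof.
by move=> hv k x y; rewrite -[k *: x + y]/(padd (pscale k x) y) !(liftE hv).
Qed.

Lemma palg_lift_monoid (A : algType K) (v : I -> A) :
  satisfies v rels -> monoid_morphism (palg_lift v).
Proof.
move=> hv; split=> [|x y]; last exact: lift_pmul.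
by rewrite -[1]/(palg_pi (Cst 1)) lift_cst // scale1r.
Qed.

Lemma palg_lift_gen (A : algType K) (v : I -> A) i :
  satisfies v rels -> palg_lift v (gen i) = v i.
Proof. by move=> hv; rewrite palg_lift_pi. Qed.

Definition palg_counit : palg -> K^o := palg_lift (@character _ D).
HB.instance Definition _ := isAugmented.Build K palg
  (palg_lift_linear (@characterP _ D)) (palg_lift_monoid (@characterP _ D)).

Lemma eval_gen t : eval gen t = palg_pi t.
Proof.
apply: palg_ext => A v hv; rewrite palg_lift_pi //.
have [l0 lD lZ] := lmod_ext_lin (palg_lift_linear hv).
have [l1 lM] := palg_lift_monoid hv.
by elim: t => [i|k|s hs t ht|s hs t ht] /=;
  rewrite ?palg_lift_gen ?lZ ?l1 ?lD ?lM ?hs ?ht.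
Qed.

Lemma gen_satisfies : satisfies gen rels.
Proof.
suff: forall r, (forall (A : algType K) (v : I -> A),
    satisfies v rels -> satisfies v r) -> satisfies gen r by exact.
elim=> //= -[s t] r ih h; split=> /=; last by apply: ih => A v /h[].
rewrite !eval_gen; apply: palg_ext => A v hv; rewrite !palg_lift_pi //.
by case: (h _ _ hv).
Qed.

Lemma palg_lift_unique (A : algType K) (f : {lrmorphism palg -> A}) x :
  f x = palg_lift (fun i => f (gen i)) x.
Proof.
rewrite -[in LHS](palg_reprK x) -eval_gen /palg_lift; elim: (repr x) => //=.
- by move=> k; rewrite linearZ rmorph1.
- by move=> s hs t ht; rewrite rmorphD /= hs ht.
- by move=> s hs t ht; rewrite rmorphM /= hs ht.
Qed.

End PresentedAlgebra.

(* [lmod_eq] reduces an equality of linear combinations in a module to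
   equalities of the coefficients *)
Section LinearCombinations.
Variables (K : nzRingType) (V : lmodType K).

Inductive lexp :=
  | LAtom of nat | LZero | LAdd of lexp & lexp | LOpp of lexp
  | LScale of K & lexp.

Fixpoint leval (env : seq V) (e : lexp) : V :=
  match e with
  | LAtom n => nth 0 env n
  | LZero => 0
  | LAdd e f => leval env e + leval env f
  | LOpp e => - leval env e
  | LScale k e => k *: leval env e
  end.

Fixpoint lcoef (i : nat) (e : lexp) : K :=
  match e with
  | LAtom n => if Nat.eqb n i then 1 else 0
  | LZero => 0
  | LAdd e f => lcoef i e + lcoef i f
  | LOpp e => - lcoef i e
  | LScale k e => k * lcoef i e
  end.

Fixpoint lcoef_eq (n : nat) (e f : lexp) : Prop :=
  if n is n'.+1 then lcoef n' e = lcoef n' f /\ lcoef_eq n' e f else True.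

Lemma levalE env e :
  leval env e = \sum_(i < size env) lcoef i e *: nth 0 env i.
Proof.
elim: e => [n||e he f hf|e he|k e he] /=.
- have [lt_n|ge_n] := ltnP n (size env).
    rewrite (bigD1 (Ordinal lt_n)) //= PeanoNat.Nat.eqb_refl scale1r.
    rewrite big1 ?addr0 // => i /eqP ni.
    case: PeanoNat.Nat.eqb_spec => [e|_]; last by rewrite scale0r.
    by case: ni; apply: val_inj; rewrite /= e.
  rewrite nth_default // big1 // => i _.
  case: PeanoNat.Nat.eqb_spec => [e|_]; last by rewrite scale0r.
  by have := ltn_ord i; rewrite -e ltnNge ge_n.
- by rewrite big1 // => i _; rewrite scale0r.
- by rewrite he hf -big_split; apply: eq_bigr => i _; rewrite scalerDl.
- by rewrite he -sumrN; apply: eq_bigr => i _; rewrite scaleNr.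
- by rewrite he scaler_sumr; apply: eq_bigr => i _; rewrite scalerA.
Qed.

Lemma leval_eq env e f :
  lcoef_eq (size env) e f -> leval env e = leval env f.
Proof.
move=> ef; rewrite !levalE; apply: eq_bigr => i _; congr (_ *: _).
elim: (size env) i ef => [[]//|n ih] [i /=]; rewrite ltnS leq_eqVlt => /orP.
by move=> [/eqP->[]//|lt_i] [_]; exact: (ih (Ordinal lt_i)).
Qed.

End LinearCombinations.

(* compares atoms up to the choice of the structures on their types *)
Ltac lmod_same x y :=
  lazymatch x with
  | y => constr:(true)
  | @GRing.one _ =>
      lazymatch y with @GRing.one _ => constr:(true) | _ => constr:(false) end
  | GRing.mul ?a ?b =>
      lazymatch y with
      | GRing.mul ?c ?d =>
          lazymatch lmod_same a c with
          | true => lmod_same b d | false => constr:(false) end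
      | _ => constr:(false)
      end
  | tpure ?a ?b =>
      lazymatch y with
      | tpure ?c ?d =>
          lazymatch lmod_same a c with
          | true => lmod_same b d | false => constr:(false) end
      | _ => constr:(false)
      end
  | _ => constr:(false)
  end.
Ltac lmod_mem x env :=
  lazymatch env with
  | nil => constr:(false)
  | cons ?y ?env' =>
      lazymatch lmod_same x y with
      | true => constr:(true)
      | false => lmod_mem x env'
      end
  end.
Ltac lmod_atoms env e :=
  lazymatch e with
  | GRing.add ?x ?y => let env' := lmod_atoms env x in lmod_atoms env' y
  | GRing.opp ?x => lmod_atoms env x
  | GRing.scale _ ?x => lmod_atoms env x
  | @GRing.zero _ => env
  | _ => lazymatch lmod_mem e env with
         | true => env
         | false => constr:(cons e env)
         end
  end.
Ltac lmod_index x env :=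
  lazymatch env with
  | cons ?y ?env' =>
      lazymatch lmod_same x y with
      | true => constr:(0%N)
      | false => let n := lmod_index x env' in constr:(S n)
      end
  end.
Ltac lmod_reify K env e :=
  lazymatch e with
  | GRing.add ?x ?y =>
      let x' := lmod_reify K env x in
      let y' := lmod_reify K env y in constr:(LAdd x' y')
  | GRing.opp ?x => let x' := lmod_reify K env x in constr:(LOpp x')
  | GRing.scale ?k ?x =>
      let x' := lmod_reify K env x in constr:(@LScale K k x')
  | @GRing.zero _ => constr:(@LZero K)
  | _ => let n := lmod_index e env in constr:(@LAtom K n)
  end.
Ltac lmod_eq K :=
  lazymatch goal with
  | |- @eq ?V ?x ?y =>
      let env := lmod_atoms (@nil V) x in
      let env := lmod_atoms env y in
      let x' := lmod_reify K env x in
      let y' := lmod_reify K env y in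
      let H := fresh "H" in
      have H := @leval_eq K _ env x' y';
      cbn [leval nth lcoef_eq lcoef Nat.eqb size] in H;
      apply H; clear H; repeat split
  end.

(* the coproducts of SU_q(2) and U_q(su(2)) preserve the relations *)
Section CoproductRelations.
Variables (K : fieldType) (A : augAlgType K) (q : K).
Hypothesis q0 : q != 0.

Lemma Delta_relations (a b c d : A) :
  b * a = q^-1 *: (a * b) -> c * a = q^-1 *: (a * c) ->
  d * b = q^-1 *: (b * d) -> d * c = q^-1 *: (c * d) ->
  c * b = b * c -> a * d = 1 + q *: (b * c) -> d * a = 1 + q^-1 *: (b * c) ->
  let a' := a \ox a + b \ox c in let b' := a \ox b + b \ox d in
  let c' := c \ox a + d \ox c in let d' := c \ox b + d \ox d in
  a' * b' = q *: (b' * a') /\ a' * c' = q *: (c' * a') /\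
  b' * d' = q *: (d' * b') /\ c' * d' = q *: (d' * c') /\
  b' * c' = c' * b' /\ a' * d' - d' * a' = (q - q^-1) *: (b' * c') /\
  a' * d' = 1 + q *: (b' * c').
Proof.
move=> ba ca db dc cb ad da /=.
have E := (ba, ca, db, dc, cb, ad, da, @tpureE _ A A).
do 6?split; rewrite !(mulrDl, mulrDr) ?tmulE ?toneE !E.
all: by lmod_eq K; field.
Qed.

Lemma uDelta_relations (k ki e f : A) :
  k * ki = 1 -> ki * k = 1 -> k * e = q *: (e * k) -> ki * e = q^-1 *: (e * ki) ->
  k * f = q^-1 *: (f * k) -> ki * f = q *: (f * ki) ->
  e * f = f * e + (q - q^-1)^-1 *: (k * k - ki * ki) ->
  let k' := k \ox k in let ki' := ki \ox ki in
  let e' := e \ox k + ki \ox e in let f' := f \ox k + ki \ox f in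
  k' * ki' = 1 /\ ki' * k' = 1 /\ k' * e' = q *: (e' * k') /\
  ki' * e' = q^-1 *: (e' * ki') /\ k' * f' = q^-1 *: (f' * k') /\
  ki' * f' = q *: (f' * ki') /\
  e' * f' - f' * e' = (q - q^-1)^-1 *: (k' * k' - ki' * ki').
Proof.
set r := (_ - _)^-1 => h1 h2 ke kie kf kif ef /=.
have eki : e * ki = q *: (ki * e) by rewrite kie scalerA mulfV // scale1r.
have ek : e * k = q^-1 *: (k * e) by rewrite ke scalerA mulVf // scale1r.
have fki : f * ki = q^-1 *: (ki * f) by rewrite kif scalerA mulVf // scale1r.
have fk : f * k = q *: (k * f) by rewrite kf scalerA mulfV // scale1r.
have E := (ek, eki, fk, fki, ef, h1, h2, @tpureE _ A A).
clearbody r; do 6?split;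
  rewrite ?(mulrDl, mulrDr) ?tmulE ?toneE ?E -?scaleN1r ?E //.
all: by lmod_eq K; field.
Qed.

End CoproductRelations.

Record deformation (R : realType) := Deformation {
  qval :> R ;
  qval_range : 0 < qval < 1 }.

Declare Scope pterm_scope.
Delimit Scope pterm_scope with pt.
Notation "s + t" := (Add s t) : pterm_scope.
Notation "s * t" := (Mul s t) : pterm_scope.
Notation "s - t" := (Add s (Mul (Cst (-1)) t)) : pterm_scope.

Section Scalars.
Variables (R : realType) (q : deformation R).

Definition qC : R[i] := (qval q)%:C.
Definition sqrt_qC : R[i] := (Num.sqrt (qval q))%:C.
Definition mu : R[i] := qC + qC^-1.
Definition nu : R[i] := qC - qC^-1.

Lemma qC_neq0 : qC != 0.
Proof.
by rewrite /qC eq_complex /= eqxx andbT gt_eqF //; case/andP: (qval_range q).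
Qed.

End Scalars.

Inductive su2_gen := Ga | Gb | Gc | Gd.
Inductive u1_gen := Gt | Gti.
Inductive uq_gen := GK | GKi | GE | GF.

Section Presentations.
Variables (R : realType) (q : deformation R).
Local Notation C := R[i].
Local Notation q' := (qC q).

Definition su2_relations : seq (term_rel C su2_gen) :=
  let a := Gen Ga in let b := Gen Gb in let c := Gen Gc in let d := Gen Gd in
  [:: (a * b, Cst q' * (b * a)); (a * c, Cst q' * (c * a));
      (b * d, Cst q' * (d * b)); (c * d, Cst q' * (d * c));
      (b * c, c * b); (a * d - d * a, Cst (q' - q'^-1)%R * (b * c));
      (a * d, Cst 1 + Cst q' * (b * c))]%pt.

Definition su2_character (g : su2_gen) : C^o :=
  match g with Ga | Gd => 1 | Gb | Gc => 0 end.

Fact su2_characterP : satisfies su2_character su2_relations.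
Proof. by rewrite /= !(mul0r, mulr0, mulr1, addr0, scale1r, scaleN1r, subrr). Qed.

Definition su2_presentation := Presentation su2_characterP.

Definition u1_relations : seq (term_rel C u1_gen) :=
  let t := Gen Gt in let ti := Gen Gti in
  [:: (t * ti, Cst 1); (ti * t, Cst 1)]%pt.

Fact u1_characterP : satisfies (fun=> 1 : C^o) u1_relations.
Proof. by rewrite /= mulr1 scale1r. Qed.

Definition u1_presentation := Presentation u1_characterP.

Definition uq_relations : seq (term_rel C uq_gen) :=
  let K := Gen GK in let Ki := Gen GKi in
  let E := Gen GE in let F := Gen GF in
  [:: (K * Ki, Cst 1); (Ki * K, Cst 1);
      (K * E, Cst q' * (E * K)); (Ki * E, Cst q'^-1 * (E * Ki));
      (K * F, Cst q'^-1 * (F * K)); (Ki * F, Cst q' * (F * Ki));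
      (E * F - F * E, Cst (q' - q'^-1)^-1%R * (K * K - Ki * Ki))]%pt.

Definition uq_character (g : uq_gen) : C^o :=
  match g with GK | GKi => 1 | GE | GF => 0 end.

Fact uq_characterP : satisfies uq_character uq_relations.
Proof.
by rewrite /= !(mul0r, mulr0, mulr1, addr0, scale1r, scaleN1r, subrr).
Qed.

Definition uq_presentation := Presentation uq_characterP.

End Presentations.

(* A[SU_q(2)], A[U(1)] and U_q(su(2)); the characters are the counits *)
Notation SUq2 q := (palg (su2_presentation q)).
Notation U1 R := (palg (u1_presentation R)).
Notation Uqsu2 q := (palg (uq_presentation q)).

Section HopfStructures.
Variables (R : realType) (q : deformation R).
Local Notation C := R[i].
Local Notation q' := (qC q).
Local Notation P := (SUq2 q).
Local Notation H := (U1 R).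
Local Notation U := (Uqsu2 q).

Definition pa : P := gen (D := su2_presentation q) Ga.
Definition pb : P := gen (D := su2_presentation q) Gb.
Definition pc : P := gen (D := su2_presentation q) Gc.
Definition pd : P := gen (D := su2_presentation q) Gd.
Definition ht : H := gen (D := u1_presentation R) Gt.
Definition hti : H := gen (D := u1_presentation R) Gti.
Definition uK : U := gen (D := uq_presentation q) GK.
Definition uKi : U := gen (D := uq_presentation q) GKi.
Definition uE : U := gen (D := uq_presentation q) GE.
Definition uF : U := gen (D := uq_presentation q) GF.

Lemma su2_relE :
  [/\ pb * pa = q'^-1 *: (pa * pb), pc * pa = q'^-1 *: (pa * pc),
      pd * pb = q'^-1 *: (pb * pd), pd * pc = q'^-1 *: (pc * pd) &
  [/\ pc * pb = pb * pc, pa * pd = 1 + q' *: (pb * pc) &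
      pd * pa = 1 + q'^-1 *: (pb * pc)]].
Proof.
have [h1 [h2 [h3 [h4 [h5 [h6 [h7 _]]]]]]] := gen_satisfies (su2_presentation q).
have cstM (k : C) (x : P) : k%:A * x = k *: x by rewrite -scalerAl mul1r.
have qK (x : P) : q'^-1 *: (q' *: x) = x.
  by rewrite scalerA mulVf ?qC_neq0 // scale1r.
have {}h1 : pa * pb = q' *: (pb * pa) by rewrite -cstM.
have {}h2 : pa * pc = q' *: (pc * pa) by rewrite -cstM.
have {}h3 : pb * pd = q' *: (pd * pb) by rewrite -cstM.
have {}h4 : pc * pd = q' *: (pd * pc) by rewrite -cstM.
have {}h6 : pa * pd - pd * pa = (q' - q'^-1) *: (pb * pc).
  by rewrite -cstM -scaleN1r -cstM.
have {}h7 : pa * pd = 1 + q' *: (pb * pc).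
  by rewrite -cstM -[X in X + _]scale1r; exact: h7.
have h8 : pd * pa = pa * pd - (q' - q'^-1) *: (pb * pc).
  by rewrite -h6 opprB addrC subrK.
rewrite h1 h2 h3 h4 !qK; split=> //; split=> //.
by rewrite h8 h7; lmod_eq (R[i]); ring.
Qed.

Lemma cstM (A : algType C) (k : C) (x : A) : k%:A * x = k *: x.
Proof. by rewrite -scalerAl mul1r. Qed.

Lemma uq_relE :
  [/\ uK * uKi = 1, uKi * uK = 1, uK * uE = q' *: (uE * uK),
      uKi * uE = q'^-1 *: (uE * uKi) &
  [/\ uK * uF = q'^-1 *: (uF * uK), uKi * uF = q' *: (uF * uKi) &
      uE * uF = uF * uE + (q' - q'^-1)^-1 *: (uK * uK - uKi * uKi)]].
Proof.
have [h1 [h2 [h3 [h4 [h5 [h6 [h7 _]]]]]]] := gen_satisfies (uq_presentation q).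
split; [by rewrite -[RHS]scale1r | by rewrite -[RHS]scale1r
       | by rewrite -cstM | by rewrite -cstM | split].
- by rewrite -cstM.
- by rewrite -cstM.
have {}h7 : uE * uF - uF * uE = (q' - q'^-1)^-1 *: (uK * uK - uKi * uKi).
  by move: h7; rewrite /= !cstM !scaleN1r.
by rewrite -h7 addrC subrK.
Qed.

Lemma u1_relE : ht * hti = 1 /\ hti * ht = 1.
Proof.
have [h1 [h2 _]] := gen_satisfies (u1_presentation R).
by split; rewrite -[RHS]scale1r.
Qed.

Definition Delta_gen (g : su2_gen) : tens P P :=
  match g with
  | Ga => pa \ox pa + pb \ox pc | Gb => pa \ox pb + pb \ox pd
  | Gc => pc \ox pa + pd \ox pc | Gd => pc \ox pb + pd \ox pd
  end.


Fact Delta_genP : satisfies Delta_gen (su2_relations q).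
Proof.
have [ba ca db dc [cb ad da]] := su2_relE.
have [e1 [e2 [e3 [e4 [e5 [e6 e7]]]]]] :=
  Delta_relations (qC_neq0 q) ba ca db dc cb ad da.
by do 7?[split]; rewrite /= ?cstM ?scaleN1r ?scale1r.
Qed.

Definition Delta : P -> tens P P := palg_lift (D := su2_presentation q) Delta_gen.
HB.instance Definition _ := GRing.isLinear.Build C P (tens P P) *:%R Delta
  (palg_lift_linear (D := su2_presentation q) Delta_genP).
HB.instance Definition _ := GRing.isMonoidMorphism.Build P (tens P P) Delta
  (palg_lift_monoid (D := su2_presentation q) Delta_genP).

(* S is an anti-homomorphism, that is a morphism to the opposite algebra *)
Definition S_gen (g : su2_gen) : P^c :=
  match g with
  | Ga => pd | Gb => - q'^-1 *: pb | Gc => - q' *: pc | Gd => pa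
  end.

Fact S_genP : satisfies S_gen (su2_relations q).
Proof.
have [ba ca db dc [cb ad da]] := su2_relE; have q0 := qC_neq0 q.
have E := (ba, ca, db, dc, cb, ad, da).
have mE (x y : P) : (x : P^c) * (y : P^c) = y * x by [].
split; [|split; [|split; [|split; [|split; [|split; [|split; [|exact: I]]]]]]];
rewrite /= ?cstM !mE -?scalerAl -?scalerAr ?E ?scale1r.
all: by lmod_eq (R[i]); field.
Qed.

Definition antipode (x : P) : P := palg_lift (D := su2_presentation q) S_gen x.

Lemma antipode_linear : linear antipode.
Proof. exact: (palg_lift_linear (D := su2_presentation q) S_genP). Qed.

Lemma antipode_anti : antipode 1 = 1 /\
  forall x y, antipode (x * y) = antipode y * antipode x.
Proof. by have [h1 hM] := palg_lift_monoid (D := su2_presentation q) S_genP. Qed.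

HB.instance Definition _ :=
  GRing.isLinear.Build C P P *:%R antipode antipode_linear.

Definition hDelta_gen (g : u1_gen) : tens H H :=
  match g with Gt => ht \ox ht | Gti => hti \ox hti end.

Fact hDelta_genP : satisfies hDelta_gen (u1_relations R).
Proof.
have [h1 h2] := u1_relE.
by do 2?[split]; rewrite //= tmulE ?h1 ?h2 scale1r.
Qed.

Definition hDelta : H -> tens H H := palg_lift (D := u1_presentation R) hDelta_gen.
HB.instance Definition _ := GRing.isLinear.Build C H (tens H H) *:%R hDelta
  (palg_lift_linear (D := u1_presentation R) hDelta_genP).
HB.instance Definition _ := GRing.isMonoidMorphism.Build H (tens H H) hDelta
  (palg_lift_monoid (D := u1_presentation R) hDelta_genP).

Definition hS_gen (g : u1_gen) : H^c :=
  match g with Gt => hti | Gti => ht end.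

Fact hS_genP : satisfies hS_gen (u1_relations R).
Proof.
have [h1 h2] := u1_relE.
have mE (x y : H) : (x : H^c) * (y : H^c) = y * x by [].
by do 2?[split]; rewrite //= mE ?h1 ?h2 scale1r.
Qed.

Definition hantipode (x : H) : H := palg_lift (D := u1_presentation R) hS_gen x.

Lemma hantipode_linear : linear hantipode.
Proof. exact: (palg_lift_linear (D := u1_presentation R) hS_genP). Qed.

HB.instance Definition _ :=
  GRing.isLinear.Build C H H *:%R hantipode hantipode_linear.

Definition tpow (n : int) : H :=
  match n with Posz k => ht ^+ k | Negz k => hti ^+ k.+1 end.

Definition uDelta_gen (g : uq_gen) : tens U U :=
  match g with
  | GK => uK \ox uK | GKi => uKi \ox uKi
  | GE => uE \ox uK + uKi \ox uE | GF => uF \ox uK + uKi \ox uF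
  end.

Fact uDelta_genP : satisfies uDelta_gen (uq_relations q).
Proof.
have [h1 h2 KE KiE [KF KiF EF]] := uq_relE.
have [e1 [e2 [e3 [e4 [e5 [e6 e7]]]]]] :=
  uDelta_relations (qC_neq0 q) h1 h2 KE KiE KF KiF EF.
by do 7?[split]; rewrite /= ?cstM ?scaleN1r ?scale1r.
Qed.

Definition uDelta : U -> tens U U := palg_lift (D := uq_presentation q) uDelta_gen.
HB.instance Definition _ := GRing.isLinear.Build C U (tens U U) *:%R uDelta
  (palg_lift_linear (D := uq_presentation q) uDelta_genP).
HB.instance Definition _ := GRing.isMonoidMorphism.Build U (tens U U) uDelta
  (palg_lift_monoid (D := uq_presentation q) uDelta_genP).

Definition hopf_map_gen (g : su2_gen) : H :=
  match g with Ga => ht | Gd => hti | Gb | Gc => 0 end.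

Fact hopf_map_genP : satisfies hopf_map_gen (su2_relations q).
Proof.
have [h1 h2] := u1_relE.
by split; [|split; [|split; [|split; [|split; [|split; [|split; [|exact: I]]]]]]];
rewrite /= ?cstM ?h1 ?h2 !(mulr0, mul0r, addr0) ?scaler0
  ?scale1r ?scaleN1r ?subrr ?addr0.
Qed.

(* the Hopf map pi *)
Definition hopf_map : P -> H := palg_lift (D := su2_presentation q) hopf_map_gen.
HB.instance Definition _ := GRing.isLinear.Build C P H *:%R hopf_map
  (palg_lift_linear (D := su2_presentation q) hopf_map_genP).
HB.instance Definition _ := GRing.isMonoidMorphism.Build P H hopf_map
  (palg_lift_monoid (D := su2_presentation q) hopf_map_genP).

(* the right coaction (id (x) pi) Delta of H on P *)
Definition coact (x : P) : tens P H := tmap idfun hopf_map (Delta x).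

Lemma coact_linear : linear coact.
Proof.
move=> k x y.
have tL : linear (tmap idfun hopf_map : tens P P -> tens P H).
  by apply: tmap_linear => // l u v; exact: linearP.
by rewrite -tL; congr (tmap _ _ _); exact: linearP.
Qed.

Lemma coact_monoid : monoid_morphism coact.
Proof.
have [t1 tM] := @tmap_monoid C P P P H idfun hopf_map.
by split=> [|x y]; rewrite /coact ?rmorph1 ?rmorphM /= ?t1 ?tM.
Qed.

HB.instance Definition _ :=
  GRing.isLinear.Build C P (tens P H) *:%R coact coact_linear.
HB.instance Definition _ :=
  GRing.isMonoidMorphism.Build P (tens P H) coact coact_monoid.

End HopfStructures.

Section Geometry.
Variables (R : realType) (q : deformation R).
Local Notation C := R[i].
Local Notation q' := (qC q).
Local Notation P := (SUq2 q).
Local Notation H := (U1 R).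
Local Notation U := (Uqsu2 q).
Local Notation a := (pa q).
Local Notation b := (pb q).
Local Notation c := (pc q).
Local Notation d := (pd q).

(* the base M = A[S^2_q] of coinvariants *)
Definition coinvariant : {pred P} := fun x => coact x == x \ox 1.

Record S2q := MkS2q { S2q_val : P ; S2q_valP : S2q_val \in coinvariant }.
HB.instance Definition _ := [isSub for S2q_val].
HB.instance Definition _ := [Choice of S2q by <:].

Fact coinvariant_closed : GRing.subsemialg_closed coinvariant.
Proof.
split; first by apply/eqP; rewrite rmorph1.
- split=> [|x y /eqP hx /eqP hy]; last by apply/eqP; rewrite raddfD /= hx hy tpureDl.
  by apply/eqP; rewrite raddf0 tpure0l.
- by move=> k x /eqP hx; apply/eqP; rewrite linearZ /= hx tpureZl.
- by move=> x y /eqP hx /eqP hy; apply/eqP; rewrite rmorphM /= hx hy tmulE mulr1.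
Qed.
HB.instance Definition _ :=
  GRing.SubChoice_isSubLalgebra.Build C P coinvariant S2q coinvariant_closed.

Lemma S2q_valM m n : S2q_val (m * n) = S2q_val m * S2q_val n.
Proof. exact: (rmorphM (val : S2q -> P)). Qed.
Lemma S2q_valD m n : S2q_val (m + n) = S2q_val m + S2q_val n.
Proof. exact: (raddfD (val : S2q -> P)). Qed.
Lemma S2q_val1 : S2q_val 1 = 1.
Proof. exact: (rmorph1 (val : S2q -> P)). Qed.

(* left P-modules viewed as left M-modules *)
Definition over_S2q (X : lmodType P) : Type := X.

Section RestrictScalars.
Variable X : lmodType P.
HB.instance Definition _ := GRing.Zmodule.on (over_S2q X).
Definition S2q_scale (m : S2q) (x : over_S2q X) : over_S2q X :=
  S2q_val m *: (x : X).
Fact S2q_scaleA m n x : S2q_scale m (S2q_scale n x) = S2q_scale (m * n) x.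
Proof. by rewrite /S2q_scale scalerA -S2q_valM. Qed.
Fact S2q_scale1 : left_id 1 S2q_scale.
Proof. by move=> x; rewrite /S2q_scale S2q_val1 scale1r. Qed.
Fact S2q_scaleDr : right_distributive S2q_scale +%R.
Proof. by move=> m x y; exact: scalerDr. Qed.
Fact S2q_scaleDl x : {morph S2q_scale^~ x : m n / m + n}.
Proof.
by move=> m n; rewrite /S2q_scale S2q_valD scalerDl.
Qed.
HB.instance Definition _ := GRing.Zmodule_isLmodule.Build S2q (over_S2q X)
  S2q_scaleA S2q_scale1 S2q_scaleDr S2q_scaleDl.
End RestrictScalars.

(* the line bundle L_n = {x | delta_R x = x (x) t^-n} *)
Definition weight (n : int) : {pred over_S2q P^o} :=
  fun x => coact (x : P) == (x : P) \ox tpow R (- n).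

Record line_bundle (n : int) := LineBundle {
  line_val : over_S2q P^o ;
  line_valP : line_val \in weight n }.
HB.instance Definition _ n := [isSub for @line_val n].
HB.instance Definition _ n := [Choice of line_bundle n by <:].

Fact weight_closed n : subsemimod_closed (weight n).
Proof.
split; first split.
- by apply/eqP; rewrite (raddf0 (coact (q := q))) (tpure0l P).
- move=> x y /eqP hx /eqP hy; apply/eqP.
  have -> : coact (x + y : over_S2q P^o) = coact (x : P) + coact (y : P).
    exact: (raddfD (coact (q := q))).
  by rewrite hx hy; exact/esym/(@tpureDl _ P).
- move=> m x /eqP hx; apply/eqP; rewrite -[m *: x]/(S2q_val m * (x : P)) rmorphM /= hx.
  by rewrite (eqP (S2q_valP m)) tmulE mul1r.
Qed.
HB.instance Definition _ n := GRing.SubChoice_isSubLmodule.Build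
  S2q (over_S2q P^o) (weight n) (line_bundle n) (weight_closed n).

Definition mul_map : tens P P -> P := tlift (fun x y => x * y).

Fact mul_map_bilinear : bilinear_map (fun x y : P => x * y).
Proof.
by split=> [y|x] k u v; rewrite ?mulrDl ?mulrDr -?scalerAl -?scalerAr.
Qed.

Fact mul_map_linear : linear mul_map.
Proof. by apply: tlift_linear; exact: mul_map_bilinear. Qed.

Lemma mul_mapM p x : mul_map ((p \ox 1) * x) = p * mul_map x.
Proof.
have [h0 hD _] := lmod_ext_lin mul_map_linear.
elim/tens_ind: x => [|x y hx hy|u v]; first by rewrite mulr0 h0 mulr0.
  by rewrite mulrDr !hD hx hy mulrDr.
rewrite tmulE mul1r /mul_map !tlift_pure ?mulrA //; exact: mul_map_bilinear.
Qed.

(* universal one-forms: the kernel of the multiplication *)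
Fact univ_forms0 : mul_map 0 = 0.
Proof. by case: (lmod_ext_lin mul_map_linear). Qed.
Fact univ_formsP k x y :
  mul_map x = 0 -> mul_map y = 0 -> mul_map (k *: x + y) = 0.
Proof. by move=> hx hy; rewrite mul_map_linear hx hy scaler0 addr0. Qed.
Definition univ_forms : submodule (tens P P) := Submodule univ_forms0 univ_formsP.

Definition IP_z : P := q' ^+ 2 *: a + d - (q' ^+ 3 + q'^-1)%:A.

Definition IP_generators : seq P :=
  [:: b ^+ 2; c ^+ 2; b * (a - d); c * (a - d);
      a ^+ 2 + q' ^+ 2 *: d ^+ 2 - (1 + q' ^+ 2) *: (a * d + q'^-1 *: (b * c));
      IP_z * b; IP_z * c; IP_z * (a - d);
      IP_z * (q' ^+ 2 *: a + d - (q' ^+ 2 + 1)%:A)].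

Definition IP : submodule P :=
  span (fun x => exists g p, g \in IP_generators /\ x = g * p).

(* N_P is spanned by the elements p S(x_1) (x) x_2 with x in I_P *)
Definition NP_gen (n : tens P P) : Prop :=
  exists p x, IP x /\ n = (p \ox 1) * tmap (@antipode R q) idfun (Delta x).
Definition NP : submodule (tens P P) := span NP_gen.

Definition Omega1P : Type := subquot univ_forms NP.
HB.instance Definition _ := GRing.Lmodule.on Omega1P.

Definition class1P (x : tens P P) : Omega1P := cls univ_forms NP x.
Definition rep1P (w : Omega1P) : tens P P := rep w.

(* The two actions and the maps ver and theta below are computed on
   representatives; they do not depend on them because N_P is a sub-bimodule
   of the universal one-forms (I_P is a right ideal), because ver
   maps N_P into P (x) I_H, and because S(x_1) dx_2 = 0 for x in I_P. *)
Definition dP (p : P) : Omega1P := class1P (1 \ox p - p \ox 1).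
Definition lact (p : P) (w : Omega1P) : Omega1P :=
  class1P ((p \ox 1) * rep1P w).
Definition ract (w : Omega1P) (p : P) : Omega1P :=
  class1P (rep1P w * (1 \ox p)).

Lemma NP_lmul p x : NP x -> NP ((p \ox 1) * x).
Proof.
move=> [n [k [s [hs ->]]]]; rewrite mulr_sumr; apply: submod_sum => i.
rewrite -scalerAr; apply: submodZ; have [p' [y [Iy ->]]] := hs i.
by apply: sub_span; exists (p * p'), y; rewrite mulrA tmulE mulr1.
Qed.

Lemma univ_forms_lmul p x : univ_forms x -> univ_forms ((p \ox 1) * x).
Proof. by move=> hx; rewrite /= mul_mapM [mul_map x]hx mulr0. Qed.

Lemma class1P_lmul p x :
  univ_forms x -> lact p (class1P x) = class1P ((p \ox 1) * x).
Proof.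
move=> hx; apply/cls_eqP; try exact: univ_forms_lmul.
  by apply: univ_forms_lmul; exact: rep_in.
by rewrite -mulrBr; apply: NP_lmul; exact: rep_cls.
Qed.

(* Omega1P as a left P-module *)
Definition left_Omega1P : Type := Omega1P.
HB.instance Definition _ := GRing.Zmodule.on left_Omega1P.

Fact lactA p p' (w : left_Omega1P) : lact p (lact p' w) = lact (p * p') w.
Proof.
rewrite [lact p' w]/lact class1P_lmul; last exact/univ_forms_lmul/rep_in.
by rewrite mulrA tmulE mulr1.
Qed.
Fact lact1 : left_id 1 (lact : P -> left_Omega1P -> left_Omega1P).
Proof. by move=> w; rewrite /lact -toneE mul1r; exact: repK. Qed.
Fact lactDr : right_distributive (lact : P -> left_Omega1P -> left_Omega1P) +%R.
Proof.
move=> p w w'.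
have -> : (w + w' : Omega1P) = class1P (rep1P w + rep1P w').
  by rewrite /class1P clsD ?repK //; exact: rep_in.
rewrite class1P_lmul; last by apply: submodD; exact: rep_in.
by rewrite mulrDr /class1P clsD //; apply: univ_forms_lmul; exact: rep_in.
Qed.
Fact lactDl (w : left_Omega1P) :
  {morph (lact^~ w : P -> left_Omega1P) : p p' / p + p'}.
Proof.
move=> p p'; rewrite /lact tpureDl mulrDl.
by rewrite /class1P clsD //; apply: univ_forms_lmul; exact: rep_in.
Qed.
HB.instance Definition _ := GRing.Zmodule_isLmodule.Build P left_Omega1P
  lactA lact1 lactDr lactDl.


Lemma lactZ (p : P) (k : C) (w : Omega1P) : lact p (k *: w) = k *: lact p w.
Proof.
have -> : k *: w = class1P (k *: rep1P w).
  by rewrite /class1P clsZ ?repK //; exact: rep_in.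
rewrite class1P_lmul; last by apply: submodZ; exact: rep_in.
by rewrite -scalerAr /class1P clsZ //; apply: univ_forms_lmul; exact: rep_in.
Qed.

Local Notation "p <*: w" := (lact p w) (at level 40).
Local Notation "w :*> p" := (ract w p) (at level 40).

(* Omega^1 M, the span of the m dn inside Omega^1 P *)
Definition Omega1M_set : submodule Omega1P :=
  span (fun w => exists m n : S2q, w = S2q_val m <*: dP (S2q_val n)).

Definition Omega1M_pred : {pred over_S2q left_Omega1P} :=
  submod_pred Omega1M_set.

Record Omega1M := MkOmega1M {
  Omega1M_val : over_S2q left_Omega1P ;
  Omega1M_valP : Omega1M_val \in Omega1M_pred }.
HB.instance Definition _ := [isSub for Omega1M_val].
HB.instance Definition _ := [Choice of Omega1M by <:].

Fact Omega1M_closed : subsemimod_closed Omega1M_pred.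
Proof.
split; first split.
- by apply/submod_predP; exact: submod0.
- move=> x y /submod_predP hx /submod_predP hy; apply/submod_predP.
  exact: (submodD hx hy).
- move=> m x /submod_predP [n [k [s [hs hx]]]]; apply/submod_predP.
  rewrite -[m *: x]/(S2q_val m <*: (x : Omega1P)) hx.
  have h0 : S2q_val m <*: 0 = 0 by exact: (scaler0 left_Omega1P (S2q_val m)).
  have hD (u v : Omega1P) : S2q_val m <*: (u + v) = S2q_val m <*: u + S2q_val m <*: v.
    exact: (scalerDr (S2q_val m) (u : left_Omega1P) v).
  rewrite (big_morph _ hD h0); apply: submod_sum => i; rewrite lactZ.
  apply: submodZ; have [m' [n' ->]] := hs i; apply: sub_span.
  by exists (m * m'), n'; rewrite S2q_valM; exact: lactA.
Qed.
HB.instance Definition _ := GRing.SubChoice_isSubLmodule.Build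
  S2q (over_S2q left_Omega1P) Omega1M_pred Omega1M Omega1M_closed.

(* P (Omega^1 M) and P (Omega^1 M) P *)
Definition P_Omega1M : submodule Omega1P :=
  span (fun w => exists p (w' : Omega1M), w = p <*: Omega1M_val w').
Definition P_Omega1M_P : submodule Omega1P :=
  span (fun w => exists p (w' : Omega1M) p',
    w = (p <*: Omega1M_val w') :*> p').

(* the ideal I_H = pi(I_P) and the space ker(epsilon) / I_H *)
Definition IH_set (h : H) : Prop := exists x, IP x /\ h = hopf_map x.
Fact IH_set0 : IH_set 0.
Proof. by exists 0; split; [exact: submod0 | rewrite raddf0]. Qed.
Fact IH_setP k x y : IH_set x -> IH_set y -> IH_set (k *: x + y).
Proof.
move=> [u [hu ->]] [v [hv ->]]; exists (k *: u + v).
by split; [exact: submodP | rewrite linearP].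
Qed.
Definition IH : submodule H := Submodule IH_set0 IH_setP.

Fact aug_ideal0 (A : augAlgType C) : counit (0 : A) = 0.
Proof. exact: raddf0. Qed.
Fact aug_idealP (A : augAlgType C) k (x y : A) :
  counit x = 0 -> counit y = 0 -> counit (k *: x + y) = 0.
Proof. by move=> hx hy; rewrite linearP /= hx hy scaler0 addr0. Qed.
Definition aug_ideal (A : augAlgType C) : submodule A :=
  Submodule (@aug_ideal0 A) (@aug_idealP A).

Definition LambdaH : Type := subquot (aug_ideal H) IH.
HB.instance Definition _ := GRing.Lmodule.on LambdaH.

(* the class of h - epsilon(h) *)
Definition class_LambdaH (h : H) : LambdaH :=
  cls (aug_ideal H) IH (h - (counit h : C)%:A).

(* ver(x (x) y) = x y_(0) (x) y_(1), first with values in P (x) H, then on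
   Omega^1 P with values in P (x) ker(epsilon) / I_H *)
Definition ver_univ : tens P P -> tens P H :=
  tlift (fun x y => (x \ox 1) * coact y).
Definition ver (w : Omega1P) : tens P LambdaH :=
  tmap idfun class_LambdaH (ver_univ (rep1P w)).

Definition is_comodule (V : lmodType C) (rho : V -> tens V H) : Prop :=
  [/\ linear rho,
      forall v, tassoc (tmap rho idfun (rho v)) = tmap idfun (@hDelta R) (rho v) &
      forall v, tlift (fun v0 h => (counit h : C) *: v0) (rho v) = v].

Definition tens_coact (V W : lmodType C) (rV : V -> tens V H)
    (rW : W -> tens W H) : tens V W -> tens (tens V W) H :=
  tlift (fun v w =>
    tlift (fun v0 h => tlift (fun w0 k => (v0 \ox w0) \ox (h * k)) (rW w)) (rV v)).

(* A quantum principal bundle with non-universal calculi: P is a right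
   H-comodule algebra (with base P^H = M by definition of M), the canonical
   map P (x) P -> P (x) H is onto, Omega^1 P is right H-covariant, the calculi
   are compatible in the sense that ver maps N_P onto P (x) I_H, and the sequence
     0 -> P (Omega^1 M) P -> Omega^1 P -> P (x) ker(epsilon) / I_H -> 0
   is exact. *)
Definition quantum_principal_bundle : Prop :=
  [/\ is_comodule (coact (q := q)) /\ monoid_morphism (coact (q := q)),
      forall y, exists x, ver_univ x = y,
      exists rho : Omega1P -> tens Omega1P H, is_comodule rho /\
        forall p p', rho (p <*: dP p') =
          tlift (fun p0 h => tlift (fun p0' h' =>
            (p0 <*: dP p0') \ox (h * h')) (coact p')) (coact p),
      forall y, (exists2 n, NP n & ver_univ n = y) <->
                span (fun z => exists p h, IH h /\ z = p \ox h) y &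
      (forall w, ver w = 0 <-> P_Omega1M_P w) /\
      (forall y, exists w, ver w = y)].

Definition soldering_map (V : lmodType C) (theta : V -> Omega1P) :
    tens P V -> Omega1P :=
  tlift (fun p v => p <*: theta v).

(* s_theta restricts to an isomorphism of left M-modules from (P (x) V)^H onto
   Omega^1 M *)
Definition soldering_iso (V : lmodType C) (rhoV : V -> tens V H)
    (theta : V -> Omega1P) : Prop :=
  let s := soldering_map theta in
  let coinv x := tens_coact (coact (q := q)) rhoV x = x \ox 1 in
  [/\ forall x, coinv x -> Omega1M_set (s x),
      forall x y, coinv x -> coinv y -> s x = s y -> x = y,
      forall w, Omega1M_set w -> exists2 x, coinv x & s x = w &
      linear s /\ forall (m : S2q) x,
        s (tmap (fun p => S2q_val m * p) idfun x) = S2q_val m <*: s x].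

Definition framed_quantum_manifold (V : lmodType C) (rhoV : V -> tens V H)
    (theta : V -> Omega1P) : Prop :=
  [/\ quantum_principal_bundle, is_comodule rhoV, linear theta,
      forall v, P_Omega1M (theta v) & soldering_iso rhoV theta].

(* V = (ker(epsilon) :&: M) / (I_P :&: M) *)
Definition aug_M_set (x : P) : Prop := x \in coinvariant /\ counit x = 0.
Fact aug_M_set0 : aug_M_set 0.
Proof. by split; [apply/eqP; rewrite raddf0 tpure0l | exact: raddf0]. Qed.
Fact aug_M_setP k x y : aug_M_set x -> aug_M_set y -> aug_M_set (k *: x + y).
Proof.
move=> [/eqP cx ex] [/eqP cy ey]; split; last exact: aug_idealP.
by apply/eqP; rewrite linearP /= cx cy tpureDl tpureZl.
Qed.
Definition aug_M : submodule P := Submodule aug_M_set0 aug_M_setP.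

Definition frameV : Type := subquot aug_M IP.
HB.instance Definition _ := GRing.Lmodule.on frameV.
Definition classV (x : P) : frameV := cls aug_M IP x.

(* v~_(2) (x) S pi(v~_(1)), which lies in (ker(epsilon) :&: M) (x) H *)
Definition coact_lift (x : P) : tens P H :=
  tlift (fun x1 x2 => x2 \ox hantipode (hopf_map x1)) (Delta x).
Definition coactV (v : frameV) : tens frameV H :=
  tmap (@subquot_pi _ _ aug_M IP) idfun
    (xget 0 [set y : tens (subm aug_M) H |
              tmap val idfun y = coact_lift (rep v)]).

Definition theta_lift (x : P) : Omega1P :=
  tlift (fun x1 x2 => antipode x1 <*: dP x2) (Delta x).
Definition theta (v : frameV) : Omega1P := theta_lift (rep v).

(* The dual pairing of U_q(su(2)) with P *)
Definition pairing_table (X : uq_gen) (x : su2_gen) : C :=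
  match X, x with
  | GK, Ga => (sqrt_qC q)^-1 | GK, Gd => sqrt_qC q
  | GKi, Ga => sqrt_qC q | GKi, Gd => (sqrt_qC q)^-1
  | GE, Gc => 1 | GF, Gb => 1
  | _, _ => 0
  end.

Record dual_pairing (pr : U -> P -> C) : Prop := DualPairing {
  pairing_linl : forall p, linear (pr^~ p : U -> C^o) ;
  pairing_linr : forall X, linear (pr X : P -> C^o) ;
  pairing_mull : forall X Y p,
    pr (X * Y) p = tlift (fun p1 p2 => pr X p1 * pr Y p2 : C^o) (Delta p) ;
  pairing_mulr : forall X p p',
    pr X (p * p') = tlift (fun X1 X2 => pr X1 p * pr X2 p' : C^o) (uDelta X) ;
  pairing_1l : forall p, pr 1 p = counit p ;
  pairing_1r : forall X, pr X 1 = counit X ;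
  pairing_gen : forall X x, pr (gen (D := uq_presentation q) X)
    (gen (D := su2_presentation q) x) = pairing_table X x }.

(* X |> p = p_(1) (X, p_(2)) *)
Definition act (pr : U -> P -> C) (X : U) (p : P) : P :=
  tlift (fun p1 p2 => pr X p2 *: p1) (Delta p).

Definition Lminus : U := sqrt_qC q *: (uF q * uKi q).
Definition Lplus : U := (sqrt_qC q)^-1 *: (uE q * uKi q).
Definition Lzero : U :=
  uK q ^+ 2 + (nu q ^+ 2 * q'^-1) *: (uF q * uE q) - 1.
Definition Lz : U := uKi q ^+ 2 - 1.

(* The forms omega_-, omega_0, omega_+, omega_z dual to the L_j; the formula
   determines them, since it gives S(x_1) dx_2 = \sum_j (L_j, x) omega_j and
   the functionals (L_j, -) are linearly independent. *)
Definition dual_forms (pr : U -> P -> C) (wm w0 wp wz : Omega1P) : Prop :=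
  forall p, dP p = (act pr Lminus p <*: wm) + (act pr Lzero p <*: w0)
                 + (act pr Lplus p <*: wp) + (act pr Lz p <*: wz).

Definition b_plus : P := c * d.
Definition b_minus : P := a * b.
Definition b_zero : P := b * c.

End Geometry.

Notation "p <*: w" := (lact p w) (at level 40) : ring_scope.

Definition projective (A : nzRingType) (N : lmodType A) : Prop :=
  forall (X Y : lmodType A) (g : {linear X -> Y}) (f : {linear N -> Y}),
    (forall y, exists x, g x = y) ->
    exists h : {linear N -> X}, forall n, g (h n) = f n.

(* Main.v *)
(* The universal one-forms are spanned by the p S(x_1) (x) x_2 with
   epsilon(x) = 0, and the Galois map x (x) y |-> x y_1 (x) y_2 sends
   p S(x_1) (x) x_2 to p (x) x. Contracting with the functionals L_j, which
   vanish on the ideal I_P, therefore gives coordinates on Omega^1 P, and these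
   exhibit the omega_j as a basis of Omega^1 P as a left P-module. Contracting
   with the counit shows that an element of ker(epsilon) on which all the L_j
   vanish lies in I_P, so that V has the basis b_-, b_0, b_+.

   P is spanned by elements that are homogeneous for both U(1)-coactions, and
   L_-, L_0, L_+, L_z shift the degree by 2, 0, -2, 0, with L_z acting on
   degree k by q^k - 1. Hence L_z kills M, and the coordinates along omega_-,
   omega_0, omega_+ of a form of Omega^1 M have degrees 2, 0, -2; conversely
   p omega_j is in Omega^1 M when p has the right degree, by the explicit
   formulas for theta. The coordinate along omega_z is ver followed by the
   functional f(q) - f(1) of ker(epsilon) / I_H, whence the exactness of the
   sequence of the bundle. Finally, partitions of unity 1 = sum_i u_i v_i with
   u_i and v_i of opposite degrees give dual bases of the line bundles. *)

Require Import Defs.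
From HB Require Import structures.
From mathcomp Require Import all_boot all_order all_algebra.
From mathcomp Require Import boolp classical_sets reals.
From mathcomp Require Import complex ring.

Set Implicit Arguments.
Unset Strict Implicit.
Unset Printing Implicit Defensive.

Import Order.TTheory GRing.Theory Num.Theory.
Local Open Scope ring_scope.
Local Open Scope complex_scope.

(** No basis of P, of H or of their tensor products is at hand: presented algebras and tensor
    products are known only through their universal properties. Independence is therefore always
    obtained by evaluating functionals. The pairing [pr] separates the four forms, and the character
    t |-> q of H, whose values q^n are pairwise distinct because 0 < q < 1, separates the degrees.
    For this reason homogeneous elements are a spanning family closed under the operations
    ([homog]), and degree-zero components are extracted as eigenvectors. The same character composed
    with the Hopf map is the pairing with K^-2, so that L_z comes from a functional on H; this links
    the fourth coordinate to [ver]. The constants q and nu^2 q^-1 of the soldering form are the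
    values of L_- on ab and of L_0 on bc. A further obstacle is that [coactV] chooses a preimage in
    (ker(epsilon) :&: M) (x) H, whose existence has to be proved by a decomposition whose pieces may
    leave ker(epsilon). *)

HB.instance Definition _ (K : fieldType) (U V U' V' : lmodType K)
    (f : {linear U -> U'}) (g : {linear V -> V'}) :=
  GRing.isLinear.Build K (tens U V) (tens U' V') *:%R (tmap f g)
    (tmap_linear (linearP f) (linearP g)).

(** * Linear maps and tensor products *)

Section TensorTools.
Variable K : fieldType.
Implicit Types U V W : lmodType K.

(** Many maps below are linear by a proof of [linear f] and carry no registered structure; this
    turns such a proof into rewriting rules. *)
Lemma linear_identities U W (f : U -> W) : linear f ->
  [/\ f 0 = 0, {morph f : x y / x + y}, {morph f : x / - x},
      (forall k x, f (k *: x) = k *: f x) & {morph f : x y / x - y}].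
Proof.
move=> fL; have [f0 fD fZ] := lmod_ext_lin fL.
have fN : {morph f : x / - x} by move=> x; rewrite -scaleN1r fZ scaleN1r.
by split=> // x y; rewrite fD fN.
Qed.

Lemma linear_map_sum U W (f : U -> W) (I : Type) (r : seq I) (F : I -> U) :
  linear f -> f (\sum_(i <- r) F i) = \sum_(i <- r) f (F i).
Proof.
by move=> /linear_identities[f0 fD _ _ _]; rewrite (big_morph f fD f0).
Qed.

Lemma tmapE U V U' V' (f : {linear U -> U'}) (g : {linear V -> V'}) u v :
  tmap f g (u \ox v) = f u \ox g v.
Proof. by rewrite tmap_pure //; exact: linearP. Qed.

Lemma linear_comp U V W (f : V -> W) (g : U -> V) :
  linear f -> linear g -> linear (fun x => f (g x)).
Proof. by move=> fL gL k x y; rewrite gL fL. Qed.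

Lemma tlift_linear_param (X : lmodType K) U V W (f : X -> U -> V -> W)
    (t : tens U V) :
  (forall u v, linear (fun x => f x u v)) -> linear (fun x => tlift (f x) t).
Proof.
move=> fL k x y; rewrite /tlift /fsum scaler_sumr -big_split.
by apply: eq_bigr => p _; exact: fL.
Qed.

Lemma tlift_ext U V W (f g : U -> V -> W) (t : tens U V) :
  (forall u v, f u v = g u v) -> tlift f t = tlift g t.
Proof. by move=> fg; apply: eq_bigr => p _; exact: fg. Qed.

(** [tlift f t] is a finite sum over the chosen representative of [t], and a linear map passes
    through it term by term. *)
Lemma tlift_comp U V W (X : lmodType K) (h : W -> X) (f : U -> V -> W)
    (t : tens U V) :
  linear h -> h (tlift f t) = tlift (fun u v => h (f u v)) t.
Proof. by move=> hL; rewrite /tlift /fsum linear_map_sum. Qed.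

Lemma tlift_tmap U V U' V' W (f : U' -> V' -> W) (g : U -> U') (h : V -> V') t :
  bilinear_map f -> tlift f (tmap g h t) = tlift (fun u v => f (g u) (h v)) t.
Proof.
move=> fb; rewrite /tmap (tlift_comp _ _ (tlift_linear fb)).
by apply: tlift_ext => u v; rewrite tlift_pure.
Qed.

Lemma tpure0r U V (u : U) : u \ox (0 : V) = 0.
Proof. by case: (lmod_ext_lin ((tpure_bilinear U V).2 u)). Qed.

Lemma tassoc_bilinear U V W :
  bilinear_map (fun (x : tens U V) (w : W) =>
    tlift (fun u v => u \ox (v \ox w)) x).
Proof.
split=> [w|x]; last first.
  by apply: tlift_linear_param => u v k w w'; rewrite !tpureDr !tpureZr.
apply: tlift_linear; split=> [v|u] k x y; first by rewrite tpureDl tpureZl.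
by rewrite tpureDl tpureZl tpureDr tpureZr.
Qed.

Lemma tassoc_linear U V W : linear (@tassoc K U V W).
Proof. exact/tlift_linear/tassoc_bilinear. Qed.

Lemma tassoc_pure U V W (u : U) (v : V) (w : W) :
  tassoc ((u \ox v) \ox w) = u \ox (v \ox w).
Proof.
rewrite /tassoc tlift_pure; last exact: tassoc_bilinear.
rewrite tlift_pure //; split=> [z|z] k x y; first by rewrite tpureDl tpureZl.
by rewrite tpureDl tpureZl tpureDr tpureZr.
Qed.

End TensorTools.

HB.instance Definition _ (K : fieldType) (U V W : lmodType K) :=
  GRing.isLinear.Build K (tens (tens U V) W) (tens U (tens V W)) *:%R
    (@tassoc K U V W) (@tassoc_linear K U V W).

Lemma tassocM (K : fieldType) (A B C : augAlgType K) :
  {morph (@tassoc K A B C) : x y / x * y}.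
Proof.
move=> x y; elim/tens_ind: x => [|x x' hx hx'|x z].
- by rewrite !mul0r linear0 mul0r.
- by rewrite !mulrDl !linearD /= hx hx' mulrDl.
elim/tens_ind: x => [|x x' hx hx'|u v].
- by rewrite tpure0l !mul0r linear0 mul0r.
- by rewrite tpureDl !mulrDl !linearD /= hx hx' mulrDl.
elim/tens_ind: y => [|y y' hy hy'|y w].
- by rewrite !mulr0 linear0 mulr0.
- by rewrite !mulrDr !linearD /= hy hy' mulrDr.
elim/tens_ind: y => [|y y' hy hy'|u' v'].
- by rewrite tpure0l !mulr0 linear0 mulr0.
- by rewrite tpureDl !mulrDr !linearD /= hy hy' mulrDr.
by rewrite !tmulE !tassoc_pure !tmulE.
Qed.

Lemma palg_ind (K : fieldType) (D : presentation K) (Q : palg D -> Prop) :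
  (forall i, Q (gen i)) -> (forall k, Q k%:A) ->
  (forall x y, Q x -> Q y -> Q (x + y)) ->
  (forall x y, Q x -> Q y -> Q (x * y)) -> forall x, Q x.
Proof.
move=> Qg Qc QD QM x; rewrite -[x]palg_reprK -eval_gen.
elim: (repr x) => //= [s hs t ht|s hs t ht]; [exact: QD | exact: QM].
Qed.

(** * Linear maps computed on representatives of a subquotient *)

Section Descent.
Variables (K : fieldType) (V : lmodType K) (A B : submodule V).

(** Representatives of the two sides differ by an element of [B], on which [f] vanishes. Maps such
    as [theta] and [ver] acquire their linearity in this way. *)
Lemma descent_linear (W : lmodType K) (f : V -> W) :
  linear f -> (forall x, B x -> f x = 0) ->
  linear (fun x : subquot A B => f (rep x)).
Proof.
move=> fL fB k x y; have [_ fD _ fZ fB'] := linear_identities fL.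
rewrite -fZ -fD; apply/eqP; rewrite -subr_eq0 -fB'; apply/eqP/fB.
have e : k *: x + y = cls A B (k *: rep x + rep y).
  by rewrite clsP ?repK //; exact: rep_in.
by rewrite e; apply: rep_cls; apply: submodP; exact: rep_in.
Qed.

Lemma descent_cls (W : lmodType K) (f : V -> W) x :
  linear f -> (forall x, B x -> f x = 0) -> A x -> f (rep (cls A B x)) = f x.
Proof.
move=> fL fB Ax; have [_ _ _ _ fB'] := linear_identities fL.
by apply/eqP; rewrite -subr_eq0 -fB'; apply/eqP/fB/rep_cls.
Qed.

Lemma cls_comp_linear (X : lmodType K) (f : X -> V) :
  linear f -> (forall x, A (f x)) -> linear (fun x => cls A B (f x)).
Proof. by move=> fL fA k x y; rewrite fL clsP. Qed.

End Descent.

Lemma span_linear0 (K : fieldType) (V W : lmodType K) (Sp : V -> Prop)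
    (f : V -> W) :
  linear f -> (forall x, Sp x -> f x = 0) -> forall x, Defs.span Sp x -> f x = 0.
Proof.
move=> fL fS x [n [k [s [hs ->]]]]; have [_ _ _ fZ _] := linear_identities fL.
rewrite (linear_map_sum _ _ fL) big1 // => i _; rewrite fZ fS // scaler0 //.
Qed.

(** * Contraction of one tensor factor with a functional *)

Section Contraction.
Variables (K : fieldType) (V W : lmodType K).

Definition contract (f : W -> K^o) : tens V W -> V :=
  tlift (fun v w => f w *: v).

Lemma contract_bilinear (f : W -> K^o) :
  linear f -> bilinear_map (fun (v : V) w => f w *: v).
Proof.
move=> fL; split=> [w|v] k x y; first by rewrite scalerDr !scalerA mulrC.
by rewrite fL scalerDl scalerA.
Qed.

Lemma contract_linear (f : W -> K^o) : linear f -> linear (contract f).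
Proof. by move=> fL; apply: tlift_linear; exact: contract_bilinear. Qed.

Lemma contract_pure (f : W -> K^o) v w :
  linear f -> contract f (v \ox w) = f w *: v.
Proof. by move=> fL; rewrite /contract tlift_pure //; exact: contract_bilinear. Qed.

Definition contractl (f : V -> K^o) : tens V W -> W :=
  tlift (fun v w => f v *: w).

Lemma contractl_bilinear (f : V -> K^o) :
  linear f -> bilinear_map (fun v (w : W) => f v *: w).
Proof.
move=> fL; split=> [w|v] k x y; last by rewrite scalerDr !scalerA mulrC.
by rewrite fL scalerDl scalerA.
Qed.

Lemma contractl_linear (f : V -> K^o) : linear f -> linear (contractl f).
Proof. by move=> fL; apply: tlift_linear; exact: contractl_bilinear. Qed.

Lemma contractl_pure (f : V -> K^o) v w :
  linear f -> contractl f (v \ox w) = f v *: w.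
Proof. by move=> fL; rewrite /contractl tlift_pure //; exact: contractl_bilinear. Qed.

End Contraction.

Lemma counit_lin (K : fieldType) (A : augAlgType K) : linear (@counit K A).
Proof. exact: linearP. Qed.

Section ContractCounit.
Variable K : fieldType.

(** The counit is a character, so contracting with it is an algebra map; the counit axiom can then
    be checked on generators. *)
Lemma contract_mul (A B : augAlgType K) (x y : tens A B) :
  contract (@counit K B) (x * y) =
  contract (@counit K B) x * contract (@counit K B) y.
Proof.
have [c0 cD _ _ _] := linear_identities (contract_linear (V := A) (@counit_lin _ B)).
elim/tens_ind: x => [|x x' hx hx'|u v]; rewrite ?mul0r ?c0 ?mul0r //.
  by rewrite !mulrDl !cD mulrDl hx hx'.
elim/tens_ind: y => [|y y' hy hy'|u' v']; rewrite ?mulr0 ?c0 ?mulr0 //.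
  by rewrite !mulrDr !cD mulrDr hy hy'.
rewrite tmulE !contract_pure; try exact: counit_lin.
by rewrite rmorphM -scalerAl -scalerAr scalerA.
Qed.

Lemma contractl_mul (A B : augAlgType K) (x y : tens A B) :
  contractl (@counit K A) (x * y) =
  contractl (@counit K A) x * contractl (@counit K A) y.
Proof.
have [c0 cD _ _ _] := linear_identities (contractl_linear (W := B) (@counit_lin _ A)).
elim/tens_ind: x => [|x x' hx hx'|u v]; rewrite ?mul0r ?c0 ?mul0r //.
  by rewrite !mulrDl !cD mulrDl hx hx'.
elim/tens_ind: y => [|y y' hy hy'|u' v']; rewrite ?mulr0 ?c0 ?mulr0 //.
  by rewrite !mulrDr !cD mulrDr hy hy'.
rewrite tmulE !contractl_pure; try exact: counit_lin.
by rewrite rmorphM -scalerAl -scalerAr scalerA.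
Qed.

End ContractCounit.

(** * The Galois map of an abstract Hopf algebra *)

Section AbstractHopf.
Variables (K : fieldType) (A : augAlgType K) (D : {lrmorphism A -> tens A A}).

Lemma coassoc_left_morph :
  linear (fun x => tassoc (tmap D idfun (D x))) /\
  monoid_morphism (fun x => tassoc (tmap D idfun (D x))).
Proof.
have [l1 lM] := @tmap_monoid K A A (tens A A) A D idfun.
split.
  apply: linear_comp; first exact: linearP.
  exact: linear_comp (linearP _) (linearP _).
split=> [|x y]; last by rewrite (rmorphM D) lM; exact: tassocM.
by rewrite (rmorph1 D) l1 {1}toneE {1}toneE tassoc_pure.
Qed.

Lemma coassoc_right_morph :
  linear (fun x => tmap idfun D (D x)) /\
  monoid_morphism (fun x => tmap idfun D (D x)).
Proof.
have [l1 lM] := @tmap_monoid K A A A (tens A A) idfun D.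
split; first exact: linear_comp (linearP _) (linearP _).
by split=> [|x y]; [rewrite (rmorph1 D) l1 | rewrite (rmorphM D) lM].
Qed.

Variable S : {linear A -> A}.
Hypothesis antipodeM : forall x y, S (x * y) = S y * S x.

Definition hkappa (x : A) : tens A A := tmap S idfun (D x).

Lemma hkappa_linear : linear hkappa.
Proof. by move=> k x y; rewrite /hkappa !linearP. Qed.

Lemma tmap_antipodeM (u v : tens A A) :
  tmap S idfun (u * v) =
  tlift (fun y z => (S y \ox 1) * (tmap S idfun u * (1 \ox z))) v.
Proof.
elim/tens_ind: u => [|u u' hu hu'|x x'].
- rewrite mul0r linear0 (tlift_ext (g := fun _ _ => 0)); last first.
    by move=> y z; rewrite mul0r mulr0.
  by rewrite /tlift /fsum big1.
- rewrite mulrDl linearD /= hu hu' /tlift /fsum -big_split.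
  by apply: eq_bigr => p _; rewrite linearD mulrDl mulrDr.
have fb : bilinear_map (fun y z : A =>
    (S y \ox 1) * (tmap S idfun (x \ox x') * (1 \ox z))).
  split=> [z|y] k v1 v2; first by rewrite linearP tpureDl tpureZl mulrDl scalerAl.
  by rewrite tpureDr tpureZr !mulrDr -!scalerAr.
have [f0 fD _ _ _] := linear_identities (tlift_linear fb).
elim/tens_ind: v => [|v v' hv hv'|y y'].
- by rewrite mulr0 linear0 f0.
- by rewrite mulrDr linearD fD /= hv hv'.
by rewrite tlift_pure // !tmapE /= !tmulE tmapE /= antipodeM mulr1 mul1r.
Qed.

Lemma hkappaM x y : hkappa (x * y) =
  tlift (fun y1 y2 => (S y1 \ox 1) * (hkappa x * (1 \ox y2))) (D y).
Proof. by rewrite /hkappa rmorphM tmap_antipodeM. Qed.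

Definition hgalois (u : tens A A) : tens A A :=
  tlift (fun x y => (x \ox 1) * D y) u.

Lemma hgalois_bilinear : bilinear_map (fun x y : A => (x \ox (1 : A)) * D y).
Proof.
split=> [y|x] k u v; first by rewrite tpureDl tpureZl mulrDl scalerAl.
by rewrite linearP mulrDr scalerAr.
Qed.

Lemma hgalois_linear : linear hgalois.
Proof. exact/tlift_linear/hgalois_bilinear. Qed.

Lemma hgalois_pure x y : hgalois (x \ox y) = (x \ox 1) * D y.
Proof. by rewrite /hgalois tlift_pure //; exact: hgalois_bilinear. Qed.

Lemma hgaloisMl p u : hgalois ((p \ox 1) * u) = (p \ox 1) * hgalois u.
Proof.
have [g0 gD _ _ _] := linear_identities hgalois_linear.
elim/tens_ind: u => [|x y hx hy|x y]; first by rewrite !mulr0 g0 mulr0.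
  by rewrite !mulrDr !gD mulrDr hx hy.
by rewrite tmulE mul1r !hgalois_pure mulrA tmulE mulr1.
Qed.

Lemma hgaloisMr u p : hgalois (u * (1 \ox p)) = hgalois u * D p.
Proof.
have [g0 gD _ _ _] := linear_identities hgalois_linear.
elim/tens_ind: u => [|x y hx hy|x y]; first by rewrite !mul0r g0 mul0r.
  by rewrite !mulrDl !gD mulrDl hx hy.
by rewrite tmulE mulr1 !hgalois_pure rmorphM mulrA.
Qed.

(** The image of S(y_1) kappa(x) y_2 is (S(y_1) (x) 1)(1 (x) x) Delta(y_2). The first two factors
    commute, which leaves 1 (x) x times the image of kappa(y). Closure under products reduces the
    antipode axiom to generators. *)
Lemma hgalois_kappaM x y :
  hgalois (hkappa x) = 1 \ox x -> hgalois (hkappa y) = 1 \ox y ->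
  hgalois (hkappa (x * y)) = 1 \ox (x * y).
Proof.
move=> hx hy; rewrite hkappaM (tlift_comp _ _ hgalois_linear).
have -> : (1 : A) \ox (x * y) = (1 \ox x) * hgalois (hkappa y).
  by rewrite hy tmulE mulr1.
rewrite [hkappa y]/hkappa [hgalois _]tlift_tmap; last exact: hgalois_bilinear.
have mL : linear (fun u : tens A A => (1 \ox x) * u) by exact: tmul_linr.
rewrite (tlift_comp _ _ mL); apply: tlift_ext => u v.
rewrite hgaloisMl hgaloisMr hx.
by rewrite !mulrA !tmulE !mul1r !mulr1.
Qed.

End AbstractHopf.

(** With the values of the antipode written out, these are S(x_1) x_2 (x) x_3 = 1 (x) x on the four
    generators. *)
Lemma antipode_relations (K : fieldType) (A : augAlgType K) (q : K)
    (q0 : q != 0) (a b c d : A) :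
  b * a = q^-1 *: (a * b) -> c * a = q^-1 *: (a * c) ->
  d * b = q^-1 *: (b * d) -> d * c = q^-1 *: (c * d) ->
  c * b = b * c -> a * d = 1 + q *: (b * c) -> d * a = 1 + q^-1 *: (b * c) ->
  let Da := a \ox a + b \ox c in let Db := a \ox b + b \ox d in
  let Dc := c \ox a + d \ox c in let Dd := c \ox b + d \ox d in
  [/\ (d \ox 1) * Da + ((- q^-1 *: b) \ox 1) * Dc = 1 \ox a,
      (d \ox 1) * Db + ((- q^-1 *: b) \ox 1) * Dd = 1 \ox b,
      ((- q *: c) \ox 1) * Da + (a \ox 1) * Dc = 1 \ox c &
      ((- q *: c) \ox 1) * Db + (a \ox 1) * Dd = 1 \ox d].
Proof.
move=> ba ca db dc cb ad da /=.
have E := (ba, ca, db, dc, cb, ad, da, @tpureE _ A A).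
split; rewrite !mulrDr !tmulE !mul1r -?scalerAl !E.
all: by lmod_eq K; field.
Qed.

(** * The Hopf algebra structure of SU_q(2) *)

Section HopfTheory.
Variables (R : realType) (q : deformation R).
Local Notation C := R[i].
Local Notation q' := (qC q).
Local Notation P := (SUq2 q).
Local Notation a := (pa q).
Local Notation b := (pb q).
Local Notation c := (pc q).
Local Notation d := (pd q).
Local Notation t := (ht R).
Local Notation ti := (hti R).
Local Notation Dl := (@Delta R q).
Local Notation S := (@antipode R q).

Lemma su2_ind (Q : P -> Prop) :
  Q a -> Q b -> Q c -> Q d -> (forall k, Q k%:A) ->
  (forall x y, Q x -> Q y -> Q (x + y)) ->
  (forall x y, Q x -> Q y -> Q (x * y)) -> forall x, Q x.
Proof. by move=> Qa Qb Qc Qd; apply: palg_ind; case. Qed.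

Lemma Delta_genE : [/\ Dl a = a \ox a + b \ox c, Dl b = a \ox b + b \ox d,
  Dl c = c \ox a + d \ox c & Dl d = c \ox b + d \ox d].
Proof. by split; rewrite /Delta palg_lift_gen //; exact: Delta_genP. Qed.

Lemma antipodeE :
  [/\ S a = d, S b = - q'^-1 *: b, S c = - q' *: c & S d = a].
Proof.
by split; rewrite /antipode palg_lift_gen //; exact: S_genP.
Qed.

Lemma antipodeM x y : S (x * y) = S y * S x.
Proof. exact: (antipode_anti q).2. Qed.

Lemma antipode1 : S 1 = 1.
Proof. exact: (antipode_anti q).1. Qed.

Lemma hopf_mapE : [/\ hopf_map a = t, hopf_map b = 0, hopf_map c = 0 &
  hopf_map d = ti].
Proof. by split; rewrite /hopf_map palg_lift_gen //; exact: hopf_map_genP. Qed.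

Lemma counitE : [/\ counit a = 1, counit b = 0, counit c = 0 & counit d = 1].
Proof.
by split; exact: (palg_lift_gen _ (characterP (su2_presentation q))).
Qed.

Lemma counit_t : counit t = 1 /\ counit ti = 1.
Proof. by split; exact: (palg_lift_gen _ (characterP (u1_presentation R))). Qed.

Lemma hDeltaE : hDelta t = t \ox t /\ hDelta ti = ti \ox ti.
Proof. by split; rewrite /hDelta palg_lift_gen //; exact: hDelta_genP. Qed.

Lemma hantipodeE : hantipode t = ti /\ hantipode ti = t.
Proof. by split; rewrite /hantipode palg_lift_gen //; exact: hS_genP. Qed.

Lemma coactE : [/\ coact a = a \ox t, coact b = b \ox ti, coact c = c \ox t &
  coact d = d \ox ti].
Proof.
have [Da Db Dc Dd] := Delta_genE; have [pia pib pic pid] := hopf_mapE.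
rewrite /coact Da Db Dc Dd !linearD /= !tmapE /= pia pib pic pid.
by rewrite !tpure0r !addr0 !add0r.
Qed.

Lemma counit_alg (A : augAlgType C) k : counit (k%:A : A) = k.
Proof. by rewrite linearZ /= rmorph1 /= [LHS]mulr1. Qed.

Lemma counitr p : contract (@counit C P) (Dl p) = p.
Proof.
have cL := contract_linear (V := P) (@counit_lin _ P).
have [_ cD _ cZ _] := linear_identities cL.
have [Da Db Dc Dd] := Delta_genE; have [ea eb ec ed] := counitE.
elim/su2_ind: p => [||||k|x y hx hy|x y hx hy].
1-4: by rewrite ?(Da, Db, Dc, Dd) cD !contract_pure; try exact: counit_lin;
        rewrite ?(ea, eb, ec, ed) ?scale0r ?scale1r ?addr0 ?add0r.
- rewrite linearZ cZ rmorph1 toneE contract_pure; last exact: counit_lin.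
  by rewrite rmorph1 scale1r.
- by rewrite raddfD cD /= hx hy.
- by rewrite rmorphM contract_mul /= hx hy.
Qed.

Lemma counitl p : contractl (@counit C P) (Dl p) = p.
Proof.
have cL := contractl_linear (W := P) (@counit_lin _ P).
have [_ cD _ cZ _] := linear_identities cL.
have [Da Db Dc Dd] := Delta_genE; have [ea eb ec ed] := counitE.
elim/su2_ind: p => [||||k|x y hx hy|x y hx hy].
1-4: by rewrite ?(Da, Db, Dc, Dd) cD !contractl_pure; try exact: counit_lin;
        rewrite ?(ea, eb, ec, ed) ?scale0r ?scale1r ?addr0 ?add0r.
- rewrite linearZ cZ rmorph1 toneE contractl_pure; last exact: counit_lin.
  by rewrite rmorph1 scale1r.
- by rewrite raddfD cD /= hx hy.
- by rewrite rmorphM contractl_mul /= hx hy.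
Qed.

Lemma su2_alg_ext (B : algType C) (f g : P -> B) :
  linear f -> linear g -> monoid_morphism f -> monoid_morphism g ->
  f a = g a -> f b = g b -> f c = g c -> f d = g d -> f =1 g.
Proof.
move=> /linear_identities[_ fD _ fZ _] /linear_identities[_ gD _ gZ _] [f1 fM] [g1 gM].
move=> ha hb hc hd; elim/su2_ind=> // [k|x y hx hy|x y hx hy].
- by rewrite fZ gZ f1 g1.
- by rewrite fD gD hx hy.
- by rewrite fM gM hx hy.
Qed.

Lemma coassoc p : tassoc (tmap Dl idfun (Dl p)) = tmap idfun Dl (Dl p).
Proof.
have [Da Db Dc Dd] := Delta_genE.
have [lL lM] := coassoc_left_morph (@Delta R q).
have [rL rM] := coassoc_right_morph (@Delta R q).
move: p; apply: (su2_alg_ext (f := fun p => tassoc (tmap Dl idfun (Dl p)))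
  (g := fun p => tmap idfun Dl (Dl p)) lL rL lM rM).
all: rewrite !(Da, Db, Dc, Dd) !linearD /= !tmapE /= !(Da, Db, Dc, Dd);
     rewrite !tpureDl !tpureDr !linearD /= !tassoc_pure; by lmod_eq (R[i]); ring.
Qed.

(* [kappa x] represents the left-invariant form S(x_1) dx_2 *)
Definition kappa : P -> tens P P := hkappa (@Delta R q) (@antipode R q).
Definition galois : tens P P -> tens P P := hgalois (@Delta R q).

Lemma kappaE x : kappa x = tmap S idfun (Dl x).
Proof. by []. Qed.

Lemma kappa_linear : linear kappa.
Proof. exact: hkappa_linear. Qed.

Lemma galois_linear : linear galois.
Proof. exact: hgalois_linear. Qed.

Lemma galois_pure x y : galois (x \ox y) = (x \ox 1) * Dl y.
Proof. exact: hgalois_pure. Qed.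

Lemma galoisMl p u : galois ((p \ox 1) * u) = (p \ox 1) * galois u.
Proof. exact: hgaloisMl. Qed.

Lemma galoisMr u p : galois (u * (1 \ox p)) = galois u * Dl p.
Proof. exact: hgaloisMr. Qed.

Lemma galois_kappa_gen : [/\ galois (kappa a) = 1 \ox a,
  galois (kappa b) = 1 \ox b, galois (kappa c) = 1 \ox c &
  galois (kappa d) = 1 \ox d].
Proof.
have [Da Db Dc Dd] := Delta_genE; have [Sa Sb Sc Sd] := antipodeE.
have [ba ca db dc [cb ad da]] := su2_relE q.
have [_ gD _ _ _] := linear_identities galois_linear.
have [h1 h2 h3 h4] := antipode_relations (qC_neq0 q) ba ca db dc cb ad da.
have E (x y z w : P) : galois (tmap S idfun (x \ox y + z \ox w)) =
    (S x \ox 1) * Dl y + (S z \ox 1) * Dl w.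
  by rewrite linearD /= gD !tmapE !galois_pure.
by split; rewrite kappaE ?(Da, Db, Dc, Dd) E ?(Sa, Sb, Sc, Sd, Da, Db, Dc, Dd).
Qed.

Lemma galois_kappa1 : galois (kappa 1) = 1 \ox 1.
Proof.
by rewrite kappaE (rmorph1 Dl) toneE tmapE /= antipode1 galois_pure (rmorph1 Dl) mulr1.
Qed.

Lemma galois_kappaM x y :
  galois (kappa x) = 1 \ox x -> galois (kappa y) = 1 \ox y ->
  galois (kappa (x * y)) = 1 \ox (x * y).
Proof. by apply: hgalois_kappaM; exact: antipodeM. Qed.

(** This carries the axiom S(x_1) x_2 = epsilon(x), and it makes the Galois map onto, since p
    kappa(x) is a preimage of p (x) x. *)
Lemma galois_kappa x : galois (kappa x) = 1 \ox x.
Proof.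
have [_ gD _ gZ _] := linear_identities galois_linear.
have [_ kD _ kZ _] := linear_identities kappa_linear.
have [ha hb hc hd] := galois_kappa_gen.
elim/su2_ind: x => // [k|x y hx hy|x y hx hy].
- by rewrite kZ gZ tpureZr galois_kappa1.
- by rewrite kD gD hx hy tpureDr.
- exact: galois_kappaM.
Qed.

End HopfTheory.

(** * One-forms on SU_q(2) *)

Section UniversalForms.
Variables (R : realType) (q : deformation R).
Local Notation C := R[i].
Local Notation q' := (qC q).
Local Notation P := (SUq2 q).
Local Notation H := (U1 R).
Local Notation a := (pa q).
Local Notation b := (pb q).
Local Notation c := (pc q).
Local Notation d := (pd q).
Local Notation S := (@antipode R q).
Local Notation kappa := (@kappa R q).
Local Notation galois := (@galois R q).
Local Notation ver_univ := (@ver_univ R q).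

Lemma counit_antipode (x : P) : counit (S x) = counit x.
Proof.
have [ea eb ec ed] := counitE q; have [Sa Sb Sc Sd] := antipodeE q.
elim/su2_ind: x => [||||k|x y hx hy|x y hx hy].
- by rewrite Sa ed ea.
- by rewrite Sb linearZ /= eb scaler0.
- by rewrite Sc linearZ /= ec scaler0.
- by rewrite Sd ed ea.
- by rewrite linearZ /= antipode1.
- by rewrite [S _]linearD !linearD /= hx hy.
- by rewrite antipodeM !rmorphM /= hx hy mulrC.
Qed.

Lemma counit_kappa x : contractl (@counit C P) (kappa x) = x.
Proof.
rewrite kappaE /contractl tlift_tmap; last exact/contractl_bilinear/counit_lin.
rewrite -[RHS](@counitl R q); apply: tlift_ext => u v.
by rewrite counit_antipode.
Qed.

Lemma mul_map_pure (x y : P) : mul_map (x \ox y) = x * y.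
Proof. by rewrite /mul_map tlift_pure //; exact: mul_map_bilinear. Qed.

Lemma contract_mull (A B : augAlgType C) (x : A) (y : B) (f : B -> C^o) u :
  linear f -> contract f ((x \ox 1) * u : tens A B) = x * contract f u.
Proof.
move=> fL; have [f0 fD _ _ _] := linear_identities (contract_linear (V := A) fL).
elim/tens_ind: u => [|u v hu hv|u v]; first by rewrite mulr0 f0 mulr0.
  by rewrite mulrDr !fD hu hv mulrDr.
by rewrite tmulE mul1r !contract_pure // scalerAr.
Qed.

(** Because x y = x y_1 epsilon(y_2). Through the Galois map the universal forms thus correspond to
    P (x) ker(epsilon). *)
Lemma mul_map_galois u : mul_map u = contract (@counit C P) (galois u).
Proof.
have cL := contract_linear (V := P) (@counit_lin _ P).
apply: (tens_eq (f := @mul_map R q)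
  (g := fun u => contract (@counit C P) (galois u))).
- exact: mul_map_linear.
- exact: linear_comp cL (@galois_linear R q).
move=> x y; rewrite mul_map_pure galois_pure contract_mul contract_pure.
  by rewrite rmorph1 scale1r counitr.
exact: counit_lin.
Qed.

Lemma mul_map_kappa x : mul_map (kappa x) = (counit x : C)%:A.
Proof.
by rewrite mul_map_galois galois_kappa contract_pure //; exact: counit_lin.
Qed.

Lemma ver_univ_bilinear : bilinear_map (fun x y : P => (x \ox (1 : H)) * coact y).
Proof.
split=> [y|x] k u v; first by rewrite tpureDl tpureZl mulrDl scalerAl.
by rewrite linearP mulrDr scalerAr.
Qed.

Lemma ver_univ_linear : linear ver_univ.
Proof. exact/tlift_linear/ver_univ_bilinear. Qed.

Lemma ver_univ_pure x y : ver_univ (x \ox y) = (x \ox 1) * coact y.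
Proof. by rewrite /Defs.ver_univ tlift_pure //; exact: ver_univ_bilinear. Qed.

Lemma tmap_hopf_mapMl (p : P) u :
  tmap idfun (@hopf_map R q) ((p \ox 1) * u) =
  (p \ox 1) * tmap idfun (@hopf_map R q) u.
Proof.
have [_ tM] := @tmap_monoid C P P P H idfun (@hopf_map R q).
by rewrite tM tmapE /= rmorph1.
Qed.

(** The coaction is the coproduct followed by the Hopf map on the right leg, so [ver_univ] factors
    through the Galois map and inherits its rules for left and right multiplication. *)
Lemma ver_univ_galois u : ver_univ u = tmap idfun (@hopf_map R q) (galois u).
Proof.
apply: (tens_eq (f := ver_univ)
  (g := fun u => tmap idfun (@hopf_map R q) (galois u))).
- exact: ver_univ_linear.
- by apply: linear_comp (@galois_linear R q); exact: linearP.
by move=> x y; rewrite ver_univ_pure galois_pure tmap_hopf_mapMl.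
Qed.

Lemma ver_univ_kappa x : ver_univ (kappa x) = 1 \ox hopf_map x.
Proof. by rewrite ver_univ_galois galois_kappa tmapE. Qed.

Lemma ver_univMl p u : ver_univ ((p \ox 1) * u) = (p \ox 1) * ver_univ u.
Proof. by rewrite !ver_univ_galois galoisMl tmap_hopf_mapMl. Qed.

Lemma ver_univMr u p : ver_univ (u * (1 \ox p)) = ver_univ u * coact p.
Proof.
have [_ tM] := @tmap_monoid C P P P H idfun (@hopf_map R q).
by rewrite !ver_univ_galois galoisMr tM.
Qed.

Lemma IP_generators_ind (Q : P -> Prop) :
  Q (b ^+ 2) -> Q (c ^+ 2) -> Q (b * (a - d)) -> Q (c * (a - d)) ->
  Q (a ^+ 2 + q' ^+ 2 *: d ^+ 2 - (1 + q' ^+ 2) *: (a * d + q'^-1 *: (b * c))) ->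
  Q (IP_z q * b) -> Q (IP_z q * c) -> Q (IP_z q * (a - d)) ->
  Q (IP_z q * (q' ^+ 2 *: a + d - (q' ^+ 2 + 1)%:A)) ->
  forall g, g \in IP_generators q -> Q g.
Proof.
move=> h1 h2 h3 h4 h5 h6 h7 h8 h9 g; rewrite !in_cons in_nil orbF.
move=> /orP[/eqP->//|/orP[/eqP->//|/orP[/eqP->//|/orP[/eqP->//|]]]].
by move=> /orP[/eqP->//|/orP[/eqP->//|/orP[/eqP->//|/orP[/eqP->//|/eqP->//]]]].
Qed.

Lemma IP_linear0 (W : lmodType C) (f : P -> W) :
  linear f -> (forall g, g \in IP_generators q -> forall p, f (g * p) = 0) ->
  forall x, IP q x -> f x = 0.
Proof.
by move=> fL fg; apply: span_linear0 => // x [g [p [gI ->]]]; exact: fg.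
Qed.

Lemma scale_regular (k : C) (x : C^o) : k *: x = k * x :> C.
Proof. by []. Qed.

Lemma counit_IP x : IP q x -> counit x = 0.
Proof.
have [ea eb ec ed] := counitE q; have q0 := qC_neq0 q.
have [_ eD eN eZ _] := linear_identities (@counit_lin _ P).
have eM (y z : P) : counit (y * z) = counit y * counit z :> C by exact: rmorphM.
have e1 : counit (1 : P) = 1 by exact: rmorph1.
have E := (ea, eb, ec, ed, e1, eM, eD, eN, eZ).
apply: IP_linear0; first exact: counit_lin.
move=> g gI p; rewrite eM; suff -> : counit g = 0 by rewrite mul0r.
elim/IP_generators_ind: gI; rewrite /IP_z ?expr2 !E ?scale_regular.
all: by field.
Qed.

Lemma NP_linear0 (W : lmodType C) (f : tens P P -> W) :
  linear f -> (forall p x, IP q x -> f ((p \ox 1) * kappa x) = 0) ->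
  forall u, NP q u -> f u = 0.
Proof.
move=> fL f0; apply: span_linear0 => // u [p [x [Ix ->]]]; exact: f0.
Qed.

Lemma NP_kappa p x : IP q x -> NP q ((p \ox 1) * kappa x).
Proof. by move=> Ix; apply: (Defs.sub_span (S := @NP_gen R q)); exists p, x. Qed.

Lemma mul_map_NP u : NP q u -> mul_map u = 0.
Proof.
apply: NP_linear0; first exact: mul_map_linear.
by move=> p x Ix; rewrite mul_mapM mul_map_kappa counit_IP // scale0r mulr0.
Qed.

(* the linear map with [Dform (x \ox y) = x dy] *)
Definition Dform (u : tens P P) : Omega1P q := class1P (u - mul_map u \ox 1).

Lemma Dform_univ u : univ_forms q (u - mul_map u \ox 1).
Proof.
have [_ _ _ _ mB] := linear_identities (@mul_map_linear R q).
by rewrite /univ_forms /= mB mul_map_pure mulr1 subrr.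
Qed.

Lemma Dform_linear : linear Dform.
Proof.
apply: (@cls_comp_linear _ _ (univ_forms q) (NP q) _
  (fun u => u - mul_map u \ox 1)); last exact: Dform_univ.
move=> k x y; rewrite mul_map_linear tpureDl tpureZl.
by lmod_eq (R[i]); ring.
Qed.

Lemma Dform_class u : mul_map u = 0 -> Dform u = class1P u.
Proof. by rewrite /Dform => ->; rewrite tpure0l subr0. Qed.

Lemma mul_map_rep (w : Omega1P q) : mul_map (rep1P w) = 0.
Proof. exact: (rep_in w). Qed.

Lemma Dform_rep w : Dform (rep1P w) = w.
Proof. by rewrite Dform_class ?mul_map_rep //; exact: repK. Qed.

Lemma lact_Dform p u : p <*: Dform u = Dform ((p \ox 1) * u).
Proof.
rewrite /Dform class1P_lmul; last exact: Dform_univ.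
by rewrite mulrBr tmulE mulr1 mul_mapM.
Qed.

Lemma Dform_pure x y : Dform (x \ox y) = x <*: dP y.
Proof.
have -> : dP y = Dform (1 \ox y) by rewrite /Dform mul_map_pure mul1r.
by rewrite lact_Dform tmulE mulr1 mul1r.
Qed.

Lemma Dform_NP u : NP q u -> Dform u = 0.
Proof.
move=> Nu; have [c0 _ _ _ _] := linear_identities Dform_linear.
transitivity (Dform 0); last exact: c0.
rewrite !Dform_class ?(univ_forms0 q) ?mul_map_NP //.
apply/cls_eqP; [exact: mul_map_NP | exact: submod0 | by rewrite subr0].
Qed.

Lemma theta_liftE x : theta_lift x = Dform (kappa x).
Proof.
rewrite kappaE /tmap (tlift_comp _ _ Dform_linear).
by apply: tlift_ext => u v; rewrite Dform_pure.
Qed.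

Lemma theta_lift_linear : linear (@theta_lift R q).
Proof.
by move=> k x y; rewrite !theta_liftE kappa_linear Dform_linear.
Qed.

Lemma theta_lift_IP x : IP q x -> theta_lift x = 0.
Proof.
move=> Ix; rewrite theta_liftE Dform_NP //.
by rewrite -[kappa x]mul1r; exact: NP_kappa.
Qed.

(** Contracting the left leg with the counit sends p S(y_1) (x) y_2 to epsilon(p) y, hence N_P into
    I_P, and sends kappa(x) back to x. *)
Lemma kappa_NP x : NP q (kappa x) -> IP q x.
Proof.
have cL := contractl_linear (W := P) (@counit_lin _ P).
rewrite -[x in IP q x]counit_kappa => -[n [k [s [hs ->]]]].
rewrite (linear_map_sum _ _ cL); apply: submod_sum => i.
have [_ _ _ cZ _] := linear_identities cL; rewrite cZ; apply: submodZ.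
have [p [y [Iy ->]]] := hs i.
rewrite contractl_mul contractl_pure; last exact: counit_lin.
rewrite [contractl _ _]counit_kappa -scalerAl mul1r; exact: submodZ.
Qed.

Section Coordinates.
Variables (W : lmodType C) (f : tens P P -> W).
Hypotheses (fL : linear f) (fN : forall u, NP q u -> f u = 0).

Lemma form_map_linear : linear (fun w : Omega1P q => f (rep1P w)).
Proof. exact: descent_linear. Qed.

Lemma form_map_Dform u : f (rep1P (Dform u)) = f (u - mul_map u \ox 1).
Proof. by apply: descent_cls => //; exact: Dform_univ. Qed.

End Coordinates.

End UniversalForms.

(** * The left action of functionals on P *)

Section Regular.
Variables (R : realType) (q : deformation R).
Local Notation C := R[i].
Local Notation P := (SUq2 q).
Local Notation a := (pa q).
Local Notation b := (pb q).
Local Notation c := (pc q).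
Local Notation d := (pd q).
Local Notation Dl := (@Delta R q).
Local Notation kappa := (@kappa R q).
Local Notation galois := (@galois R q).

(** [act pr X] is convertible to [actf (pr X)], and the proofs below switch freely between the
    two. *)
Definition actf (f : P -> C^o) (p : P) : P := contract f (Dl p).

Section Functional.
Variable f : P -> C^o.
Hypothesis fL : linear f.

Lemma actf_linear : linear (actf f).
Proof. by apply: linear_comp (contract_linear fL) _; exact: linearP. Qed.

Lemma actf_gen : [/\ actf f a = f a *: a + f c *: b,
  actf f b = f b *: a + f d *: b, actf f c = f a *: c + f c *: d &
  actf f d = f b *: c + f d *: d].
Proof.
have [Da Db Dc Dd] := Delta_genE q.
have [_ cD _ _ _] := linear_identities (contract_linear (V := P) fL).
by split; rewrite /actf ?(Da, Db, Dc, Dd) cD !contract_pure.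
Qed.

Lemma counit_actf p : counit (actf f p) = f p.
Proof.
rewrite /actf /contract (tlift_comp _ _ (@counit_lin _ P)).
rewrite -[p in RHS](@counitl R q) (tlift_comp _ _ fL).
have [_ _ _ fZ _] := linear_identities fL.
by apply: tlift_ext => u v; rewrite linearZ /= fZ [LHS]mulrC.
Qed.

(** This is the source of the coordinates of one-forms: the right-hand side is the coefficient that
    x dy receives from [f]. *)
Lemma contract_galois_pure x y : contract f (galois (x \ox y)) = x * actf f y.
Proof. by rewrite galois_pure contract_mull. Qed.

Lemma contract_galois_linear : linear (fun u => contract f (galois u)).
Proof. exact: linear_comp (contract_linear fL) (@galois_linear R q). Qed.

Lemma contract_galoisMl p u :
  contract f (galois ((p \ox 1) * u)) = p * contract f (galois u).
Proof. by rewrite galoisMl contract_mull. Qed.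

Lemma contract_galois_kappa x : contract f (galois (kappa x)) = (f x)%:A.
Proof. by rewrite galois_kappa contract_pure. Qed.

Lemma contract_galois_NP : (forall x, IP q x -> f x = 0) ->
  forall u, NP q u -> contract f (galois u) = 0.
Proof.
move=> f0; apply: NP_linear0; first exact: contract_galois_linear.
move=> p x Ix; rewrite contract_galoisMl contract_galois_kappa f0 //.
by rewrite scale0r mulr0.
Qed.

End Functional.

(** The twisted Leibniz rule for a coproduct with two terms. E and F use it as it stands, group-like
    elements with a vanishing second term. *)
Lemma actfM (f f1 f2 f3 f4 : P -> C^o) :
  linear f -> linear f1 -> linear f2 -> linear f3 -> linear f4 ->
  (forall x y, f (x * y) = f1 x * f2 y + f3 x * f4 y) ->
  forall x y, actf f (x * y) = actf f1 x * actf f2 y + actf f3 x * actf f4 y.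
Proof.
move=> fL f1L f2L f3L f4L fM x y; rewrite /actf.
have -> : Dl (x * y) = Dl x * Dl y by exact: rmorphM.
have [f_0 fD _ _ _] := linear_identities (contract_linear (V := P) fL).
have [f1_0 f1D _ _ _] := linear_identities (contract_linear (V := P) f1L).
have [f2_0 f2D _ _ _] := linear_identities (contract_linear (V := P) f2L).
have [f3_0 f3D _ _ _] := linear_identities (contract_linear (V := P) f3L).
have [f4_0 f4D _ _ _] := linear_identities (contract_linear (V := P) f4L).
elim/tens_ind: (Dl x) => [|u u' hu hu'|u v].
- by rewrite mul0r f_0 f1_0 f3_0 !mul0r addr0.
- by rewrite mulrDl fD hu hu' f1D f3D !mulrDl addrACA.
elim/tens_ind: (Dl y) => [|w w' hw hw'|w z].
- by rewrite mulr0 f_0 f2_0 f4_0 !mulr0 addr0.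
- by rewrite mulrDr fD hw hw' f2D f4D !mulrDr addrACA.
rewrite tmulE !contract_pure // fM scalerDl.
by rewrite -!scalerAl -!scalerAr !scalerA.
Qed.

(** The functional on the left is the convolution product of [f] and [g]; coassociativity turns it
    into composition of the actions. *)
Lemma actf_comp (f g : P -> C^o) p : linear f -> linear g ->
  actf (fun x => tlift (fun v w => f v * g w : C^o) (Dl x)) p =
  actf f (actf g p).
Proof.
move=> fL gL; have cfL := contract_linear (V := P) fL.
pose h := tlift (fun v w : P => f v * g w : C^o).
have hb : bilinear_map (fun v w : P => f v * g w : C^o).
  split=> [w|v] k x y; first by rewrite fL mulrDl scalerAl.
  by rewrite gL mulrDr scalerAr.
have hL : linear h by exact: tlift_linear.
have chL := contract_linear (V := P) hL.
transitivity (contract h (tmap idfun Dl (Dl p))).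
  rewrite /actf [RHS]tlift_tmap; last exact: contract_bilinear.
  by [].
rewrite -coassoc /actf.
have -> : Dl (contract g (Dl p)) = contract g (tmap Dl idfun (Dl p)).
  rewrite [RHS]tlift_tmap; last exact: contract_bilinear.
  rewrite /contract (tlift_comp _ _ (linearP Dl)).
  by apply: tlift_ext => u v; rewrite linearZ.
move: (tmap _ _ _) => z.
apply: (tens_eq (f := fun z => contract h (tassoc z))
  (g := fun z => contract f (contract g z))).
- by apply: linear_comp chL _; exact: tassoc_linear.
- by apply: linear_comp cfL _; exact: contract_linear.
move=> u w; elim/tens_ind: u => [|u v hu hv|u v].
- have [c0 _ _ _ _] := linear_identities chL; have [c0' _ _ _ _] := linear_identities cfL.
  have [c0'' _ _ _ _] := linear_identities (contract_linear (V := tens P P) gL).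
  by rewrite tpure0l linear0 c0 c0'' c0'.
- have [_ cD _ _ _] := linear_identities chL; have [_ cD' _ _ _] := linear_identities cfL.
  have [_ cD'' _ _ _] := linear_identities (contract_linear (V := tens P P) gL).
  by rewrite tpureDl linearD /= cD hu hv cD'' cD'.
rewrite tassoc_pure !contract_pure // /h tlift_pure //.
have [_ _ _ cZ _] := linear_identities cfL.
by rewrite cZ contract_pure // scalerA mulrC.
Qed.

End Regular.

(** * The pairing with the enveloping algebra *)

Section Pairing.
Variables (R : realType) (q : deformation R).
Variable pr : Uqsu2 q -> SUq2 q -> R[i].
Hypothesis hpr : dual_pairing pr.
Local Notation C := R[i].
Local Notation q' := (qC q).
Local Notation s := (sqrt_qC q).
Local Notation P := (SUq2 q).
Local Notation U := (Uqsu2 q).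
Local Notation a := (pa q).
Local Notation b := (pb q).
Local Notation c := (pc q).
Local Notation d := (pd q).
Local Notation K := (uK q).
Local Notation Ki := (uKi q).
Local Notation E := (uE q).
Local Notation F := (uF q).
Local Notation act := (act pr).

Lemma sqrt_qC_neq0 : s != 0.
Proof.
rewrite /sqrt_qC eq_complex /= eqxx andbT gt_eqF //.
by rewrite sqrtr_gt0; case/andP: (qval_range q).
Qed.

Lemma qC_sqrt : q' = s ^+ 2.
Proof.
rewrite /qC /sqrt_qC -rmorphXn /= sqr_sqrtr //.
by rewrite ltW //; case/andP: (qval_range q).
Qed.

Lemma pr_linear X : linear (pr X : P -> C^o).
Proof. exact: pairing_linr hpr X. Qed.

Lemma pr_linearl p : linear (pr^~ p : U -> C^o).
Proof. exact: pairing_linl hpr p. Qed.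

Lemma act_linear X : linear (act X).
Proof. exact/actf_linear/pr_linear. Qed.

Lemma act_linearl p : linear (act^~ p).
Proof.
apply: (tlift_linear_param (f := fun X p1 p2 => pr X p2 *: p1)) => u v k X Y.
by rewrite (pr_linearl v) scalerDl scalerA.
Qed.

Lemma actM X Y p : act (X * Y) p = act X (act Y p).
Proof.
rewrite -[RHS](actf_comp p (pr_linear X) (pr_linear Y)).
by apply: tlift_ext => u v; rewrite (pairing_mull hpr).
Qed.

Lemma pr_genM X Y :
  [/\ pr (X * Y) a = pr X a * pr Y a + pr X b * pr Y c,
      pr (X * Y) b = pr X a * pr Y b + pr X b * pr Y d,
      pr (X * Y) c = pr X c * pr Y a + pr X d * pr Y c &
      pr (X * Y) d = pr X c * pr Y b + pr X d * pr Y d].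
Proof.
have [Da Db Dc Dd] := Delta_genE q.
have hb : bilinear_map (fun v w : P => pr X v * pr Y w : C^o).
  split=> [w|v] k x y; first by rewrite (pr_linear X) mulrDl scalerAl.
  by rewrite (pr_linear Y) mulrDr scalerAr.
have [_ lD _ _ _] := linear_identities (tlift_linear hb).
by split; rewrite (pairing_mull hpr) ?(Da, Db, Dc, Dd) lD !tlift_pure.
Qed.

Lemma pr_mul_bilinear x y : bilinear_map (fun X Y : U => pr X x * pr Y y : C^o).
Proof.
split=> [Y|X] k V W; first by rewrite (pr_linearl x) mulrDl scalerAl.
by rewrite (pr_linearl y) mulrDr scalerAr.
Qed.

Lemma uDelta_genE : [/\ uDelta K = K \ox K, uDelta Ki = Ki \ox Ki,
  uDelta E = E \ox K + Ki \ox E & uDelta F = F \ox K + Ki \ox F].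
Proof. by split; rewrite /uDelta palg_lift_gen //; exact: uDelta_genP. Qed.

Lemma prK x y : pr K (x * y) = pr K x * pr K y.
Proof.
have [dK _ _ _] := uDelta_genE.
by rewrite (pairing_mulr hpr) dK tlift_pure //; exact: pr_mul_bilinear.
Qed.

Lemma prKi x y : pr Ki (x * y) = pr Ki x * pr Ki y.
Proof.
have [_ dK _ _] := uDelta_genE.
by rewrite (pairing_mulr hpr) dK tlift_pure //; exact: pr_mul_bilinear.
Qed.

Lemma prE x y : pr E (x * y) = pr E x * pr K y + pr Ki x * pr E y.
Proof.
have [_ _ dE _] := uDelta_genE; have hb := pr_mul_bilinear x y.
have [_ lD _ _ _] := linear_identities (tlift_linear hb).
by rewrite (pairing_mulr hpr) dE lD !tlift_pure.
Qed.

Lemma prF x y : pr F (x * y) = pr F x * pr K y + pr Ki x * pr F y.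
Proof.
have [_ _ _ dF] := uDelta_genE; have hb := pr_mul_bilinear x y.
have [_ lD _ _ _] := linear_identities (tlift_linear hb).
by rewrite (pairing_mulr hpr) dF lD !tlift_pure.
Qed.

Lemma pr_mulE X Y x y : pr (X * Y) (x * y) =
  tlift (fun V W => pr V x * pr W y : C^o) (uDelta X * uDelta Y).
Proof. by rewrite (pairing_mulr hpr); congr (tlift _ _); exact: rmorphM. Qed.

Lemma prKK x y : pr (K * K) (x * y) = pr (K * K) x * pr (K * K) y.
Proof.
have [dK _ _ _] := uDelta_genE.
by rewrite pr_mulE dK tmulE tlift_pure //; exact: pr_mul_bilinear.
Qed.

Lemma prKiKi x y : pr (Ki * Ki) (x * y) = pr (Ki * Ki) x * pr (Ki * Ki) y.
Proof.
have [_ dK _ _] := uDelta_genE.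
by rewrite pr_mulE dK tmulE tlift_pure //; exact: pr_mul_bilinear.
Qed.

(** K K^-1 = 1 reduces the coproduct of E K^-1 to E K^-1 (x) 1 + K^-2 (x) E K^-1, which is the
    effect of the factor K^-1 in L_+; L_- is treated likewise. *)
Lemma prEKi x y :
  pr (E * Ki) (x * y) = pr (E * Ki) x * counit y + pr (Ki * Ki) x * pr (E * Ki) y.
Proof.
have [_ dK dE _] := uDelta_genE; have hb := pr_mul_bilinear x y.
have [_ lD _ _ _] := linear_identities (tlift_linear hb).
have [KKi _ _ _ _] := uq_relE q.
by rewrite pr_mulE dK dE mulrDl !tmulE lD !tlift_pure // KKi (pairing_1l hpr).
Qed.

Lemma prFKi x y :
  pr (F * Ki) (x * y) = pr (F * Ki) x * counit y + pr (Ki * Ki) x * pr (F * Ki) y.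
Proof.
have [_ dK _ dF] := uDelta_genE; have hb := pr_mul_bilinear x y.
have [_ lD _ _ _] := linear_identities (tlift_linear hb).
have [KKi _ _ _ _] := uq_relE q.
by rewrite pr_mulE dK dF mulrDl !tmulE lD !tlift_pure // KKi (pairing_1l hpr).
Qed.

(** The four terms come from multiplying out Delta(F) Delta(E); the factor q^-1 arises from
    rewriting K^-1 E as E K^-1 in the third. *)
Lemma prFE x y : pr (F * E) (x * y) =
  pr (F * E) x * pr (K * K) y + pr (F * Ki) x * pr (K * E) y +
  q'^-1 * pr (E * Ki) x * pr (F * K) y + pr (Ki * Ki) x * pr (F * E) y.
Proof.
have [_ _ dE dF] := uDelta_genE; have hb := pr_mul_bilinear x y.
have [_ lD _ lZ _] := linear_identities (tlift_linear hb).
have [_ _ _ KiE _] := uq_relE q.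
rewrite pr_mulE dE dF mulrDl !mulrDr !tmulE KiE tpureZl.
by rewrite !lD !lZ !tlift_pure // scale_regular; ring.
Qed.

Lemma pr_gen : [/\ [/\ pr K a = s^-1, pr K b = 0, pr K c = 0 & pr K d = s],
  [/\ pr Ki a = s, pr Ki b = 0, pr Ki c = 0 & pr Ki d = s^-1],
  [/\ pr E a = 0, pr E b = 0, pr E c = 1 & pr E d = 0] &
  [/\ pr F a = 0, pr F b = 1, pr F c = 0 & pr F d = 0]].
Proof. by split; split; rewrite (pairing_gen hpr). Qed.

End Pairing.

(** * Values of the tangent vectors L_j *)

Section TangentVectors.
Variables (R : realType) (q : deformation R).
Variable pr : Uqsu2 q -> SUq2 q -> R[i].
Hypothesis hpr : dual_pairing pr.
Local Notation C := R[i].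
Local Notation q' := (qC q).
Local Notation s := (sqrt_qC q).
Local Notation P := (SUq2 q).
Local Notation U := (Uqsu2 q).
Local Notation a := (pa q).
Local Notation b := (pb q).
Local Notation c := (pc q).
Local Notation d := (pd q).
Local Notation K := (uK q).
Local Notation Ki := (uKi q).
Local Notation E := (uE q).
Local Notation F := (uF q).

Lemma pr_table :
  [/\ [/\ pr (K * K) a = s ^- 2, pr (K * K) b = 0, pr (K * K) c = 0 &
          pr (K * K) d = s ^+ 2],
      [/\ pr (Ki * Ki) a = s ^+ 2, pr (Ki * Ki) b = 0, pr (Ki * Ki) c = 0 &
          pr (Ki * Ki) d = s ^- 2],
      [/\ pr (E * Ki) a = 0, pr (E * Ki) b = 0, pr (E * Ki) c = s &
          pr (E * Ki) d = 0],
      [/\ pr (F * Ki) a = 0, pr (F * Ki) b = s^-1, pr (F * Ki) c = 0 &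
          pr (F * Ki) d = 0] &
  [/\ [/\ pr (K * E) a = 0, pr (K * E) b = 0, pr (K * E) c = s &
          pr (K * E) d = 0],
      [/\ pr (F * K) a = 0, pr (F * K) b = s, pr (F * K) c = 0 &
          pr (F * K) d = 0] &
      [/\ pr (F * E) a = 1, pr (F * E) b = 0, pr (F * E) c = 0 &
          pr (F * E) d = 0]]].
Proof.
have [hK hKi hE hF] := pr_gen hpr.
case: hK hKi hE hF => [Ka Kb Kc Kd] [Kia Kib Kic Kid] [Ea Eb Ec Ed] [Fa Fb Fc Fd].
have Ta X Y := let: And4 h _ _ _ := pr_genM hpr X Y in h.
have Tb X Y := let: And4 _ h _ _ := pr_genM hpr X Y in h.
have Tc X Y := let: And4 _ _ h _ := pr_genM hpr X Y in h.
have Td X Y := let: And4 _ _ _ h := pr_genM hpr X Y in h.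
have V := (Ka, Kb, Kc, Kd, Kia, Kib, Kic, Kid, Ea, Eb, Ec, Ed, Fa, Fb, Fc, Fd).
have s0 := sqrt_qC_neq0 q.
split; [split|split|split|split|split; split];
  rewrite (Ta, Tb, Tc, Td) !V ?(mul0r, mulr0, mul1r, mulr1, addr0, add0r) //.
all: by field.
Qed.

Lemma pr_linearE X : [/\ {morph pr X : x y / x + y}, {morph pr X : x / - x},
  (forall k x, pr X (k *: x) = k * pr X x) & {morph pr X : x y / x - y}].
Proof. by have [_ pD pN pZ pB] := linear_identities (pr_linear hpr X); split. Qed.

Lemma pr1 X : pr X 1 = counit X. Proof. exact: pairing_1r hpr X. Qed.

Lemma counit_uq : [/\ counit K = 1, counit Ki = 1, counit E = 0 & counit F = 0].
Proof.
by split; exact: (palg_lift_gen _ (characterP (uq_presentation q))).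
Qed.

Lemma pr_unit : [/\ pr (K * K) 1 = 1, pr (Ki * Ki) 1 = 1, pr (E * Ki) 1 = 0,
  pr (F * Ki) 1 = 0 & pr (F * E) 1 = 0].
Proof.
have [eK eKi eE eF] := counit_uq.
have eM (X Y : U) : counit (X * Y) = counit X * counit Y :> C by exact: rmorphM.
by rewrite !pr1 !eM eK eKi eE eF !mul0r !mulr1.
Qed.

(** In L_j(g p) every term has one of these five expressions in [g] as a factor, so vanishing on the
    generators spreads to the right ideal. K^2 and F E do not vanish separately on the fifth
    generator; only their combination in L_0 does. *)
Lemma pr_IP_generators g : g \in IP_generators q ->
  [/\ pr (Ki * Ki) g = 0, pr (E * Ki) g = 0, pr (F * Ki) g = 0, counit g = 0 &
      pr (K * K) g + nu q ^+ 2 * q'^-1 * pr (F * E) g = 0].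
Proof.
have [[A1 A2 A3 A4] [B1 B2 B3 B4] [C1 C2 C3 C4] [D1 D2 D3 D4]
  [[E1 E2 E3 E4] [F1 F2 F3 F4] [G1 G2 G3 G4]]] := pr_table.
have [ea eb ec ed] := counitE q.
have [_ eD eN eZ _] := linear_identities (@counit_lin _ P).
have eM (y z : P) : counit (y * z) = counit y * counit z :> C by exact: rmorphM.
have e1 : counit (1 : P) = 1 by exact: rmorph1.
have [u1 u2 u3 u4 u5] := pr_unit.
have M := (prKK hpr, prKiKi hpr, prEKi hpr, prFKi hpr, prFE hpr).
have D X := let: And4 h _ _ _ := pr_linearE X in h.
have N X := let: And4 _ h _ _ := pr_linearE X in h.
have Z X := let: And4 _ _ h _ := pr_linearE X in h.
have L := (M, D, N, Z, u1, u2, u3, u4, u5, eD, eN, eZ, eM, e1).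
have V := (A1, A2, A3, A4, B1, B2, B3, B4, C1, C2, C3, C4, D1, D2, D3, D4,
  E1, E2, E3, E4, F1, F2, F3, F4, G1, G2, G3, G4, ea, eb, ec, ed).
have s0 := sqrt_qC_neq0 q.
elim/IP_generators_ind; rewrite /IP_z ?expr2; split; rewrite !L ?V ?scale_regular.
all: by rewrite /nu ?(qC_sqrt q); field.
Qed.

Lemma pr_linearlE x : [/\ {morph pr^~ x : X Y / X + Y}, {morph pr^~ x : X / - X},
  (forall k X, pr (k *: X) x = k * pr X x) & {morph pr^~ x : X Y / X - Y}].
Proof. by have [_ pD pN pZ pB] := linear_identities (pr_linearl hpr x); split. Qed.

Lemma pr_Lplus x : pr (Lplus q) x = s^-1 * pr (E * Ki) x.
Proof. by have [_ _ ->] := pr_linearlE x. Qed.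

Lemma pr_Lminus x : pr (Lminus q) x = s * pr (F * Ki) x.
Proof. by have [_ _ ->] := pr_linearlE x. Qed.

Lemma pr_Lzero x : pr (Lzero q) x =
  pr (K * K) x + nu q ^+ 2 * q'^-1 * pr (F * E) x - counit x.
Proof.
have [pD _ pZ pB] := pr_linearlE x.
by rewrite /Lzero pB pD pZ expr2 (pairing_1l hpr).
Qed.

Lemma pr_Lz x : pr (Lz q) x = pr (Ki * Ki) x - counit x.
Proof.
have [_ _ _ pB] := pr_linearlE x.
by rewrite /Lz pB expr2 (pairing_1l hpr).
Qed.

Inductive tangent := Tminus | Tzero | Tplus | Tz.

Definition tangent_vector (i : tangent) : U :=
  match i with
  | Tminus => Lminus q | Tzero => Lzero q | Tplus => Lplus q | Tz => Lz q
  end.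
Local Notation L := tangent_vector.

Lemma pr_tangent_1 i : pr (L i) 1 = 0.
Proof.
have [u1 u2 u3 u4 u5] := pr_unit.
have e1 : counit (1 : P) = 1 by exact: rmorph1.
case: i; rewrite /= ?(pr_Lplus, pr_Lminus, pr_Lzero, pr_Lz).
all: by rewrite ?(u1, u2, u3, u4, u5) ?e1 ?mulr0 ?addr0 ?subrr.
Qed.

Lemma pr_tangent_IP i x : IP q x -> pr (L i) x = 0.
Proof.
apply: IP_linear0; first exact: pr_linear.
move=> g /pr_IP_generators[g1 g2 g3 g4 g5] p.
have eM (y z : P) : counit (y * z) = counit y * counit z :> C by exact: rmorphM.
case: i; rewrite /= ?(pr_Lplus, pr_Lminus, pr_Lzero, pr_Lz).
- by rewrite (prFKi hpr) g1 g3 !mul0r addr0 mulr0.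
- rewrite (prFE hpr) (prKK hpr) eM g1 g2 g3 g4.
  (* The two remaining terms share the factor [pr (K * K) p], and their coefficients add up to the
     left-hand side of [g5]. *)
  rewrite !(mul0r, mulr0, addr0, subr0) mulrA -mulrDl.
  by rewrite g5 mul0r.
- by rewrite (prEKi hpr) g1 g2 !mul0r addr0 mulr0.
- by rewrite (prKiKi hpr) eM g1 g4 !mul0r subr0.
Qed.

(** On [a * b], [b * c], [c * d] the vectors L_-, L_0, L_+ are diagonal and L_z vanishes; the
    diagonal entries are the constants of the soldering form. The element [a] is added to detect
    L_z; its L_0 value is left open and subtracted later. *)
Lemma pr_tangent_frame :
  [/\ [/\ pr (Lminus q) (a * b) = q', pr (Lzero q) (a * b) = 0,
          pr (Lplus q) (a * b) = 0 & pr (Lz q) (a * b) = 0],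
      [/\ pr (Lminus q) (b * c) = 0, pr (Lzero q) (b * c) = nu q ^+ 2 * q'^-1,
          pr (Lplus q) (b * c) = 0 & pr (Lz q) (b * c) = 0],
      [/\ pr (Lminus q) (c * d) = 0, pr (Lzero q) (c * d) = 0,
          pr (Lplus q) (c * d) = 1 & pr (Lz q) (c * d) = 0] &
      [/\ pr (Lminus q) a = 0, pr (Lplus q) a = 0 & pr (Lz q) a = q' - 1]].
Proof.
have [[A1 A2 A3 A4] [B1 B2 B3 B4] [C1 C2 C3 C4] [D1 D2 D3 D4]
  [[E1 E2 E3 E4] [F1 F2 F3 F4] [G1 G2 G3 G4]]] := pr_table.
have [ea eb ec ed] := counitE q.
have eM (y z : P) : counit (y * z) = counit y * counit z :> C by exact: rmorphM.
have V := (A1, A2, A3, A4, B1, B2, B3, B4, C1, C2, C3, C4, D1, D2, D3, D4,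
  E1, E2, E3, E4, F1, F2, F3, F4, G1, G2, G3, G4, ea, eb, ec, ed).
have M := (prKK hpr, prKiKi hpr, prEKi hpr, prFKi hpr, prFE hpr, eM).
have s0 := sqrt_qC_neq0 q.
split; [split|split|split|split];
  rewrite (pr_Lplus, pr_Lminus, pr_Lzero, pr_Lz) ?M !V /nu ?(qC_sqrt q).
all: by field.
Qed.

End TangentVectors.

(** * The left-invariant frame of Omega^1 P *)

Section Frame.
Variables (R : realType) (q : deformation R).
Variable pr : Uqsu2 q -> SUq2 q -> R[i].
Hypothesis hpr : dual_pairing pr.
Variables omega_m omega_0 omega_p omega_z : Omega1P q.
Hypothesis homega : dual_forms pr omega_m omega_0 omega_p omega_z.
Local Notation C := R[i].
Local Notation q' := (qC q).
Local Notation P := (SUq2 q).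
Local Notation a := (pa q).
Local Notation b := (pb q).
Local Notation c := (pc q).
Local Notation d := (pd q).
Local Notation L := (@tangent_vector R q).
Local Notation act := (act pr).

Lemma lactE p (w : Omega1P q) : p <*: w = Dform ((p \ox 1) * rep1P w).
Proof. by rewrite -lact_Dform Dform_rep. Qed.

Lemma lact_linear p : linear (lact p : Omega1P q -> Omega1P q).
Proof.
move=> k x y; rewrite -lactZ; exact: (scalerDr p (_ : left_Omega1P q)).
Qed.

Lemma lact_linearl (w : Omega1P q) : linear ((@lact R q)^~ w).
Proof.
move=> k x y; rewrite !lactE tpureDl tpureZl mulrDl -scalerAl.
exact: Dform_linear.
Qed.

Lemma lactM p p' (w : Omega1P q) : p <*: (p' <*: w) = (p * p') <*: w.
Proof. exact: lactA. Qed.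

Lemma lact_scalar k (w : Omega1P q) : k%:A <*: w = k *: w.
Proof.
have [_ _ _ lZ _] := linear_identities (lact_linearl w).
by rewrite lZ; congr (_ *: _); exact: lact1.
Qed.

Definition coord (i : tangent) (w : Omega1P q) : P :=
  contract (pr (L i) : P -> C^o) (galois (rep1P w)).

Lemma coord_linear i : linear (coord i).
Proof.
apply: (form_map_linear (f := fun u => contract (pr (L i) : P -> C^o) (galois u))).
- exact/contract_galois_linear/pr_linear.
- by apply: contract_galois_NP => [|x]; [exact: pr_linear | exact: pr_tangent_IP].
Qed.

Lemma coord_Dform i u :
  coord i (Dform u) = contract (pr (L i) : P -> C^o) (galois u).
Proof.
have prL := pr_linear hpr (L i).
rewrite /coord (form_map_Dform (contract_galois_linear prL)); last first.
  by apply: contract_galois_NP => // x; exact: pr_tangent_IP.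
have [_ _ _ _ cB] := linear_identities (contract_galois_linear prL).
rewrite cB contract_galois_pure // -[X in _ - _ * X]/(act (L i) 1).
have -> : act (L i) 1 = 0.
  rewrite /Defs.act (rmorph1 (@Delta R q)) -[tlift _ _]/(contract _ _).
  by rewrite contract_pure // (pr_tangent_1 hpr) scale0r.
by rewrite mulr0 subr0.
Qed.

Lemma coord_lact i p w : coord i (p <*: w) = p * coord i w.
Proof.
rewrite lactE coord_Dform contract_galoisMl; last exact: pr_linear.
by rewrite -coord_Dform Dform_rep.
Qed.

Lemma coord_dP i p : coord i (dP p) = act (L i) p.
Proof.
have -> : dP p = Dform (1 \ox p).
  by rewrite Dform_pure; apply/esym; exact: lact1.
by rewrite coord_Dform contract_galois_pure ?mul1r //; exact: pr_linear.
Qed.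

Lemma coord_theta_lift i x : coord i (theta_lift x) = (pr (L i) x)%:A.
Proof.
by rewrite theta_liftE coord_Dform contract_galois_kappa //; exact: pr_linear.
Qed.

(** Both sides are linear in a representative of [w], and on x dy the claim is the defining formula
    [homega] multiplied by x. *)
Lemma coordK w : w = (coord Tminus w <*: omega_m) + (coord Tzero w <*: omega_0)
                   + (coord Tplus w <*: omega_p) + (coord Tz w <*: omega_z).
Proof.
rewrite -[w]Dform_rep !coord_Dform.
move: (rep1P w) => u; apply: (tens_eq (f := @Dform R q) (g := fun u =>
  (contract (pr (Lminus q) : P -> C^o) (galois u) <*: omega_m) +
  (contract (pr (Lzero q) : P -> C^o) (galois u) <*: omega_0) +
  (contract (pr (Lplus q) : P -> C^o) (galois u) <*: omega_p) +
  (contract (pr (Lz q) : P -> C^o) (galois u) <*: omega_z))).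
- exact: Dform_linear.
- move=> k x y.
  have cL X := contract_galois_linear (pr_linear hpr X).
  rewrite !cL !lact_linearl; lmod_eq (R[i]); ring.
move=> x y; rewrite Dform_pure homega !contract_galois_pure; try exact: pr_linear.
have [_ lD _ _ _] := linear_identities (lact_linear x).
by rewrite !lD !lactM.
Qed.

Lemma theta_lift_decomp x : theta_lift x =
  pr (Lminus q) x *: omega_m + pr (Lzero q) x *: omega_0 +
  pr (Lplus q) x *: omega_p + pr (Lz q) x *: omega_z.
Proof. by rewrite [LHS]coordK !coord_theta_lift !lact_scalar. Qed.

Lemma theta_lift_frame :
  [/\ theta_lift (a * b) = q' *: omega_m,
      theta_lift (b * c) = (nu q ^+ 2 * q'^-1) *: omega_0 &
      theta_lift (c * d) = omega_p].
Proof.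
have [[m1 m2 m3 m4] [z1 z2 z3 z4] [p1 p2 p3 p4] _] := pr_tangent_frame hpr.
split; rewrite theta_lift_decomp ?(m1, m2, m3, m4, z1, z2, z3, z4, p1, p2, p3, p4).
all: by rewrite !scale0r ?scale1r ?addr0 ?add0r.
Qed.

Lemma qC_neq1 : q' - 1 != 0.
Proof.
rewrite subr_eq0 /qC; apply/eqP => /(congr1 (@complex.Re R)) /= e.
by have := qval_range q; rewrite e ltxx andbF.
Qed.

Lemma nu_neq0 : nu q != 0.
Proof.
have q0 := qC_neq0 q; have /andP[h0 h1] := qval_range q.
apply/eqP => /(congr1 (fun x => x * q')); rewrite mul0r /nu mulrBl mulVf //.
move/eqP; rewrite subr_eq0 -expr2 /qC -rmorphXn => /eqP/(congr1 (@complex.Re R)) /= e.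
have : qval q ^+ 2 < 1 by rewrite expr_lt1 // ltW.
by rewrite e ltxx.
Qed.

(** Each form is solved for in terms of [theta_lift] of ab, bc, cd and a, whose coordinates are the
    scalars L_j of these elements. This needs q, nu and q - 1 to be nonzero, and it yields the
    freeness of Omega^1 P without a basis of P. *)
Lemma coord_omega : [/\
  [/\ coord Tminus omega_m = 1, coord Tzero omega_m = 0,
      coord Tplus omega_m = 0 & coord Tz omega_m = 0],
  [/\ coord Tminus omega_0 = 0, coord Tzero omega_0 = 1,
      coord Tplus omega_0 = 0 & coord Tz omega_0 = 0],
  [/\ coord Tminus omega_p = 0, coord Tzero omega_p = 0,
      coord Tplus omega_p = 1 & coord Tz omega_p = 0] &
  [/\ coord Tminus omega_z = 0, coord Tzero omega_z = 0,
      coord Tplus omega_z = 0 & coord Tz omega_z = 1]].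
Proof.
have [[m1 m2 m3 m4] [z1 z2 z3 z4] [p1 p2 p3 p4] [a1 a2 a3]] := pr_tangent_frame hpr.
have [tm t0 tp] := theta_lift_frame.
have q0 := qC_neq0 q; have q1 := qC_neq1; have n0 := nu_neq0.
have n1 : nu q ^+ 2 * q'^-1 != 0 by rewrite mulf_neq0 ?expf_neq0 ?invr_neq0.
have inv (k : C) (w w' : Omega1P q) : k != 0 -> w = k *: w' -> w' = k^-1 *: w.
  by move=> k0 ->; rewrite scalerA mulVf // scale1r.
have {tm} em := inv _ _ _ q0 tm; have {t0} e0 := inv _ _ _ n1 t0.
(* [a] may pair with L_0 as well; that contribution is removed before dividing by L_z(a) = q - 1. *)
have ez : omega_z = (q' - 1)^-1 *: (theta_lift a - pr (Lzero q) a *: omega_0).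
  apply: inv => //; rewrite theta_lift_decomp a1 a2 a3 !scale0r add0r addr0.
  by rewrite addrC addKr.
have cZ i := let: And5 _ _ _ h _ := linear_identities (coord_linear i) in h.
have cB i := let: And5 _ _ _ _ h := linear_identities (coord_linear i) in h.
split; rewrite ?ez ?e0 ?em -?tp ?(cZ, cB) !coord_theta_lift /=.
all: rewrite ?(m1, m2, m3, m4, z1, z2, z3, z4, p1, p2, p3, p4, a1, a2, a3).
all: rewrite ?(scale0r, scaler0, scale1r, subr0, sub0r) ?scalerA.
all: by rewrite ?(divfK n1) ?mulVf ?scale1r ?subrr ?scaler0 //.
Qed.

Lemma coord_sum pm p0 pp pz i :
  coord i ((pm <*: omega_m) + (p0 <*: omega_0) + (pp <*: omega_p)
           + (pz <*: omega_z)) =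
  match i with Tminus => pm | Tzero => p0 | Tplus => pp | Tz => pz end.
Proof.
have [[m1 m2 m3 m4] [z1 z2 z3 z4] [p1 p2 p3 p4] [a1 a2 a3 a4]] := coord_omega.
have [_ cD _ _ _] := linear_identities (coord_linear i).
rewrite !cD !coord_lact; clear cD; case: i.
all: rewrite (m1, m2, m3, m4) (z1, z2, z3, z4) (p1, p2, p3, p4) (a1, a2, a3, a4).
all: by rewrite !mulr0 mulr1 ?add0r ?addr0.
Qed.

(** The coefficients of [theta_lift x] are the L_j(x), so kappa(x) represents the zero form and lies
    in N_P. Together with [pr_tangent_IP] this makes I_P accessible through functionals alone. *)
Lemma IP_tangent x : counit x = 0 -> (forall i, pr (L i) x = 0) -> IP q x.
Proof.
move=> ex hx; apply: kappa_NP.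
have mk : mul_map (kappa x) = 0 by rewrite mul_map_kappa ex scale0r.
have : Dform (kappa x) = 0.
  rewrite -theta_liftE theta_lift_decomp.
  rewrite (hx Tminus) (hx Tzero) (hx Tplus) (hx Tz).
  by rewrite !scale0r !addr0.
rewrite Dform_class // => h.
have : class1P (kappa x) = class1P 0.
  have [c0 _ _ _ _] := linear_identities (@Dform_linear R q).
  by rewrite h -[LHS]c0 Dform_class // (univ_forms0 q).
by move/cls_eqP; rewrite subr0; apply; [exact: mk | exact: submod0].
Qed.

End Frame.

(** * Extraction of eigencomponents from a sum of eigenvectors *)

Section EigenvectorSum.
Variables (K : fieldType) (V : lmodType K) (f : V -> V).
Hypothesis fL : linear f.

Definition eigen_shift (cs : seq K) (y : V) : V :=
  foldr (fun k z => f z - k *: z) y cs.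

Lemma eigen_shift_linear cs : linear (eigen_shift cs).
Proof.
elim: cs => // k cs ih m x y; rewrite /= !ih fL.
by rewrite scalerBr scalerDr opprD addrACA !scalerA [k * m]mulrC.
Qed.

Lemma eigen_shiftE cs e y : f y = e *: y ->
  eigen_shift cs y = (\prod_(k <- cs) (e - k)) *: y.
Proof.
move=> fy; elim: cs => [|k cs ih]; first by rewrite big_nil scale1r.
have [_ _ _ fZ _] := linear_identities fL.
by rewrite /= ih fZ fy big_cons !scalerA -scalerBl mulrBl [e * _]mulrC.
Qed.

(* Applying the product of the [f - k] over the eigenvalues [k] other than
   [e] kills the other eigenvectors. *)
Lemma eigenvector_sum (r : seq (K * V)) e x :
  (forall p, p \in r -> f p.2 = p.1 *: p.2) -> f x = e *: x ->
  x = \sum_(p <- r) p.2 -> x = \sum_(p <- r | p.1 == e) p.2.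
Proof.
move=> hr fx xE; set cs := [seq p.1 | p <- r & p.1 != e].
pose m := \prod_(k <- cs) (e - k).
have m0 : m != 0.
  rewrite prodf_seq_neq0; apply/allP => k /mapP[p]; rewrite mem_filter.
  by move=> /andP[pe _] -> /=; rewrite subr_eq0 eq_sym.
apply: (scalerI m0); rewrite -(eigen_shiftE cs fx) {1}xE.
rewrite (linear_map_sum _ _ (eigen_shift_linear cs)) (bigID (fun p => p.1 == e)) /=.
rewrite [X in _ + X]big_seq_cond [X in _ + X]big1 ?addr0; last first.
  move=> p /andP[pr pe]; rewrite (eigen_shiftE _ (hr _ pr)).
  have pcs : p.1 \in cs by apply/mapP; exists p; rewrite ?mem_filter ?pe.
  suff /eqP -> : \prod_(k <- cs) (p.1 - k) == 0 by rewrite scale0r.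
  by rewrite prodf_seq_eq0; apply/hasP; exists p.1; rewrite // subrr eqxx.
rewrite scaler_sumr [LHS]big_seq_cond [RHS]big_seq_cond.
apply: eq_bigr => p /andP[pr /eqP pe].
by rewrite (eigen_shiftE _ (hr _ pr)) pe.
Qed.

End EigenvectorSum.

(** * The gradings of SU_q(2) *)

Section Grading.
Variables (R : realType) (q : deformation R).
Local Notation C := R[i].
Local Notation q' := (qC q).
Local Notation P := (SUq2 q).
Local Notation H := (U1 R).
Local Notation a := (pa q).
Local Notation b := (pb q).
Local Notation c := (pc q).
Local Notation d := (pd q).
Local Notation t := (ht R).
Local Notation ti := (hti R).
Local Notation tpow := (tpow R).

(** Commutativity makes the antipode of H, constructed as an anti-homomorphism, multiplicative; this
    lets [coact_lift] respect products. *)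
Lemma u1_mulC : @commutative H H *%R.
Proof.
have [h1 h2] := u1_relE R.
suff gC (x : H) : x * t = t * x /\ x * ti = ti * x.
  move=> x; elim/palg_ind=> [[]|k|y z hy hz|y z hy hz].
  - by case: (gC x).
  - by case: (gC x).
  - by rewrite -scalerAr -scalerAl mul1r mulr1.
  - by rewrite mulrDr mulrDl hy hz.
  - by rewrite mulrA hy -mulrA hz mulrA.
elim/palg_ind: x => [[]|k|y z [hy hy'] [hz hz']|y z [hy hy'] [hz hz']].
- by rewrite -/t h1 h2.
- by rewrite -/ti h1 h2.
- by rewrite -!scalerAr -!scalerAl !mul1r !mulr1.
- by rewrite !mulrDr !mulrDl hy hz hy' hz'.
- by split; rewrite -mulrA ?hz ?hz' mulrA ?hy ?hy' -mulrA.
Qed.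

Lemma tpowS n : tpow (n + 1) = tpow n * t.
Proof.
have [_ h2] := u1_relE R; case: n => [n|n].
  by rewrite -PoszD addn1 [LHS]exprSr.
(* [Negz 0] stands for -1, where the successor crosses over to the nonnegative branch. *)
case: n => [|n]; first by rewrite /Defs.tpow /= expr1 h2.
have -> : Negz n.+1 + 1 = Negz n by rewrite !NegzE -[n.+2]addn1 PoszD opprD addrNK.
rewrite -[tpow (Negz n)]/(ti ^+ n.+1) -[tpow (Negz n.+1)]/(ti ^+ n.+2).
by rewrite [ti ^+ n.+2]exprSr -mulrA h2 mulr1.
Qed.

Lemma tpowP n : tpow (n - 1) = tpow n * ti.
Proof.
have [h1 _] := u1_relE R.
by rewrite -{2}[n](subrK 1) tpowS -mulrA h1 mulr1.
Qed.

Lemma tpowD m n : tpow (m + n) = tpow m * tpow n.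
Proof.
elim/int_ind: n => [|n ih|n ih]; first by rewrite addr0 mulr1.
- by rewrite -addn1 PoszD addrA !tpowS ih mulrA.
- by rewrite -addn1 PoszD opprD addrA !tpowP ih mulrA.
Qed.

Lemma tpowNK n : tpow n * tpow (- n) = 1.
Proof. by rewrite -tpowD subrr. Qed.

Lemma tpow_grouplike n : hDelta (tpow n) = tpow n \ox tpow n /\
  counit (tpow n) = 1 :> C.
Proof.
have [ht1 ht2] := hDeltaE R; have [e1 e2] := counit_t R.
have dM : {morph @hDelta R : x y / x * y} by exact: rmorphM.
have eM : {morph (fun x : H => counit x : C) : x y / x * y} by exact: rmorphM.
elim/int_ind: n => [|n [ih ih']|n [ih ih']].
- by split; [exact: rmorph1 | exact: rmorph1].
- rewrite -addn1 PoszD tpowS dM ih ht1 tmulE; split=> //.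
  by rewrite [LHS]eM ih' e1 mulr1.
- rewrite -addn1 PoszD opprD tpowP dM ih ht2 tmulE; split=> //.
  by rewrite [LHS]eM ih' e2 mulr1.
Qed.

Lemma hantipodeM (x y : H) : hantipode (x * y) = hantipode x * hantipode y.
Proof.
rewrite u1_mulC.
by have [_ hM] := palg_lift_monoid (D := u1_presentation R) (hS_genP R); exact: hM.
Qed.

Lemma coact_liftL_bilinear :
  bilinear_map (fun x y : P => y \ox hantipode (hopf_map x)).
Proof.
split=> [y|x] k u v; last by rewrite tpureDl tpureZl.
by rewrite !linearP tpureDr tpureZr.
Qed.

Lemma coact_lift_linear : linear (@coact_lift R q).
Proof.
by apply: linear_comp (tlift_linear coact_liftL_bilinear) _; exact: linearP.
Qed.

Lemma coact_liftM (x y : P) : coact_lift (x * y) = coact_lift x * coact_lift y.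
Proof.
have [f0 fD _ _ _] := linear_identities (tlift_linear coact_liftL_bilinear).
rewrite /coact_lift; have -> : Delta (x * y) = Delta x * Delta y by exact: rmorphM.
elim/tens_ind: (Delta x) => [|u u' hu hu'|u v].
- by rewrite mul0r f0 mul0r.
- by rewrite mulrDl !fD hu hu' mulrDl.
elim/tens_ind: (Delta y) => [|w w' hw hw'|w z].
- by rewrite mulr0 f0 mulr0.
- by rewrite mulrDr !fD hw hw' mulrDr.
have pM : {morph @hopf_map R q : x y / x * y} by exact: rmorphM.
rewrite tmulE !tlift_pure; try exact: coact_liftL_bilinear.
by rewrite tmulE pM hantipodeM.
Qed.

(** [coact] grades by the column of the matrix of generators, [coact_lift] by its row. The second
    grading gives the coaction on V. *)
Lemma coact_lift_gen : [/\ coact_lift a = a \ox tpow (-1),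
  coact_lift b = b \ox tpow (-1), coact_lift c = c \ox tpow 1 &
  coact_lift d = d \ox tpow 1].
Proof.
have [Da Db Dc Dd] := Delta_genE q; have [pia pib pic pid] := hopf_mapE q.
have [s1 s2] := hantipodeE R.
have [_ fD _ _ _] := linear_identities (tlift_linear coact_liftL_bilinear).
have h0 : hantipode (0 : H) = 0 by exact: linear0.
split; rewrite /coact_lift ?(Da, Db, Dc, Dd) fD !tlift_pure;
  try exact: coact_liftL_bilinear.
all: by rewrite ?pia ?pib ?pic ?pid ?s1 ?s2 ?h0 ?tpure0r ?addr0 ?add0r.
Qed.

(* [homog k l x]: x has degree k for the coaction of H and degree l for the
   coaction [coact_lift] *)
Inductive homog : int -> int -> P -> Prop :=
| homog_a : homog 1 (-1) a
| homog_b : homog (-1) (-1) b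
| homog_c : homog 1 1 c
| homog_d : homog (-1) 1 d
| homog_scalar k : homog 0 0 k%:A
| homog0 k l : homog k l 0
| homogD k l x y : homog k l x -> homog k l y -> homog k l (x + y)
| homogM k l m n x y : homog k l x -> homog m n y -> homog (k + m) (l + n) (x * y).

Lemma homogZ z k l x : homog k l x -> homog k l (z *: x).
Proof.
move=> hx; rewrite -[k]add0r -[l]add0r -[x]mul1r scalerAl.
exact: homogM (homog_scalar z) hx.
Qed.

Lemma homog_coact k l x : homog k l x -> coact x = x \ox tpow k.
Proof.
have [ca cb cc cd] := coactE q.
elim=> {k l x} // [k|k _|k l x y _ hx _ hy|k l m n x y _ hx _ hy].
- by rewrite linearZ rmorph1 tpureZl.
- by rewrite linear0 tpure0l.
- by rewrite linearD /= hx hy tpureDl.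
- by rewrite rmorphM /= hx hy tmulE tpowD.
Qed.

Lemma homog_coact_lift k l x : homog k l x -> coact_lift x = x \ox tpow l.
Proof.
have [ca cb cc cd] := coact_lift_gen.
have [l0 lD _ lZ _] := linear_identities coact_lift_linear.
elim=> {k l x} // [k|_ l|k l x y _ hx _ hy|k l m n x y _ hx _ hy].
- rewrite lZ tpureZl; congr (_ *: _).
  rewrite /coact_lift.
  have -> : Delta (1 : P) = 1 \ox 1 by exact: (rmorph1 (@Delta R q)).
  rewrite tlift_pure; last exact: coact_liftL_bilinear.
  rewrite rmorph1; congr (_ \ox _).
  by case: (palg_lift_monoid (D := u1_presentation R) (hS_genP R)).
- by rewrite l0 tpure0l.
- by rewrite lD hx hy tpureDl.
- by rewrite coact_liftM hx hy tmulE tpowD.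
Qed.

(** A spanning statement only: directness of the sum over degrees is not claimed, and its role is
    taken over by the eigenvalues of [sigma]. *)
Lemma homog_sum x : exists2 r : seq P, x = \sum_(y <- r) y &
  forall y, y \in r -> exists k l, homog k l y.
Proof.
have one k l y : homog k l y -> exists2 r : seq P, y = \sum_(z <- r) z &
    forall z, z \in r -> exists k l, homog k l z.
  move=> hy; exists [:: y]; first by rewrite big_seq1.
  by move=> z; rewrite inE => /eqP->; exists k, l.
elim/su2_ind: x => [||||k|x y [r -> hr] [r' -> hr']|x y [r -> hr] [r' -> hr']].
- exact: one homog_a.
- exact: one homog_b.
- exact: one homog_c.
- exact: one homog_d.
- exact: one (homog_scalar k).
- exists (r ++ r'); first by rewrite big_cat.
  by move=> z; rewrite mem_cat => /orP[/hr|/hr'].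
exists [seq y * z | y <- r, z <- r'].
  by rewrite big_allpairs_dep mulr_suml; apply: eq_bigr => i _; rewrite mulr_sumr.
move=> _ /allpairsP[[u v] /= [/hr[k [l hy]] /hr'[m [n hz]] ->]].
by exists (k + m), (l + n); exact: homogM.
Qed.

Lemma homog_ext (W : lmodType C) (f g : P -> W) : linear f -> linear g ->
  (forall k l x, homog k l x -> f x = g x) -> f =1 g.
Proof.
move=> fL gL fg x; have [r -> hr] := homog_sum x.
rewrite (linear_map_sum _ _ fL) (linear_map_sum _ _ gL) [LHS]big_seq [RHS]big_seq.
by apply: eq_bigr => y /hr[k [l]]; exact: fg.
Qed.

(** This character of H serves twice: its values q^n separate the degrees, and composed with the
    Hopf map it is the pairing with K^-2 ([u1_eval_hopf]). *)
Definition u1_eval_gen (g : u1_gen) : C^o :=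
  match g with Gt => q' | Gti => q'^-1 end.

Fact u1_eval_genP : satisfies u1_eval_gen (u1_relations R).
Proof.
have q0 := qC_neq0 q; do 2?[split] => //=.
  by rewrite scale1r [LHS]mulfV.
by rewrite scale1r [LHS]mulVf.
Qed.

Definition u1_eval : H -> C^o := palg_lift (D := u1_presentation R) u1_eval_gen.

Lemma u1_eval_linear : linear u1_eval.
Proof. exact: (palg_lift_linear (D := u1_presentation R) u1_eval_genP). Qed.

Lemma u1_eval_monoid : monoid_morphism u1_eval.
Proof. exact: (palg_lift_monoid (D := u1_presentation R) u1_eval_genP). Qed.

Lemma u1_eval_t : u1_eval t = q' /\ u1_eval ti = q'^-1.
Proof.
by split; rewrite /u1_eval palg_lift_gen //; exact: u1_eval_genP.
Qed.

Lemma u1_eval_tpow n : u1_eval (tpow n) = q' ^ n.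
Proof.
have [e1 eM] := u1_eval_monoid; have [et eti] := u1_eval_t.
have q0 := qC_neq0 q.
elim/int_ind: n => [|n ih|n ih]; first by rewrite expr0z.
  by rewrite -addn1 PoszD tpowS eM ih et expfzDr // expr1z.
by rewrite -addn1 PoszD opprD tpowP eM ih eti expfzDr // exprN1.
Qed.

Definition sigma (x : P) : P := contract u1_eval (coact x).

Lemma sigma_linear : linear sigma.
Proof.
by apply: linear_comp (contract_linear u1_eval_linear) _; exact: linearP.
Qed.

Lemma homog_sigma k l x : homog k l x -> sigma x = q' ^ k *: x.
Proof.
move=> /homog_coact hx; rewrite /sigma hx contract_pure ?u1_eval_tpow //.
exact: u1_eval_linear.
Qed.

Lemma qC_exprz_eq1 n : q' ^ n = 1 -> n = 0.
Proof.
have q0 := qC_neq0 q; have /andP[h0 h1] := qval_range q.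
have pos (m : nat) : q' ^+ m = 1 -> m = 0%N.
  rewrite /qC -rmorphXn => /(congr1 (@complex.Re R)) /=; case: m => // m e.
  have : qval q ^+ m.+1 < 1 by rewrite exprn_ilt1 // ltW.
  by rewrite e ltxx.
case: n => n; first by move=> /pos->.
by move=> /(congr1 GRing.inv); rewrite invr1 NegzE -exprnN invrK => /pos.
Qed.

Lemma coinvariant_homog x : coact x = x \ox 1 ->
  exists2 r : seq P, x = \sum_(y <- r) y &
    forall y, y \in r -> exists l, homog 0 l y.
Proof.
move=> hx; have [r xE hr] := homog_sum x.
have sx : sigma x = 1 *: x.
  rewrite /sigma hx contract_pure; last exact: u1_eval_linear.
  by case: u1_eval_monoid => ->.
have {hr} [r' xE' hr'] : exists2 r' : seq (C * P), x = \sum_(p <- r') p.2 &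
    forall p, p \in r' -> exists k l, p.1 = q' ^ k /\ homog k l p.2.
  rewrite xE; elim: r hr {x hx xE sx} => [|y r ih] hr.
    by exists [::]; rewrite ?big_nil.
  have [|r' e hr'] := ih; first by move=> z zr; apply: hr; rewrite inE zr orbT.
  have [|k [l hy]] := hr y; first by rewrite inE eqxx.
  exists ((q' ^ k, y) :: r'); first by rewrite !big_cons e.
  by move=> p; rewrite inE => /orP[/eqP->|/hr'//]; exists k, l.
have eig p : p \in r' -> sigma p.2 = p.1 *: p.2.
  by move=> /hr'[k [l [-> hy]]]; exact: homog_sigma hy.
exists [seq p.2 | p <- r' & p.1 == 1].
  by rewrite big_map big_filter; exact: (eigenvector_sum sigma_linear eig sx).
move=> y /mapP[p]; rewrite mem_filter => /andP[/eqP p1 /hr'[k [l [e hy]]]] ->.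
by exists l; rewrite -(qC_exprz_eq1 (n := k)) // -e.
Qed.

End Grading.

(** * Degree shifts of U_q(su(2)) acting on P *)

Section Weights.
Variables (R : realType) (q : deformation R).
Variable pr : Uqsu2 q -> SUq2 q -> R[i].
Hypothesis hpr : dual_pairing pr.
Local Notation C := R[i].
Local Notation P := (SUq2 q).
Local Notation H := (U1 R).
Local Notation a := (pa q).
Local Notation b := (pb q).
Local Notation c := (pc q).
Local Notation d := (pd q).
Local Notation K := (uK q).
Local Notation Ki := (uKi q).
Local Notation E := (uE q).
Local Notation F := (uF q).
Local Notation L := (@tangent_vector R q).
Local Notation act := (act pr).
Local Notation tpow := (tpow R).

Lemma act_gen X : [/\ act X a = pr X a *: a + pr X c *: b,
  act X b = pr X b *: a + pr X d *: b, act X c = pr X a *: c + pr X c *: d &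
  act X d = pr X b *: c + pr X d *: d].
Proof. exact: actf_gen (pr_linear hpr X). Qed.

Lemma act_1 X : act X 1 = (counit X)%:A.
Proof.
rewrite /Defs.act -[tlift _ _]/(contract (pr X : P -> C^o) _).
have -> : Delta (1 : P) = 1 \ox 1 by exact: (rmorph1 (@Delta R q)).
by rewrite contract_pure ?(pairing_1r hpr) //; exact: pr_linear.
Qed.

Lemma act_unit p : act 1 p = p.
Proof.
rewrite -[RHS](@counitr R q); apply: tlift_ext => u v.
by rewrite (pairing_1l hpr).
Qed.

Lemma zero_linear : linear (fun _ : P => 0 : C^o).
Proof. by move=> k x y; rewrite scaler0 addr0. Qed.

Lemma act_grouplike X : (forall x y, pr X (x * y) = pr X x * pr X y) ->
  forall x y, act X (x * y) = act X x * act X y.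
Proof.
move=> hX x y; have pL := pr_linear hpr X.
have z0 z : actf (fun _ : P => 0 : C^o) z = 0.
  by rewrite /actf /contract /tlift /fsum big1 // => i _; rewrite scale0r.
have M u v : pr X (u * v) = pr X u * pr X v + (0 : C^o) * (0 : C^o).
  by rewrite hX mul0r addr0.
rewrite -[LHS]/(actf (pr X) (x * y)) (actfM pL pL pL zero_linear zero_linear M).
by rewrite !z0 mul0r addr0.
Qed.

Lemma act_skew X : (forall x y, pr X (x * y) = pr X x * pr K y + pr Ki x * pr X y) ->
  forall x y, act X (x * y) = act X x * act K y + act Ki x * act X y.
Proof.
have pL Y := pr_linear hpr Y.
by move=> hX x y; exact: (actfM (pL X) (pL X) (pL K) (pL Ki) (pL X) hX).
Qed.

Lemma homog_grouplike X k l x :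
  (forall x y, pr X (x * y) = pr X x * pr X y) ->
  [/\ pr X b = 0 & pr X c = 0] -> homog (q := q) k l x -> homog k l (act X x).
Proof.
move=> XM [Xb Xc]; have [Xa' Xb' Xc' Xd'] := act_gen X.
have [A0 AD _ AZ _] := linear_identities (act_linear hpr X).
elim=> {k l x} [||||k|k l|k l x y _ hx _ hy|k l m n x y _ hx _ hy].
- by rewrite Xa' Xc scale0r addr0; exact/homogZ/homog_a.
- by rewrite Xb' Xb scale0r add0r; exact/homogZ/homog_b.
- by rewrite Xc' Xc scale0r addr0; exact/homogZ/homog_c.
- by rewrite Xd' Xb scale0r add0r; exact/homogZ/homog_d.
- by rewrite AZ act_1; apply: homogZ; exact: homog_scalar.
- by rewrite A0; exact: homog0.
- by rewrite AD; exact: homogD.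
- by rewrite act_grouplike //; exact: homogM.
Qed.

Lemma homog_K k l x : homog k l x -> homog k l (act K x).
Proof.
have [[_ Kb Kc _] _ _ _] := pr_gen hpr.
by apply: homog_grouplike => //; exact: prK.
Qed.

Lemma homog_Ki k l x : homog k l x -> homog k l (act Ki x).
Proof.
have [_ [_ Kb Kc _] _ _] := pr_gen hpr.
by apply: homog_grouplike => //; exact: prKi.
Qed.

(** K and K^-1 preserve both degrees, so the Leibniz rule propagates the shift [w] from the four
    generators to products; the vanishing counit takes care of scalars. *)
Lemma homog_skew X w k l x :
  (forall x y, pr X (x * y) = pr X x * pr K y + pr Ki x * pr X y) ->
  counit X = 0 ->
  [/\ homog (1 + w) (-1) (act X a), homog (-1 + w) (-1) (act X b),
      homog (1 + w) 1 (act X c) & homog (-1 + w) 1 (act X d)] ->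
  homog k l x -> homog (k + w) l (act X x).
Proof.
move=> XM eX [Xa Xb Xc Xd]; have [A0 AD _ AZ _] := linear_identities (act_linear hpr X).
elim=> {k l x} // [k|k l|k l x y _ hx _ hy|k l m n x y hx hx' hy hy'].
- by rewrite AZ act_1 eX scale0r scaler0; exact: homog0.
- by rewrite A0; exact: homog0.
- by rewrite AD; exact: homogD.
rewrite (act_skew XM); apply: homogD.
  by rewrite addrAC; apply: homogM => //; exact: homog_K.
by rewrite -addrA; apply: homogM => //; exact: homog_Ki.
Qed.

Lemma homog_E k l x : homog k l x -> homog (k - 2) l (act E x).
Proof.
have [_ _ [Ea Eb Ec Ed] _] := pr_gen hpr; have [a1 a2 a3 a4] := act_gen E.
have [_ _ eE _] := counit_uq q.
apply: homog_skew => //; first exact: prE.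
rewrite a1 a2 a3 a4 Ea Eb Ec Ed !scale0r !scale1r !add0r.
by split; [exact: homog_b | exact: homog0 | exact: homog_d | exact: homog0].
Qed.

Lemma homog_F k l x : homog k l x -> homog (k + 2) l (act F x).
Proof.
have [_ _ _ [Fa Fb Fc Fd]] := pr_gen hpr; have [a1 a2 a3 a4] := act_gen F.
have [_ _ _ eF] := counit_uq q.
apply: homog_skew => //; first exact: prF.
rewrite a1 a2 a3 a4 Fa Fb Fc Fd !scale0r !scale1r !addr0.
by split; [exact: homog0 | exact: homog_a | exact: homog0 | exact: homog_c].
Qed.

Definition tangent_weight (i : tangent) : int :=
  match i with Tminus => 2 | Tzero => 0 | Tplus => - 2 | Tz => 0 end.
Local Notation wt := tangent_weight.

(** E lowers and F raises the first degree by 2, while F E and the powers of K preserve it. The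
    second degree is read off the left leg of the coproduct, which the action does not touch. *)
Lemma homog_tangent i k l x :
  homog k l x -> homog (k + wt i) l (act (L i) x).
Proof.
move=> hx; have [_ lD _ lZ lB] := linear_identities (act_linearl hpr x).
have hN m y : homog m l y -> homog m l (- y).
  by move=> hy; rewrite -scaleN1r; exact: homogZ.
case: i => /=.
- by rewrite lZ (actM hpr); apply: homogZ; apply: homog_F; exact: homog_Ki.
- rewrite addr0 lB act_unit lD lZ expr2 !(actM hpr).
  apply: homogD; last exact: hN.
  apply: homogD; first by apply: homog_K; exact: homog_K.
  apply: homogZ; rewrite -[k](subrK 2); apply: homog_F; exact: homog_E.
- by rewrite lZ (actM hpr); apply: homogZ; apply: homog_E; exact: homog_Ki.
- rewrite addr0 lB act_unit expr2 (actM hpr).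
  apply: homogD; last exact: hN.
  by apply: homog_Ki; exact: homog_Ki.
Qed.

Lemma coact_tangent i x : coact (act (L i) x) =
  tmap (act (L i)) idfun (coact x) * (1 \ox tpow (wt i)).
Proof.
have aL := act_linear hpr (L i).
have iL : linear (idfun : H -> H) by [].
have tL := tmap_linear aL iL.
apply: (homog_ext (f := fun x => coact (act (L i) x))
  (g := fun x => tmap (act (L i)) idfun (coact x) * (1 \ox tpow (wt i)))).
- by apply: linear_comp _ aL; exact: linearP.
- have ctL : linear (fun x : P => tmap (act (L i)) idfun (coact x)).
    by apply: linear_comp tL _; exact: linearP.
  by move=> k y z; rewrite ctL mulrDl -scalerAl.
move=> k l y hy; rewrite (homog_coact (homog_tangent i hy)) (homog_coact hy).
by rewrite tmap_pure //= tmulE mulr1 tpowD.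
Qed.

Lemma coact_tangent_coinv i x :
  coact x = x \ox 1 -> coact (act (L i) x) = act (L i) x \ox tpow (wt i).
Proof.
move=> hx; rewrite coact_tangent hx tmap_pure ?tmulE ?mulr1 ?mul1r //.
exact: act_linear.
Qed.

(** Both sides are characters of P with the same values on the generators. Consequently L_z = K^-2 -
    1 factors through H. *)
Lemma u1_eval_hopf x : u1_eval q (hopf_map x) = pr (Ki * Ki) x.
Proof.
have [e1 eM] := u1_eval_monoid q; have [et eti] := u1_eval_t q.
have [pia pib pic pid] := hopf_mapE q.
have [_ [A1 A2 A3 A4] _ _ _] := pr_table hpr.
have [e0 _ _ _ _] := linear_identities (u1_eval_linear q).
have [_ u1 _ _ _] := pr_unit hpr.
apply: (su2_alg_ext (B := C^o) (f := fun x => u1_eval q (hopf_map x))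
  (g := pr (Ki * Ki))).
- by apply: linear_comp (u1_eval_linear q) _; exact: linearP.
- exact: pr_linear.
- split=> [|y z]; first by rewrite rmorph1.
  by rewrite rmorphM eM.
- by split=> // y z; exact: prKiKi.
- by rewrite pia et A1 qC_sqrt.
- by rewrite pib e0 A2.
- by rewrite pic e0 A3.
- by rewrite pid eti A4 qC_sqrt.
Qed.

Lemma act_KiKi x : act (Ki * Ki) x = sigma x.
Proof.
rewrite /sigma /coact [RHS]tlift_tmap; last exact/contract_bilinear/u1_eval_linear.
by apply: tlift_ext => u v; rewrite u1_eval_hopf.
Qed.

Lemma act_Lz x : act (Lz q) x = sigma x - x.
Proof.
have [_ _ _ _ lB] := linear_identities (act_linearl hpr x).
by rewrite lB act_unit expr2 act_KiKi.
Qed.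

Lemma sigma_coinv (x : P) : coact x = x \ox 1 -> sigma x = x.
Proof.
move=> hx; rewrite /sigma hx contract_pure; last exact: u1_eval_linear.
by have [-> _] := u1_eval_monoid q; rewrite scale1r.
Qed.

Lemma act_Lz_coinv (x : P) : coact x = x \ox 1 -> act (Lz q) x = 0.
Proof. by move=> /sigma_coinv hx; rewrite act_Lz hx subrr. Qed.

Lemma hantipode_tpow n : hantipode (tpow n) = tpow (- n).
Proof.
have [s1 s2] := hantipodeE R.
elim/int_ind: n => [|n ih|n ih].
- by rewrite oppr0; case: (palg_lift_monoid (D := u1_presentation R) (hS_genP R)).
- by rewrite -addn1 PoszD tpowS hantipodeM ih s1 opprD tpowP.
- by rewrite -addn1 PoszD opprD tpowP hantipodeM ih s2 !opprD !opprK tpowS.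
Qed.

Lemma hopf_map_coact (y : P) : hopf_map y = contractl (@counit C P) (coact y).
Proof.
rewrite /coact [RHS]tlift_tmap; last exact/contractl_bilinear/counit_lin.
rewrite -[y in LHS](@counitl R q) /contractl (tlift_comp _ _ (linearP (@hopf_map R q))).
by apply: tlift_ext => u v; rewrite linearZ.
Qed.

Lemma contractl_coact_lift (f : P -> C^o) x : linear f ->
  contractl f (coact_lift x) = hantipode (hopf_map (actf f x)).
Proof.
move=> fL; have cL := contractl_linear (W := H) fL.
rewrite /coact_lift (tlift_comp _ _ cL) /actf /contract.
have hL : linear (fun y : P => hantipode (hopf_map y)).
  by apply: linear_comp (@hantipode_linear R) _; exact: linearP.
rewrite (tlift_comp _ _ hL); apply: tlift_ext => u v.
have [_ _ _ hZ _] := linear_identities hL.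
by rewrite contractl_pure // hZ.
Qed.

Lemma hopf_map_coinv (x : P) : coact x = x \ox 1 -> hopf_map x = (counit x : C)%:A.
Proof.
by move=> hx; rewrite hopf_map_coact hx contractl_pure //; exact: counit_lin.
Qed.

(** The contraction is S pi(L_i |> x). As L_i |> x has degree wt i, its image under pi is its counit
    L_i(x) times t^(wt i), and the antipode inverts the power. *)
Lemma contractl_tangent i x : coact x = x \ox 1 ->
  contractl (pr (L i) : P -> C^o) (coact_lift x) = pr (L i) x *: tpow (- wt i).
Proof.
move=> /(coact_tangent_coinv i) hx; have pL := pr_linear hpr (L i).
rewrite contractl_coact_lift // -[actf _ _]/(act (L i) x) hopf_map_coact hx.
rewrite contractl_pure; last exact: counit_lin.
rewrite -[act (L i) x]/(actf (pr (L i) : P -> C^o) x) counit_actf //.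
by rewrite linearZ /= hantipode_tpow.
Qed.

End Weights.

(** * The comodule V *)

Section FrameComodule.
Variables (R : realType) (q : deformation R).
Variable pr : Uqsu2 q -> SUq2 q -> R[i].
Hypothesis hpr : dual_pairing pr.
Variables omega_m omega_0 omega_p omega_z : Omega1P q.
Hypothesis homega : dual_forms pr omega_m omega_0 omega_p omega_z.
Local Notation C := R[i].
Local Notation q' := (qC q).
Local Notation P := (SUq2 q).
Local Notation H := (U1 R).
Local Notation act := (act pr).
Local Notation tpow := (tpow R).
Local Notation V := (frameV q).
Local Notation bm := (b_minus q).
Local Notation b0 := (b_zero q).
Local Notation bp := (b_plus q).
Local Notation vm := (classV bm).
Local Notation v0 := (classV b0).
Local Notation vp := (classV bp).

Lemma aug_MP (x : P) : aug_M q x <-> coact x = x \ox 1 /\ counit x = 0.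
Proof. by split=> [[/eqP]|[/eqP]]. Qed.

Lemma homog_frame : [/\ homog 0 (- 2) bm, homog 0 0 b0 & homog 0 2 bp].
Proof.
split; [exact: homogM (homog_a q) (homog_b q)
       | exact: homogM (homog_b q) (homog_c q)
       | exact: homogM (homog_c q) (homog_d q)].
Qed.

Lemma aug_M_frame : [/\ aug_M q bm, aug_M q b0 & aug_M q bp].
Proof.
have [hm h0 hp] := homog_frame; have [ea eb ec ed] := counitE q.
have eM (y z : P) : counit (y * z) = counit y * counit z :> C by exact: rmorphM.
split; apply/aug_MP; rewrite ?(homog_coact hm) ?(homog_coact h0) ?(homog_coact hp);
  by split=> //; rewrite eM ?(ea, eb, ec, ed) ?mulr0 ?mul0r.
Qed.

Lemma pr_Lz_coinv (x : P) : coact x = x \ox 1 -> pr (Lz q) x = 0.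
Proof.
move=> /(act_Lz_coinv hpr) hx; rewrite -(counit_actf (pr_linear hpr _)).
by rewrite -[actf _ _]/(act (Lz q) x) hx raddf0.
Qed.

(** Dividing by the diagonal values in [pr_tangent_frame] makes the first three functionals dual to
    b_-, b_0, b_+. The fourth vanishes on coinvariants and keeps the statements uniform in [i]. *)
Definition frame_coord (i : tangent) (x : P) : C^o :=
  match i with
  | Tminus => q'^-1 * pr (Lminus q) x
  | Tzero => (nu q ^+ 2 * q'^-1)^-1 * pr (Lzero q) x
  | Tplus => pr (Lplus q) x
  | Tz => pr (Lz q) x
  end.

Lemma frame_coord_linear i : linear (frame_coord i).
Proof.
by case: i => k x y /=; rewrite (pr_linear hpr) // mulrDr scalerAr.
Qed.

Lemma frame_coord_IP i x : IP q x -> frame_coord i x = 0.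
Proof.
move=> Ix; have h j := pr_tangent_IP hpr j Ix.
case: i => /=; rewrite ?(h Tminus) ?(h Tzero) ?(h Tplus) ?(h Tz) ?mulr0 //.
Qed.

Lemma frame_norm_neq0 : nu q ^+ 2 * q'^-1 != 0.
Proof. by rewrite mulf_neq0 ?expf_neq0 ?invr_neq0 ?qC_neq0 ?nu_neq0. Qed.

Lemma frame_coordE :
  [/\ [/\ frame_coord Tminus bm = 1, frame_coord Tzero bm = 0,
          frame_coord Tplus bm = 0 & frame_coord Tz bm = 0],
      [/\ frame_coord Tminus b0 = 0, frame_coord Tzero b0 = 1,
          frame_coord Tplus b0 = 0 & frame_coord Tz b0 = 0] &
      [/\ frame_coord Tminus bp = 0, frame_coord Tzero bp = 0,
          frame_coord Tplus bp = 1 & frame_coord Tz bp = 0]].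
Proof.
have [[m1 m2 m3 m4] [z1 z2 z3 z4] [p1 p2 p3 p4] _] := pr_tangent_frame hpr.
have E := (m1, m2, m3, m4, z1, z2, z3, z4, p1, p2, p3, p4).
have n0 := frame_norm_neq0; have q0 := qC_neq0 q.
by split; split; rewrite /= ?E ?mulr0 ?mulVf.
Qed.

Definition frame_proj (x : P) : V :=
  frame_coord Tminus x *: vm + frame_coord Tzero x *: v0 + frame_coord Tplus x *: vp.

Lemma frame_proj_linear : linear frame_proj.
Proof.
move=> k x y; rewrite /frame_proj !frame_coord_linear.
by lmod_eq (R[i]); rewrite ?scale_regular; ring.
Qed.

(** The difference of [x] and its projection is killed by the counit and by all four L_j, by L_z
    because it is coinvariant; [IP_tangent] then puts it in I_P. So three classes span V. *)
Lemma classV_proj x : aug_M q x -> classV x = frame_proj x.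
Proof.
move=> Mx; have [Mm M0 Mp] := aug_M_frame.
have [[m1 m2 m3 m4] [z1 z2 z3 z4] [p1 p2 p3 p4]] := frame_coordE.
pose y := frame_coord Tminus x *: bm + frame_coord Tzero x *: b0
        + frame_coord Tplus x *: bp.
have My : aug_M q y by do 2?apply: submodD; exact: submodZ.
have -> : frame_proj x = classV y.
  rewrite /classV !clsD ?clsZ //; try exact: submodZ.
  by apply: submodD; exact: submodZ.
have coordB i : frame_coord i (x - y) = 0.
  have [_ fD _ fZ fB] := linear_identities (frame_coord_linear i).
  rewrite fB !fD !fZ; case: i {fD fZ fB} => //.
  - by rewrite m1 z1 p1 !scaler0 !addr0 [_ *: _]mulr1 subrr.
  - by rewrite m2 z2 p2 !scaler0 addr0 add0r [_ *: _]mulr1 subrr.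
  - by rewrite m3 z3 p3 !scaler0 !add0r [_ *: _]mulr1 subrr.
  have [cx _] := (aug_MP x).1 Mx.
  by rewrite m4 z4 p4 !scaler0 !addr0 subr0 /= pr_Lz_coinv.
apply/cls_eqP => //; apply: (IP_tangent hpr homega).
  have [_ ex] := (aug_MP x).1 Mx; have [_ ey] := (aug_MP y).1 My.
  have [_ _ _ _ eB] := linear_identities (@counit_lin _ P).
  by rewrite eB ex ey subr0.
have n0 := frame_norm_neq0; have q0 := qC_neq0 q.
case=> /=; [have := coordB Tminus | have := coordB Tzero | exact: coordB Tplus
           | exact: coordB Tz] => /= /eqP.
all: by rewrite mulf_eq0 invr_eq0 (negbTE q0, negbTE n0) => /eqP.
Qed.

Definition frame_coordV (i : tangent) (v : V) : C^o := frame_coord i (rep v).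

Lemma frame_coordV_linear i : linear (frame_coordV i).
Proof.
apply: (descent_linear (A := aug_M q) (B := IP q) (f := frame_coord i)).
- exact: frame_coord_linear.
- by move=> x; exact: frame_coord_IP.
Qed.

Lemma frame_coordV_class i x : aug_M q x ->
  frame_coordV i (classV x) = frame_coord i x.
Proof.
move=> Mx; apply: (descent_cls (A := aug_M q) (B := IP q) (f := frame_coord i)) => //.
- exact: frame_coord_linear.
- by move=> y; exact: frame_coord_IP.
Qed.

Lemma frameV_decomp v : v = frame_coordV Tminus v *: vm
  + frame_coordV Tzero v *: v0 + frame_coordV Tplus v *: vp.
Proof. by rewrite -{1}[v]repK -[RHS]classV_proj //; exact: rep_in. Qed.

Lemma counit_coact_lift x : coact x = x \ox 1 -> counit x = 0 ->
  contractl (@counit C P) (coact_lift x) = 0.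
Proof.
move=> cx ex; rewrite contractl_coact_lift; last exact: counit_lin.
rewrite [actf _ _]counitr hopf_map_coinv // ex scale0r.
exact: (linear0 (@hantipode R)).
Qed.

(** [coactV] picks a preimage with [xget 0]; existence ensures that the element picked is a preimage
    and not the default 0. *)
Lemma coact_lift_in x : aug_M q x ->
  exists y : tens (subm (aug_M q)) H, tmap val idfun y = coact_lift x.
Proof.
move=> /aug_MP[cx ex].
have [_ _ _ _ eB] := linear_identities (@counit_lin _ P).
have vL : linear (tmap val idfun : tens (subm (aug_M q)) H -> tens P H).
  by apply: tmap_linear => //; exact: linearP.
have cL := contractl_linear (W := H) (@counit_lin _ P).
(* A homogeneous piece of [x] need not lie in ker(epsilon). [G] removes the counit part of each
   piece; for [x] as a whole nothing is removed, by [counit_coact_lift]. *)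
pose G (z : tens P H) := z - 1 \ox contractl (@counit C P) z.
have GL : linear G.
  by move=> k u v; rewrite /G cL tpureDr tpureZr scalerBr opprD addrACA.
have -> : coact_lift x = G (coact_lift x).
  by rewrite /G counit_coact_lift // tpure0r subr0.
have GcL : linear (fun x : P => G (coact_lift x)).
  by apply: linear_comp GL _; exact: coact_lift_linear.
have [r -> hr] := coinvariant_homog cx.
have {hr} [w hw] : exists w : P -> tens (subm (aug_M q)) H,
    forall y, y \in r -> tmap val idfun (w y) = G (coact_lift y).
  suff hw y : y \in r -> exists w : tens (subm (aug_M q)) H,
      tmap val idfun w = G (coact_lift y).
    exists (fun y => xget 0 [set w | tmap val idfun w = G (coact_lift y)]).
    by move=> y /hw ew; exact: (@xgetPex _ 0 [set w | tmap val idfun w = _] ew).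
  move=> /hr[l hy].
  have My : aug_M q (y - (counit y : C)%:A).
    apply/aug_MP; split; last by rewrite eB counit_alg subrr.
    rewrite [LHS]linearB /= linearZ /= rmorph1 (homog_coact hy).
    by rewrite -!scaleNr tpureDl tpureZl.
  have /submod_predP My' := My.
  exists (Subm My' \ox tpow l).
  have valL : linear (val : subm (aug_M q) -> P) by exact: linearP.
  have iL : linear (idfun : H -> H) by [].
  rewrite (tmap_pure _ _ valL iL) /=.
  rewrite (homog_coact_lift hy) /G contractl_pure; last exact: counit_lin.
  by rewrite -scaleNr tpureDl tpureZl tpureZr scaleNr.
exists (\sum_(y <- r) w y).
rewrite (linear_map_sum _ _ vL) (linear_map_sum _ _ GcL) [LHS]big_seq [RHS]big_seq.
exact: eq_bigr.
Qed.

(** The chosen preimage drops out, since on ker(epsilon) :&: M the quotient map is [frame_proj]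
    after [val]. *)
Lemma coactVE v : coactV v = tmap frame_proj idfun (coact_lift (rep v)).
Proof.
have := @xgetPex _ 0 [set y | tmap val idfun y = coact_lift (rep v)]
  (coact_lift_in (rep_in v)).
rewrite /coactV.
move: (xget _ _) => z /= <-.
have fL := frame_proj_linear; have iL : linear (idfun : H -> H) by [].
apply: (tens_eq (f := tmap (@subquot_pi _ _ (aug_M q) (IP q)) idfun)
  (g := fun z => tmap frame_proj idfun (tmap val idfun z))).
- by apply: tmap_linear => //; exact: linearP.
- apply: linear_comp (tmap_linear fL iL) _.
  by apply: tmap_linear => //; exact: linearP.
move=> u h; rewrite !tmap_pure //; try exact: linearP.
rewrite -clsE; congr (_ \ox _); apply: classV_proj; exact/submod_predP/subm_valP.
Qed.

(** By [contractl_tangent] each coordinate of the lifted coaction is a multiple of one power of t;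
    the exponents are minus the weights of L_-, L_0, L_+. *)
Lemma coactV_decomp v : coactV v =
  frame_coordV Tminus v *: (vm \ox tpow (- 2)) +
  frame_coordV Tzero v *: (v0 \ox 1) + frame_coordV Tplus v *: (vp \ox tpow 2).
Proof.
have [cx _] := (aug_MP _).1 (rep_in v).
have E (z : tens P H) : tmap frame_proj idfun z =
    vm \ox contractl (frame_coord Tminus) z + v0 \ox contractl (frame_coord Tzero) z
  + vp \ox contractl (frame_coord Tplus) z.
  have cL i := contractl_linear (W := H) (frame_coord_linear i).
  apply: (tens_eq (f := tmap frame_proj idfun) (g := fun z =>
    vm \ox contractl (frame_coord Tminus) z + v0 \ox contractl (frame_coord Tzero) z
    + vp \ox contractl (frame_coord Tplus) z)).
  - by apply: tmap_linear => //; exact: frame_proj_linear.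
  - move=> k x y; lazy beta; rewrite !cL !tpureDr !tpureZr.
    by lmod_eq (R[i]); ring.
  move=> x h; rewrite tmap_pure //; last exact: frame_proj_linear.
  rewrite !contractl_pure; try exact: frame_coord_linear.
  by rewrite !tpureZr /frame_proj !tpureDl !tpureZl.
have cZ (f g : P -> C^o) k z : linear g -> (forall x, f x = k * g x) ->
    contractl f z = k *: contractl g z :> H.
  move=> gL fg; rewrite /contractl /tlift /fsum scaler_sumr.
  by apply: eq_bigr => p _; rewrite fg scalerA.
rewrite coactVE E.
rewrite (cZ (frame_coord Tminus) (pr (Lminus q)) q'^-1) //; last exact: pr_linear.
rewrite (cZ (frame_coord Tzero) (pr (Lzero q)) (nu q ^+ 2 * q'^-1)^-1) //;
  last exact: pr_linear.
rewrite (contractl_tangent hpr Tminus cx) (contractl_tangent hpr Tzero cx).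
rewrite (contractl_tangent hpr Tplus cx) !scalerA.
by rewrite !tpureZr.
Qed.

Lemma coactV_frame : [/\ coactV vp = vp \ox tpow 2, coactV v0 = v0 \ox 1 &
  coactV vm = vm \ox tpow (- 2)].
Proof.
have [Mm M0 Mp] := aug_M_frame.
have [[m1 m2 m3 m4] [z1 z2 z3 z4] [p1 p2 p3 p4]] := frame_coordE.
split; rewrite coactV_decomp !frame_coordV_class ?(m1, m2, m3, z1, z2, z3, p1, p2, p3) //.
all: by rewrite !scale0r scale1r ?addr0 ?add0r.
Qed.

Lemma coactV_linear : linear (@coactV R q).
Proof.
move=> k x y; rewrite !coactV_decomp !frame_coordV_linear.
by lmod_eq (R[i]); rewrite ?scale_regular; ring.
Qed.

Lemma coactV_comodule : is_comodule (@coactV R q).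
Proof.
have [cp c0 cm] := coactV_frame; have vL := coactV_linear.
have iL : linear (idfun : H -> H) by []; have iL' : linear (idfun : V -> V) by [].
have dL : linear (@hDelta R) by exact: linearP.
have sb : bilinear_map (fun (v : V) (h : H) => (counit h : C) *: v).
  by apply: contract_bilinear; exact: counit_lin.
have ext (W : lmodType C) (f g : V -> W) : linear f -> linear g ->
    f vm = g vm -> f v0 = g v0 -> f vp = g vp -> f =1 g.
  move=> /linear_identities[_ fD _ fZ _] /linear_identities[_ gD _ gZ _] e1 e2 e3 v.
  by rewrite [v]frameV_decomp !fD !fZ !gD !gZ e1 e2 e3.
split=> //.
- apply: ext.
  + apply: linear_comp (@tassoc_linear _ _ _ _) _.
    exact: linear_comp (tmap_linear vL iL) vL.
  + exact: linear_comp (tmap_linear iL' dL) vL.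
  + by rewrite cm !tmap_pure // cm tassoc_pure (tpow_grouplike R _).1.
  + by rewrite c0 !tmap_pure // c0 tassoc_pure (rmorph1 (@hDelta R)).
  + by rewrite cp !tmap_pure // cp tassoc_pure (tpow_grouplike R _).1.
- apply: ext.
  + exact: linear_comp (tlift_linear sb) vL.
  + by [].
  + by rewrite cm tlift_pure // (tpow_grouplike R _).2 scale1r.
  + by rewrite c0 tlift_pure // rmorph1 scale1r.
  + by rewrite cp tlift_pure // (tpow_grouplike R _).2 scale1r.
Qed.

Lemma theta_class x : aug_M q x -> theta (classV x) = theta_lift x.
Proof.
move=> Mx; apply: (descent_cls (A := aug_M q) (B := IP q) (f := @theta_lift R q)) => //.
- exact: theta_lift_linear.
- by move=> y; exact: theta_lift_IP.
Qed.

Lemma theta_linear : linear (@theta R q).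
Proof.
apply: (descent_linear (A := aug_M q) (B := IP q) (f := @theta_lift R q)).
- exact: theta_lift_linear.
- by move=> y; exact: theta_lift_IP.
Qed.

Lemma theta_omega : [/\ theta vm = q' *: omega_m,
  theta v0 = (nu q ^+ 2 * q'^-1) *: omega_0 & theta vp = omega_p].
Proof.
have [Mm M0 Mp] := aug_M_frame.
have [tm t0 tp] := theta_lift_frame hpr homega.
by rewrite !theta_class.
Qed.

End FrameComodule.

(** * The quantum principal bundle *)

Section PrincipalBundle.
Variables (R : realType) (q : deformation R).
Variable pr : Uqsu2 q -> SUq2 q -> R[i].
Hypothesis hpr : dual_pairing pr.
Variables omega_m omega_0 omega_p omega_z : Omega1P q.
Hypothesis homega : dual_forms pr omega_m omega_0 omega_p omega_z.
Local Notation C := R[i].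
Local Notation P := (SUq2 q).
Local Notation H := (U1 R).
Local Notation a := (pa q).
Local Notation d := (pd q).
Local Notation Om := (Omega1P q).
Local Notation tpow := (tpow R).
Local Notation coord := (coord pr).
Local Notation wt := tangent_weight.

Lemma coact_comodule : is_comodule (coact (q := q)).
Proof.
have cL : linear (coact (q := q)) by exact: linearP.
have iL : linear (idfun : H -> H) by []; have iL' : linear (idfun : P -> P) by [].
have dL : linear (@hDelta R) by exact: linearP.
have sb : bilinear_map (fun (v : P) (h : H) => (counit h : C) *: v).
  by apply: contract_bilinear; exact: counit_lin.
split=> //.
- apply: homog_ext.
  + apply: linear_comp (@tassoc_linear _ _ _ _) _.
    exact: linear_comp (tmap_linear cL iL) cL.
  + exact: linear_comp (tmap_linear iL' dL) cL.
  move=> k l x /homog_coact hx.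
  by rewrite hx !tmap_pure // hx tassoc_pure (tpow_grouplike R _).1.
- apply: homog_ext; [exact: linear_comp (tlift_linear sb) cL | by [] |].
  move=> k l x /homog_coact hx.
  by rewrite hx tlift_pure // (tpow_grouplike R _).2 scale1r.
Qed.

Lemma hopf_map_surj (h : H) : exists x : P, hopf_map x = h.
Proof.
have [pia pib pic pid] := hopf_mapE q.
elim/palg_ind: h => [[]|k|y z [u <-] [v <-]|y z [u <-] [v <-]].
- by exists a.
- by exists d.
- by exists k%:A; rewrite linearZ rmorph1.
- by exists (u + v); rewrite linearD.
- by exists (u * v); rewrite rmorphM.
Qed.

Lemma ver_univ_lkappa p x :
  ver_univ ((p \ox 1) * kappa x) = p \ox hopf_map x :> tens P H.
Proof. by rewrite ver_univMl ver_univ_kappa tmulE mulr1 mul1r. Qed.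

Lemma ver_univ_surj (y : tens P H) : exists x, ver_univ x = y.
Proof.
have [v0 vD _ _ _] := linear_identities (@ver_univ_linear R q).
elim/tens_ind: y => [|y z [u <-] [v <-]|p h].
- by exists 0.
- by exists (u + v).
have [x <-] := hopf_map_surj h.
by exists ((p \ox 1) * kappa x); rewrite ver_univ_lkappa.
Qed.

(** Reduces identities between linear maps on one-forms to x dy with homogeneous x and y, where
    every coaction just appends a power of t. *)
Lemma Omega1P_ext (W : lmodType C) (f g : Om -> W) : linear f -> linear g ->
  (forall k l m n x y, homog k l x -> homog m n y ->
     f (x <*: dP y) = g (x <*: dP y)) -> f =1 g.
Proof.
move=> fL gL fg w; rewrite -[w]Dform_rep.
apply: (tens_eq (f := fun u => f (Dform u)) (g := fun u => g (Dform u))).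
- exact: linear_comp fL (@Dform_linear R q).
- exact: linear_comp gL (@Dform_linear R q).
have DL1 y : linear (fun x : P => Dform (x \ox y)).
  by move=> k x z; rewrite tpureDl tpureZl; exact: Dform_linear.
have DL2 x : linear (fun y : P => Dform (x \ox y)).
  by move=> k y z; rewrite tpureDr tpureZr; exact: Dform_linear.
move=> x y; move: x; apply: homog_ext.
- exact: linear_comp fL (DL1 y).
- exact: linear_comp gL (DL1 y).
move=> k l x hx; move: y; apply: homog_ext.
- exact: linear_comp fL (DL2 x).
- exact: linear_comp gL (DL2 x).
by move=> m n y hy; rewrite Dform_pure; exact: fg hx hy.
Qed.

(** The coefficient of the i-th form in x dy has degree higher by wt i than x dy, so the form itself
    receives degree - wt i. Passing through coordinates makes the coaction well defined on
    classes. *)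
Definition form_coact1 (i : tangent) (om w : Om) : tens Om H :=
  tmap (fun p : P => p <*: om) (fun h => h * tpow (- wt i)) (coact (coord i w)).

Definition form_coact (w : Om) : tens Om H :=
  form_coact1 Tminus omega_m w + form_coact1 Tzero omega_0 w
  + form_coact1 Tplus omega_p w + form_coact1 Tz omega_z w.

Lemma mulr_linear (h : H) : linear (fun x => x * h).
Proof. by move=> k x y; rewrite mulrDl scalerAl. Qed.

Lemma form_coact1_linear i om : linear (form_coact1 i om).
Proof.
apply: linear_comp (tmap_linear (lact_linearl om) (mulr_linear _)) _.
by apply: linear_comp (linearP (coact (q := q))) _; exact: coord_linear.
Qed.

Lemma form_coact_linear : linear form_coact.
Proof.
move=> k x y; rewrite /form_coact !form_coact1_linear.
by lmod_eq (R[i]); ring.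
Qed.

Lemma form_coact_homog k l m n x y : homog k l x -> homog m n y ->
  form_coact (x <*: dP y) = (x <*: dP y) \ox tpow (k + m).
Proof.
move=> hx hy; have E i om : form_coact1 i om (x <*: dP y) =
    (coord i (x <*: dP y) <*: om) \ox tpow (k + m).
  have hc : homog (k + (m + wt i)) (l + n) (coord i (x <*: dP y)).
    rewrite (coord_lact hpr) (coord_dP hpr).
    by apply: homogM => //; exact: homog_tangent.
  rewrite /form_coact1 (homog_coact hc) tmap_pure; first last.
  - exact: mulr_linear.
  - exact: lact_linearl.
  by rewrite -tpowD -addrA -addrA addrN addr0.
by rewrite /form_coact !E -!tpureDl -(coordK hpr homega).
Qed.

Lemma form_coact_comodule : is_comodule form_coact.
Proof.
have cL := form_coact_linear.
have iL : linear (idfun : H -> H) by []; have iL' : linear (idfun : Om -> Om) by [].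
have dL : linear (@hDelta R) by exact: linearP.
have sb : bilinear_map (fun (v : Om) (h : H) => (counit h : C) *: v).
  by apply: contract_bilinear; exact: counit_lin.
split=> //.
- apply: Omega1P_ext.
  + apply: linear_comp (@tassoc_linear _ _ _ _) _.
    exact: linear_comp (tmap_linear cL iL) cL.
  + exact: linear_comp (tmap_linear iL' dL) cL.
  move=> k l m n x y hx hy; have h := form_coact_homog hx hy.
  by rewrite h !tmap_pure // h tassoc_pure (tpow_grouplike R _).1.
- apply: Omega1P_ext; [exact: linear_comp (tlift_linear sb) cL | by [] |].
  move=> k l m n x y hx hy; rewrite (form_coact_homog hx hy).
  by rewrite tlift_pure // (tpow_grouplike R _).2 scale1r.
Qed.

Lemma dP_linear : linear (@dP R q).
Proof.
have E z : dP z = Dform (1 \ox z).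
  by rewrite Dform_pure; apply/esym; exact: lact1.
by move=> k x y; rewrite !E tpureDr tpureZr; exact: Dform_linear.
Qed.

Lemma form_coactE p p' : form_coact (p <*: dP p') =
  tlift (fun p0 h => tlift (fun p0' h' =>
    (p0 <*: dP p0') \ox (h * h')) (coact p')) (coact p).
Proof.
have dPL := dP_linear.
have b1 p0 h : bilinear_map (fun (p0' : P) (h' : H) => (p0 <*: dP p0') \ox (h * h')).
  split=> [h'|p0'] k x y.
    by rewrite dPL lact_linear tpureDl tpureZl.
  by rewrite mulrDr -scalerAr tpureDr tpureZr.
have b2 z : bilinear_map (fun (p0 : P) (h : H) => tlift (fun p0' h' =>
    (p0 <*: dP p0') \ox (h * h')) z).
  split=> [h|p0].
    apply: tlift_linear_param => p0' h' k x y.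
    by rewrite lact_linearl tpureDl tpureZl.
  apply: tlift_linear_param => p0' h' k x y.
  by rewrite mulrDl -scalerAl tpureDr tpureZr.
have cL : linear (coact (q := q)) by exact: linearP.
move: p; apply: homog_ext.
- exact: linear_comp form_coact_linear (lact_linearl (dP p')).
- exact: linear_comp (tlift_linear (b2 _)) cL.
move=> k l p hp; move: p'; apply: homog_ext.
- exact: linear_comp form_coact_linear (linear_comp (lact_linear p) dPL).
- rewrite (homog_coact hp) => z x y.
  by rewrite !tlift_pure //; exact: (linear_comp (tlift_linear (b1 p _)) cL).
move=> m n p' hp'; rewrite (form_coact_homog hp hp').
by rewrite (homog_coact hp) tlift_pure // (homog_coact hp') tlift_pure // tpowD.
Qed.

Lemma counit_hopf_map (x : P) : counit (hopf_map x) = counit x :> C.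
Proof.
have [pia pib pic pid] := hopf_mapE q; have [ea eb ec ed] := counitE q.
have [et eti] := counit_t R.
apply: (su2_alg_ext (B := C^o) (f := fun x : P => counit (hopf_map x))
  (g := fun x : P => counit x)).
- by apply: linear_comp (@counit_lin _ H) _; exact: linearP.
- exact: counit_lin.
- by split=> [|y z]; rewrite ?rmorph1 // !rmorphM.
- by split=> [|y z]; rewrite ?rmorph1 // !rmorphM.
- by rewrite pia et ea.
- by rewrite pib raddf0 eb.
- by rewrite pic raddf0 ec.
- by rewrite pid eti ed.
Qed.

(** The generator p kappa(x) of N_P is sent to p (x) pi(x), and I_H is by definition the set of
    pi(x) with x in I_P; both inclusions follow. *)
Lemma ver_NP (y : tens P H) : (exists2 n, NP q n & ver_univ n = y) <->
  Defs.span (fun z => exists p h, IH q h /\ z = p \ox h) y.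
Proof.
have vL := @ver_univ_linear R q; split=> [[n Nn <-]|].
  move: Nn => [m [k [s [hs ->]]]]; rewrite (linear_map_sum _ _ vL).
  apply: submod_sum => i; have [_ _ _ vZ _] := linear_identities vL; rewrite vZ.
  apply: submodZ; apply: Defs.sub_span; have [p [x [Ix ->]]] := hs i.
  exists p, (hopf_map x); split; first by exists x.
  exact: ver_univ_lkappa.
have i0 : exists2 n, NP q n & ver_univ n = 0.
  by exists 0; [exact: submod0 | case: (linear_identities vL)].
have iP k x z : (exists2 n, NP q n & ver_univ n = x) ->
    (exists2 n, NP q n & ver_univ n = z) ->
    exists2 n, NP q n & ver_univ n = k *: x + z.
  move=> [n Nn <-] [m Nm <-]; exists (k *: n + m); last exact: vL.
  exact: submodP.
apply: (span_min (A := Submodule i0 iP)) => z [p [h [[x [Ix ->]] ->]]].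
by exists ((p \ox 1) * kappa x); [exact: NP_kappa | exact: ver_univ_lkappa].
Qed.

Lemma class_LambdaH_linear : linear (class_LambdaH q).
Proof.
apply: (@cls_comp_linear _ _ (aug_ideal H) (IH q) _
  (fun h : H => h - (counit h : C)%:A)) => [k x y|x] /=.
  rewrite (counit_lin k x y) scalerDl -scalerA.
  by rewrite scalerBr opprD addrACA.
by rewrite linearB /= counit_alg subrr.
Qed.

Lemma class_LambdaH_aug (h : H) : counit h = 0 :> C ->
  class_LambdaH q h = cls (aug_ideal H) (IH q) h.
Proof. by rewrite /class_LambdaH => ->; rewrite scale0r subr0. Qed.

Lemma class_LambdaH_IH h : IH q h -> class_LambdaH q h = 0.
Proof.
move=> Ih; have [x [Ix hE]] := Ih.
have eh : counit h = 0 :> C by rewrite hE counit_hopf_map counit_IP.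
have [c0 _ _ _ _] := linear_identities class_LambdaH_linear.
rewrite -[RHS]c0 !class_LambdaH_aug ?raddf0 //.
apply/cls_eqP; [exact: eh | exact: submod0 | by rewrite subr0].
Qed.

Lemma class_LambdaH_1 : class_LambdaH q 1 = 0.
Proof.
have [c0 _ _ _ _] := linear_identities class_LambdaH_linear.
rewrite -[RHS]c0 /class_LambdaH; congr (cls _ _ _).
by rewrite rmorph1 raddf0 scale1r scale0r !subrr.
Qed.

Lemma class_LambdaH_rep (v : LambdaH q) : class_LambdaH q (rep v) = v.
Proof.
have ev : counit (rep v) = 0 :> C by exact: (rep_in v).
by rewrite class_LambdaH_aug //; exact: repK.
Qed.

Definition ver_map (u : tens P P) : tens P (LambdaH q) :=
  tmap idfun (class_LambdaH q) (ver_univ u).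

Lemma lambda_tmap_linear :
  linear (tmap idfun (class_LambdaH q) : tens P H -> _).
Proof. by apply: tmap_linear => //; exact: class_LambdaH_linear. Qed.

Lemma ver_map_linear : linear ver_map.
Proof. exact: linear_comp lambda_tmap_linear (@ver_univ_linear R q). Qed.

(* [IH] is an ideal, which makes [ver] independent of representatives even
   after a right multiplication. *)
Lemma ver_map_right_NP p u : NP q u -> ver_map (u * (1 \ox p)) = 0.
Proof.
have mL : linear (fun u : tens P P => u * (1 \ox p)).
  by move=> k x y; rewrite mulrDl scalerAl.
move: u; apply: NP_linear0; first exact: linear_comp ver_map_linear mL.
move=> p' x Ix; rewrite /ver_map ver_univMr ver_univ_lkappa /coact.
have [t0 tD _ _ _] := linear_identities lambda_tmap_linear.
elim/tens_ind: (Delta p) => [|y z hy hz|y z].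
- by rewrite linear0 mulr0 t0.
- by rewrite linearD mulrDr tD hy hz addr0.
rewrite tmapE /= tmulE tmap_pure //; last exact: class_LambdaH_linear.
rewrite class_LambdaH_IH ?tpure0r //.
exists (x * z); split; last by rewrite rmorphM.
move: Ix => [n [k [s [hs ->]]]]; rewrite mulr_suml; apply: submod_sum => i.
rewrite -scalerAl; apply: submodZ; have [g [r [gI ->]]] := hs i.
by apply: Defs.sub_span; exists g, (r * z); rewrite mulrA.
Qed.

Lemma ver_map_NP u : NP q u -> ver_map u = 0.
Proof. by move=> /(ver_map_right_NP 1); rewrite -toneE mulr1. Qed.

Lemma ver_linear : linear (@ver R q).
Proof. exact: (form_map_linear ver_map_linear ver_map_NP). Qed.

(** The correction term of [Dform] is sent by [ver_univ] into P (x) 1, and the class of 1 -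
    epsilon(1) is zero. *)
Lemma ver_Dform u : ver (Dform u) = ver_map u.
Proof.
rewrite [LHS](form_map_Dform ver_map_linear ver_map_NP).
have [_ _ _ _ vB] := linear_identities ver_map_linear; rewrite vB.
suff -> : ver_map (mul_map u \ox 1) = 0 by rewrite subr0.
rewrite /ver_map ver_univ_pure rmorph1 mulr1 tmap_pure //; last first.
  exact: class_LambdaH_linear.
by rewrite class_LambdaH_1 tpure0r.
Qed.

Lemma ver_surj y : exists w, ver (q := q) w = y.
Proof.
have [v0 vD _ _ _] := linear_identities ver_linear.
elim/tens_ind: y => [|y z [u <-] [v <-]|p v].
- by exists 0.
- by exists (u + v).
have [x hx] := hopf_map_surj (rep v).
exists (Dform ((p \ox 1) * kappa x)); rewrite ver_Dform /ver_map ver_univ_lkappa.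
rewrite tmap_pure //; last exact: class_LambdaH_linear.
by rewrite hx class_LambdaH_rep.
Qed.

Definition lambda_eval (v : LambdaH q) : C^o :=
  u1_eval q (rep v) - counit (rep v).

Lemma u1_eval_counit_linear :
  linear (fun h : H => u1_eval q h - counit h : C^o).
Proof.
by move=> k x y; rewrite (u1_eval_linear q) (counit_lin k x y) scalerBr opprD addrACA.
Qed.

(** On pi(x) this functional takes the value L_z(x), which vanishes for x in I_P. *)
Lemma u1_eval_counit_IH h : IH q h -> u1_eval q h - counit h = 0 :> C.
Proof.
move=> [x [Ix ->]].
rewrite (u1_eval_hopf hpr) counit_hopf_map -(pr_Lz hpr).
exact: (pr_tangent_IP hpr Tz Ix).
Qed.

Lemma lambda_eval_linear : linear lambda_eval.
Proof. exact: (descent_linear u1_eval_counit_linear u1_eval_counit_IH). Qed.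

Lemma lambda_eval_class h :
  lambda_eval (class_LambdaH q h) = u1_eval q h - counit h.
Proof.
rewrite /lambda_eval /class_LambdaH.
have := descent_cls (A := aug_ideal H) (B := IH q)
  (f := fun h : H => u1_eval q h - counit h : C^o)
  (x := h - (counit h : C)%:A) u1_eval_counit_linear u1_eval_counit_IH.
move=> ->; last by rewrite /= linearB /= counit_alg subrr.
have [_ _ _ fZ fB] := linear_identities u1_eval_counit_linear.
rewrite (fB h) (fZ _ 1); have [-> _] := u1_eval_monoid q.
by rewrite rmorph1 subrr scaler0 subr0.
Qed.

Lemma contract_ver w : contract lambda_eval (ver w) = coord Tz w.
Proof.
have lL := lambda_eval_linear.
rewrite [contract _ _]tlift_tmap; last exact: contract_bilinear.
rewrite ver_univ_galois [tlift _ _]tlift_tmap; last first.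
  have fL : linear (fun h : H => lambda_eval (class_LambdaH q h)).
    exact: linear_comp lL class_LambdaH_linear.
  exact: (contract_bilinear P fL).
apply: tlift_ext => u v /=.
by rewrite lambda_eval_class (u1_eval_hopf hpr) counit_hopf_map -(pr_Lz hpr).
Qed.

End PrincipalBundle.

(** * Explicit formulas for theta, and the forms killed by ver *)

Section SolderingForm.
Variables (R : realType) (q : deformation R).
Local Notation q' := (qC q).
Local Notation P := (SUq2 q).
Local Notation a := (pa q).
Local Notation b := (pb q).
Local Notation c := (pc q).
Local Notation d := (pd q).
Local Notation Om := (Omega1P q).
Local Notation S := (@antipode R q).
Local Notation Dl := (@Delta R q).
Local Notation bm := (b_minus q).
Local Notation b0 := (b_zero q).
Local Notation bp := (b_plus q).

Lemma theta_lift_bilinear : bilinear_map (fun x1 x2 : P => S x1 <*: dP x2).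
Proof.
split=> [y|x] k u v; first by rewrite linearP lact_linearl.
by rewrite dP_linear lact_linear.
Qed.

Lemma theta_lift_prod (x1 x2 y1 y2 z1 z2 w1 w2 : P) :
  tlift (fun x1 x2 : P => S x1 <*: dP x2)
    ((x1 \ox y1 + x2 \ox y2) * (z1 \ox w1 + z2 \ox w2)) =
  ((S z1 * S x1) <*: dP (y1 * w1)) + ((S z2 * S x1) <*: dP (y1 * w2)) +
  ((S z1 * S x2) <*: dP (y2 * w1)) + ((S z2 * S x2) <*: dP (y2 * w2)).
Proof.
have fb := theta_lift_bilinear; have [_ fD _ _ _] := linear_identities (tlift_linear fb).
by rewrite mulrDl !mulrDr !tmulE !fD !tlift_pure // !antipodeM !addrA.
Qed.

Lemma dP_1 : dP (1 : P) = 0.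
Proof.
have [c0 _ _ _ _] := linear_identities (@Dform_linear R q).
by rewrite -[RHS]c0 /dP subrr Dform_class // (univ_forms0 q).
Qed.

(** The coproduct of a product of two generators has four terms. Reordering leaves d(ab), d(bc),
    d(cd), as d1 = 0 removes the constants of ad and da. Two of the four terms contribute to d(bc),
    whence mu = q + q^-1. *)
Lemma theta_lift_explicit :
  [/\ theta_lift bp = ((q' ^+ 2 *: c ^+ 2) <*: dP bm)
        - (((q' * mu q) *: (a * c)) <*: dP b0) + ((a ^+ 2) <*: dP bp),
      theta_lift b0 = - ((q' *: (d * c)) <*: dP bm)
        + ((1 + mu q *: (b * c)) <*: dP b0) - ((q'^-1 *: (b * a)) <*: dP bp) &
      theta_lift bm = ((d ^+ 2) <*: dP bm)
        - (((q'^-1 * mu q) *: (b * d)) <*: dP b0)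
        + ((q' ^- 2 *: b ^+ 2) <*: dP bp)].
Proof.
have [Da Db Dc Dd] := Delta_genE q; have [Sa Sb Sc Sd] := antipodeE q.
have [ba ca db dc [cb ad da]] := su2_relE q.
have DM (x y : P) : Dl (x * y) = Dl x * Dl y by exact: rmorphM.
have [_ dD _ dZ _] := linear_identities (@dP_linear R q).
have lD p p' w : (p + p') <*: w = (p <*: w) + (p' <*: w) :> Om.
  by have [_ h _ _ _] := linear_identities (@lact_linearl R q w); exact: h.
have lZ k p w : (k *: p) <*: w = k *: (p <*: w) :> Om.
  by have [_ _ _ h _] := linear_identities (@lact_linearl R q w); exact: h.
have q0 := qC_neq0 q.
rewrite /theta_lift /b_plus /b_minus /b_zero !DM Da Db Dc Dd !theta_lift_prod.
rewrite Sa Sb Sc Sd !expr2 -?scalerAl -?scalerAr ?scalerA.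
rewrite !(ba, ca, db, dc, cb, ad, da) ?dD !dZ dP_1 ?add0r ?lactZ.
split; rewrite ?(lD, lZ, lactZ) ?scalerA.
- move: (_ <*: dP (a * b)) (_ <*: dP (b * c)) (_ <*: dP (c * d)) => u v w.
  by lmod_eq (R[i]); rewrite /mu; field.
- move: (_ <*: dP (a * b)) ((b * c) <*: dP (b * c)) (1 <*: dP (b * c)).
  move: (_ <*: dP (c * d)) => w u v v'.
  by lmod_eq (R[i]); rewrite /mu; field.
- move: (_ <*: dP (a * b)) (_ <*: dP (b * c)) (_ <*: dP (c * d)) => u v w.
  by lmod_eq (R[i]); rewrite /mu; field.
Qed.

Lemma coinv_S2q (m : P) : coact m = m \ox 1 ->
  exists m' : S2q q, S2q_val m' = m.
Proof. by move=> /eqP hm; exists (MkS2q hm). Qed.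

Lemma Omega1M_dP (m n : P) : coact m = m \ox 1 -> coact n = n \ox 1 ->
  Omega1M_set q (m <*: dP n).
Proof.
move=> /coinv_S2q[m' <-] /coinv_S2q[n' <-].
by apply: Defs.sub_span; exists m', n'.
Qed.

Lemma coact_frame (x : P) : aug_M q x -> coact x = x \ox 1.
Proof. by move=> /aug_MP[]. Qed.

Lemma P_Omega1M_dP (p n : P) : coact n = n \ox 1 -> P_Omega1M q (p <*: dP n).
Proof.
move=> hn; have h1 : coact (1 : P) = 1 \ox 1 by exact: rmorph1.
have /submod_predP h := Omega1M_dP h1 hn.
apply: Defs.sub_span; exists p, (MkOmega1M h) => /=.
by congr (_ <*: _); apply/esym; exact: lact1.
Qed.

Lemma P_Omega1M_lact p w : P_Omega1M q w -> P_Omega1M q (p <*: w).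
Proof.
move=> [n [k [s [hs ->]]]]; rewrite (linear_map_sum _ _ (lact_linear p)).
apply: submod_sum => i; rewrite lactZ; apply: submodZ.
have [p' [w' ->]] := hs i.
by apply: Defs.sub_span; exists (p * p'), w'; rewrite lactM.
Qed.

Lemma P_Omega1M_theta_lift :
  [/\ P_Omega1M q (theta_lift bm), P_Omega1M q (theta_lift b0) &
      P_Omega1M q (theta_lift bp)].
Proof.
have [hm h0 hp] := aug_M_frame q; have [ep e0 em] := theta_lift_explicit.
move: (coact_frame hm) (coact_frame h0) (coact_frame hp) => {}hm {}h0 {}hp.
have P1 p := P_Omega1M_dP p hm; have P2 p := P_Omega1M_dP p h0.
have P3 p := P_Omega1M_dP p hp.
rewrite ep e0 em; split; apply: submodD; do ?apply: submodD; do ?apply: submodN => //.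
all: by [].
Qed.

Lemma P_Omega1M_P_sub w : P_Omega1M q w -> P_Omega1M_P q w.
Proof.
apply: span_min => _ [p [w' ->]]; apply: Defs.sub_span; exists p, w', 1.
by rewrite /ract -toneE mulr1; apply/esym; exact: repK.
Qed.

Lemma mul_mapMr (u : tens P P) p : mul_map (u * (1 \ox p)) = mul_map u * p.
Proof.
have [m0 mD _ _ _] := linear_identities (@mul_map_linear R q).
elim/tens_ind: u => [|u v hu hv|x y]; first by rewrite mul0r m0 mul0r.
  by rewrite mulrDl !mD mulrDl hu hv.
by rewrite tmulE mulr1 !mul_map_pure mulrA.
Qed.

(** For coinvariant n the elements 1 (x) n and n (x) 1 have the same image, so p m dn is killed
    already by [ver_univ]; a right factor only multiplies the image by its coaction. *)
Lemma ver_P_Omega1M_P w : P_Omega1M_P q w -> ver w = 0.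
Proof.
apply: span_linear0; first exact: ver_linear.
(* [ract] is computed on a chosen representative; [gN] shows that [g] depends on the class only, so
   a convenient representative may be used. *)
move=> _ [p [w' [p' ->]]]; pose g u := ver_map (u * (1 \ox p')).
have gL : linear g.
  apply: linear_comp (@ver_map_linear R q) _ => k x y.
  by rewrite mulrDl scalerAl.
have gN u : NP q u -> g u = 0 by exact: ver_map_right_NP.
have -> : ver (ract (p <*: Omega1M_val w') p') =
    g (rep1P (p <*: Omega1M_val w')).
  by rewrite /g -ver_Dform Dform_class // mul_mapMr mul_map_rep mul0r.
have /submod_predP := Omega1M_valP w'.
apply: (span_linear0 (f := fun v => g (rep1P (p <*: v)))).
  exact: linear_comp (form_map_linear gL gN) (lact_linear p).
move=> _ [m [n ->]].
rewrite lactM -Dform_pure (form_map_Dform gL gN) mul_map_pure /g /ver_map ver_univMr.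
have [_ _ _ _ vB] := linear_identities (@ver_univ_linear R q).
rewrite vB !ver_univ_pure (eqP (S2q_valP n)) tmulE mul1r rmorph1 mulr1 subrr mul0r.
by case: (linear_identities (@lambda_tmap_linear R q)).
Qed.

End SolderingForm.

(** * The bundle axioms, and degrees of forms on the base *)

Section Framing.
Variables (R : realType) (q : deformation R).
Variable pr : Uqsu2 q -> SUq2 q -> R[i].
Hypothesis hpr : dual_pairing pr.
Variables omega_m omega_0 omega_p omega_z : Omega1P q.
Hypothesis homega : dual_forms pr omega_m omega_0 omega_p omega_z.
Local Notation C := R[i].
Local Notation q' := (qC q).
Local Notation P := (SUq2 q).
Local Notation Om := (Omega1P q).
Local Notation act := (act pr).
Local Notation tpow := (tpow R).
Local Notation coord := (coord pr).
Local Notation V := (frameV q).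
Local Notation bm := (b_minus q).
Local Notation b0 := (b_zero q).
Local Notation bp := (b_plus q).
Local Notation vm := (classV bm).
Local Notation v0 := (classV b0).
Local Notation vp := (classV bp).
Local Notation wt := tangent_weight.

Lemma P_Omega1M_omega :
  [/\ P_Omega1M q omega_m, P_Omega1M q omega_0 & P_Omega1M q omega_p].
Proof.
have [hm h0 hp] := P_Omega1M_theta_lift q.
have [tm t0 tp] := theta_lift_frame hpr homega.
have inv (k : C) w : k != 0 -> P_Omega1M q (k *: w) -> P_Omega1M q w.
  by move=> k0 h; rewrite -[w]scale1r -(mulVf k0) -scalerA; exact: submodZ.
split; last by rewrite -tp.
  by apply: (inv q'); rewrite ?qC_neq0 // -tm.
by apply: (inv (nu q ^+ 2 * q'^-1)); rewrite ?frame_norm_neq0 // -t0.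
Qed.

(** A form without omega_z coordinate already lies in P (Omega^1 M), which contains the other three
    forms; hence P (Omega^1 M) P = P (Omega^1 M). *)
Lemma ver_exact w : ver w = 0 <-> P_Omega1M_P q w.
Proof.
split; last exact: ver_P_Omega1M_P.
move=> vw; apply: P_Omega1M_P_sub.
have [Pm P0 Pp] := P_Omega1M_omega.
have wz : coord Tz w = 0.
  rewrite -(contract_ver hpr) vw.
  by case: (linear_identities (contract_linear (V := P) (lambda_eval_linear hpr))).
rewrite [w](coordK hpr homega) wz.
have -> : 0 <*: omega_z = 0 by case: (linear_identities (lact_linearl omega_z)).
rewrite addr0; apply: submodD; first apply: submodD.
all: exact: P_Omega1M_lact.
Qed.

Lemma quantum_principal_bundle_SUq2 : quantum_principal_bundle q.
Proof.
split.
- by split; [exact: coact_comodule | exact: coact_monoid].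
- exact: ver_univ_surj.
- exists (form_coact pr omega_m omega_0 omega_p omega_z).
  by split; [exact: form_coact_comodule | exact: form_coactE].
- exact: ver_NP.
- by split; [exact: ver_exact | exact: ver_surj].
Qed.

Lemma theta_decomp v : theta v =
  frame_coordV pr Tminus v *: theta vm + frame_coordV pr Tzero v *: theta v0
  + frame_coordV pr Tplus v *: theta vp.
Proof.
have [_ tD _ tZ _] := linear_identities (@theta_linear R q).
by rewrite {1}[v](frameV_decomp hpr homega) !tD !tZ.
Qed.

Lemma P_Omega1M_theta v : P_Omega1M q (theta v).
Proof.
have [Pm P0 Pp] := P_Omega1M_omega; have [tm t0 tp] := theta_omega hpr homega.
rewrite theta_decomp tm t0 tp; apply: submodD; last exact: submodZ.
by apply: submodD; do ?apply: submodZ.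
Qed.

Lemma coord_Omega1M i w : Omega1M_set q w ->
  coact (coord i w) = coord i w \ox tpow (wt i).
Proof.
move=> hw; apply/eqP; rewrite -subr_eq0; apply/eqP; move: w hw.
have cL := coord_linear hpr i.
apply: (span_linear0 (f := fun w => coact (coord i w) - coord i w \ox tpow (wt i))).
  move=> k x y; rewrite cL [coact _]linearP tpureDl tpureZl.
  by rewrite scalerBr opprD addrACA.
move=> _ [m [n ->]]; rewrite (coord_lact hpr) (coord_dP hpr) rmorphM /=.
have /eqP hm := S2q_valP m; have /eqP hn := S2q_valP n.
by rewrite hm (coact_tangent_coinv hpr) // tmulE mul1r subrr.
Qed.

Lemma coord_Tz_Omega1M w : Omega1M_set q w -> coord Tz w = 0.
Proof.
apply: span_linear0; first exact: coord_linear.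
move=> _ [m [n ->]]; rewrite (coord_lact hpr) (coord_dP hpr).
have /eqP hn := S2q_valP n.
by rewrite [act _ _](act_Lz_coinv hpr) // mulr0.
Qed.

Lemma Omega1M_decomp w : Omega1M_set q w ->
  w = (coord Tminus w <*: omega_m) + (coord Tzero w <*: omega_0)
    + (coord Tplus w <*: omega_p).
Proof.
move=> hw; rewrite {1}[w](coordK hpr homega) (coord_Tz_Omega1M hw).
by have [-> _ _ _ _] := linear_identities (lact_linearl omega_z); rewrite addr0.
Qed.

(** In the explicit formulas every coefficient has the degree opposite to that of [p], so its
    product with [p] is coinvariant. *)
Lemma lact_theta_Omega1M :
  [/\ forall p, coact p = p \ox tpow 2 -> Omega1M_set q (p <*: theta vm),
      forall p, coact p = p \ox 1 -> Omega1M_set q (p <*: theta v0) &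
      forall p, coact p = p \ox tpow (- 2) -> Omega1M_set q (p <*: theta vp)].
Proof.
have [Mm M0 Mp] := aug_M_frame q.
rewrite !theta_class //; have [-> -> ->] := theta_lift_explicit q.
have cm := coact_frame Mm; have c0 := coact_frame M0; have cp := coact_frame Mp.
have term w (p x n : P) k : coact p = p \ox tpow w -> homog (- w) k x ->
    coact n = n \ox 1 -> Omega1M_set q ((p * x) <*: dP n).
  move=> hp /homog_coact hx hn; apply: Omega1M_dP => //.
  by rewrite rmorphM /= hp hx tmulE tpowNK.
have lD p w w' : p <*: (w + w') = (p <*: w) + (p <*: w') :> Om.
  by have [_ h _ _ _] := linear_identities (@lact_linear R q p); exact: h.
have lN p w : p <*: (- w) = - (p <*: w) :> Om.
  by have [_ _ h _ _] := linear_identities (@lact_linear R q p); exact: h.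
have [ha hb hc hd] := And4 (homog_a q) (homog_b q) (homog_c q) (homog_d q).
split=> p hp; rewrite !lD !lN !lactM; apply: submodD; do ?apply: submodD;
  do ?apply: submodN.
- by apply: term hp _ cm; exact: (homogM hd hd).
- by apply: term hp _ c0; apply: homogZ; exact: (homogM hb hd).
- by apply: term hp _ cp; apply: homogZ; exact: (homogM hb hb).
- by apply: (term 0) hp _ cm; apply: homogZ; exact: (homogM hd hc).
- apply: (term 0) hp _ c0; apply: homogD; last by apply: homogZ; exact: (homogM hb hc).
  by rewrite -[X in homog _ _ X]scale1r; exact: homog_scalar.
- by apply: (term 0) hp _ cp; apply: homogZ; exact: (homogM hb ha).
- by apply: term hp _ cm; apply: homogZ; exact: (homogM hc hc).
- by apply: term hp _ c0; apply: homogZ; exact: (homogM ha hc).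
- by apply: term hp _ cp; exact: (homogM ha ha).
Qed.

End Framing.

(** * Tensor product coactions, and the dual basis criterion *)

Section TensorCoaction.
Variables (R : realType) (V W : lmodType R[i]).
Variables (rV : V -> tens V (U1 R)) (rW : W -> tens W (U1 R)).
Hypotheses (rVL : linear rV) (rWL : linear rW).
Local Notation H := (U1 R).

Lemma tens_coact_bilinear : bilinear_map (fun v w =>
  tlift (fun (v0 : V) (h : H) => tlift (fun (w0 : W) (k : H) =>
    (v0 \ox w0) \ox (h * k)) (rW w)) (rV v)).
Proof.
have b1 (v : V) (h : H) : bilinear_map (fun (w : W) (k : H) => (v \ox w) \ox (h * k)).
  split=> [z|z] k x y; first by rewrite !tpureDr !tpureZr tpureDl tpureZl.
  by rewrite mulrDr -scalerAr tpureDr tpureZr.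
split=> [w|v].
  apply: linear_comp rVL; apply: tlift_linear; split=> [h|v].
    apply: tlift_linear_param => w0 k l x y.
    by rewrite !(tpureDl, tpureZl).
  apply: tlift_linear_param => w0 k l x y.
  by rewrite mulrDl -scalerAl tpureDr tpureZr.
apply: tlift_linear_param => v0 h.
have tL := tlift_linear (b1 v0 h).
by apply: linear_comp rWL.
Qed.

Lemma tens_coact_linear : linear (tens_coact rV rW).
Proof. exact: tlift_linear tens_coact_bilinear. Qed.

Lemma tens_coact_pure v w k : rW w = w \ox k ->
  tens_coact rV rW (v \ox w) = tmap (fun v0 => v0 \ox w) (fun h => h * k) (rV v).
Proof.
move=> hw; rewrite /tens_coact tlift_pure; last exact: tens_coact_bilinear.
apply: tlift_ext => v0 h; rewrite hw tlift_pure //.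
split=> [z|z] l x y; first by rewrite !tpureDr !tpureZr tpureDl tpureZl.
by rewrite mulrDr -scalerAr tpureDr tpureZr.
Qed.

End TensorCoaction.

(** The lift sends each basis member to a chosen preimage of its image; linearity comes from the
    coordinate functionals and not from the choice. *)
Lemma dual_basis_projective (A : nzRingType) (N : lmodType A)
    (r : seq ({linear N -> A^o} * N)) :
  (forall n, n = \sum_(p <- r) p.1 n *: p.2) -> projective N.
Proof.
move=> hr X Y g f gsurj.
have [ch hch] := choice (fun n => gsurj (f n)).
pose h n := \sum_(p <- r) p.1 n *: ch p.2.
have hL : linear h.
  move=> k x y; rewrite /h scaler_sumr -big_split; apply: eq_bigr => p _.
  by rewrite linearP scalerDl scalerA.
pose h' : {linear N -> X} := HB.pack h (GRing.isLinear.Build _ _ _ _ h hL).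
exists h' => n.
rewrite [in RHS](hr n) /= /h !raddf_sum; apply: eq_bigr => p _.
have gZ (k : A) x : g (k *: x) = k *: g x by exact: linearZ_LR.
have fZ (k : A) x : f (k *: x) = k *: f x by exact: linearZ_LR.
by rewrite [LHS]gZ [RHS]fZ hch.
Qed.

(** * The soldering form *)

Section Soldering.
Variables (R : realType) (q : deformation R).
Variable pr : Uqsu2 q -> SUq2 q -> R[i].
Hypothesis hpr : dual_pairing pr.
Variables omega_m omega_0 omega_p omega_z : Omega1P q.
Hypothesis homega : dual_forms pr omega_m omega_0 omega_p omega_z.
Local Notation q' := (qC q).
Local Notation P := (SUq2 q).
Local Notation H := (U1 R).
Local Notation Om := (Omega1P q).
Local Notation tpow := (tpow R).
Local Notation coord := (coord pr).
Local Notation V := (frameV q).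
Local Notation vm := (classV (b_minus q)).
Local Notation v0 := (classV (b_zero q)).
Local Notation vp := (classV (b_plus q)).
Local Notation wt := tangent_weight.
Local Notation n0 := (nu q ^+ 2 * q'^-1).
Local Notation ell := (frame_coordV pr).
Local Notation s := (soldering_map (@theta R q)).

(** The value 0 at [Tz] is a filler that keeps [coactV_vector] uniform in [i]. *)
Definition frame_vector (i : tangent) : V :=
  match i with Tminus => vm | Tzero => v0 | Tplus => vp | Tz => 0 end.
Local Notation fv := frame_vector.

Lemma coactV_vector i : coactV (fv i) = fv i \ox tpow (- wt i).
Proof.
have [hp h0 hm] := coactV_frame hpr homega; case: i => //=.
rewrite tpure0l; have [z0 _ _ _ _] := linear_identities (coactV_linear hpr homega).
exact: z0.
Qed.

Lemma frame_coordV_vector :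
  [/\ [/\ ell Tminus vm = 1, ell Tzero vm = 0 & ell Tplus vm = 0],
      [/\ ell Tminus v0 = 0, ell Tzero v0 = 1 & ell Tplus v0 = 0] &
      [/\ ell Tminus vp = 0, ell Tzero vp = 0 & ell Tplus vp = 1]].
Proof.
have [Mm M0 Mp] := aug_M_frame q.
have [[m1 m2 m3 _] [z1 z2 z3 _] [p1 p2 p3 _]] := frame_coordE hpr.
by split; split; rewrite (frame_coordV_class hpr).
Qed.

Definition component (i : tangent) (x : tens P V) : P := contract (ell i) x.

Lemma component_linear i : linear (component i).
Proof. exact/contract_linear/frame_coordV_linear. Qed.

Lemma component_pure i p v : component i (p \ox v) = ell i v *: p.
Proof. by rewrite /component contract_pure //; exact: frame_coordV_linear. Qed.

Lemma componentK x : x = component Tminus x \ox vm + component Tzero x \ox v0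
  + component Tplus x \ox vp.
Proof.
apply: (tens_eq (f := fun x => x) (g := fun x => component Tminus x \ox vm
  + component Tzero x \ox v0 + component Tplus x \ox vp)) => //.
  move=> k y z; rewrite !component_linear !(tpureDl, tpureZl).
  by lmod_eq (R[i]); ring.
move=> p v; rewrite !component_pure !tpureZl -!tpureZr -!tpureDr.
by rewrite -(frameV_decomp hpr homega).
Qed.

(** The basis vector of index i carries t^(- wt i), which is the extra factor; mixed terms vanish by
    duality of [ell] with the basis. *)
Lemma coaction_component i x : i <> Tz ->
  tmap (component i) idfun (tens_coact (coact (q := q)) (@coactV R q) x) =
  coact (component i x) * (1 \ox tpow (- wt i)).
Proof.
move=> iz; have cL : linear (coact (q := q)) by exact: linearP.
have vL := coactV_linear hpr homega; have iL : linear (idfun : H -> H) by [].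
have tL := tens_coact_linear cL vL; have kL := component_linear i.
have fL := linear_comp (tmap_linear kL iL) tL.
have gL : linear (fun x => coact (component i x) * (1 \ox tpow (- wt i))).
  have ckL : linear (fun x => coact (component i x)) by exact: linear_comp cL kL.
  by move=> k y z; rewrite ckL mulrDl scalerAl.
have E p j : tmap (component i) idfun
      (tens_coact (coact (q := q)) (@coactV R q) (p \ox fv j)) =
    ell i (fv j) *: (coact p * (1 \ox tpow (- wt j))).
  rewrite (tens_coact_pure cL vL _ (coactV_vector j)).
  have bL : linear (fun p0 : P => p0 \ox fv j) by exact: (tpure_bilinear _ _).1.
  have mL := mulr_linear (tpow (- wt j)).
  apply: (tens_eq
    (f := fun z => tmap (component i) idfun
       (tmap (fun p0 => p0 \ox fv j) (fun h => h * tpow (- wt j)) z))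
    (g := fun z : tens P H => ell i (fv j) *: (z * (1 \ox tpow (- wt j))))).
  - exact: linear_comp (tmap_linear kL iL) (tmap_linear bL mL).
  - move=> k y z; rewrite mulrDl -scalerAl scalerDr !scalerA.
    by rewrite [_ * k]mulrC.
  move=> u h; rewrite !tmap_pure // component_pure tmulE mulr1.
  by rewrite tpureZl.
have G p j : coact (component i (p \ox fv j)) * (1 \ox tpow (- wt i)) =
    ell i (fv j) *: (coact p * (1 \ox tpow (- wt i))).
  by rewrite component_pure [coact _]linearZ /= scalerAl.
have [[m1 m2 m3] [z1 z2 z3] [p1 p2 p3]] := frame_coordV_vector.
have [_ fD _ _ _] := linear_identities fL; have [_ gD _ _ _] := linear_identities gL.
rewrite [x]componentK !fD !gD.
rewrite (E _ Tminus) (E _ Tzero) (E _ Tplus) (G _ Tminus) (G _ Tzero) (G _ Tplus).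
rewrite /frame_vector.
by case: i iz {kL fL gL E G fD gD} => [_|_|_|//];
  rewrite ?(m1, m2, m3) ?(z1, z2, z3) ?(p1, p2, p3) !scale0r.
Qed.

Lemma component_coinv i x : i <> Tz ->
  tens_coact (coact (q := q)) (@coactV R q) x = x \ox 1 ->
  coact (component i x) = component i x \ox tpow (wt i).
Proof.
move=> iz hx; have := coaction_component x iz.
rewrite hx tmap_pure //; last exact: component_linear.
move=> /(congr1 (fun z => z * (1 \ox tpow (wt i)))).
rewrite -mulrA !tmulE !mulr1 mul1r -tpowD addNr.
by rewrite -[1 \ox tpow 0]/(1 : tens P H) mulr1 => <-.
Qed.

Lemma coinv_vector i p : coact p = p \ox tpow (wt i) ->
  tens_coact (coact (q := q)) (@coactV R q) (p \ox fv i) = (p \ox fv i) \ox 1.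
Proof.
have cL : linear (coact (q := q)) by exact: linearP.
have vL := coactV_linear hpr homega.
move=> hp; rewrite (tens_coact_pure cL vL _ (coactV_vector i)) hp tmap_pure.
- by rewrite tpowNK.
- exact: (tpure_bilinear _ _).1.
- exact: mulr_linear.
Qed.

Lemma soldering_bilinear : bilinear_map (fun (p : P) (v : V) => p <*: theta v).
Proof.
split=> [v|p] k x y; first by rewrite lact_linearl.
by rewrite theta_linear lact_linear.
Qed.

Lemma soldering_linear : linear s.
Proof. exact/tlift_linear/soldering_bilinear. Qed.

Lemma soldering_pure p v : s (p \ox v) = p <*: theta v.
Proof. by rewrite /soldering_map tlift_pure //; exact: soldering_bilinear. Qed.

Lemma lactZl k p (w : Om) : (k *: p) <*: w = p <*: (k *: w).
Proof.
by have [_ _ _ lZ _] := linear_identities (lact_linearl w); rewrite lZ -lactZ.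
Qed.

Lemma theta_sum pm p0 pp :
  (pm <*: theta vm) + (p0 <*: theta v0) + (pp <*: theta vp) =
  ((q' *: pm) <*: omega_m) + ((n0 *: p0) <*: omega_0) + (pp <*: omega_p).
Proof.
by have [-> -> ->] := theta_omega hpr homega; rewrite !lactZl.
Qed.

(** Freeness of Omega^1 P, after cancelling the nonzero factors q and nu^2 q^-1. *)
Lemma theta_sum_inj pm p0 pp pm' p0' pp' :
  (pm <*: theta vm) + (p0 <*: theta v0) + (pp <*: theta vp) =
  (pm' <*: theta vm) + (p0' <*: theta v0) + (pp' <*: theta vp) ->
  [/\ pm = pm', p0 = p0' & pp = pp'].
Proof.
(* A zero term along omega_z brings both sides to the shape of [coord_sum]. *)
have z0 : 0 <*: omega_z = 0 by case: (linear_identities (lact_linearl omega_z)).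
rewrite !theta_sum -[LHS]addr0 -[RHS]addr0 -z0 => e.
have h i := congr1 (coord i) e.
have := h Tminus; have := h Tzero; have := h Tplus.
rewrite !(coord_sum hpr homega) => -> e0 em; split=> //.
  exact: (scalerI (qC_neq0 q) em).
exact: (scalerI (frame_norm_neq0 q) e0).
Qed.

(** The coordinates of a form on the base have the required degrees; the scalars q^-1 and q nu^-2
    compensate the normalisation of theta. *)
Lemma theta_sum_surj w : Omega1M_set q w -> exists pm p0 pp,
  [/\ coact pm = pm \ox tpow 2, coact p0 = p0 \ox 1, coact pp = pp \ox tpow (- 2) &
      w = (pm <*: theta vm) + (p0 <*: theta v0) + (pp <*: theta vp)].
Proof.
move=> hw; have W i := coord_Omega1M hpr i hw.
exists (q'^-1 *: coord Tminus w), (n0^-1 *: coord Tzero w), (coord Tplus w).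
split.
- by rewrite [LHS]linearZ /= (W Tminus) tpureZl.
- by rewrite [LHS]linearZ /= (W Tzero) tpureZl.
- exact: (W Tplus).
rewrite theta_sum !scalerA !mulfV ?scale1r ?qC_neq0 ?frame_norm_neq0 //.
exact: Omega1M_decomp hw.
Qed.

Lemma soldering_component x : s x = (component Tminus x <*: theta vm)
  + (component Tzero x <*: theta v0) + (component Tplus x <*: theta vp).
Proof.
have [_ sD _ _ _] := linear_identities soldering_linear.
by rewrite {1}[x]componentK !sD !soldering_pure.
Qed.

Lemma soldering_iso_theta : soldering_iso (@coactV R q) (@theta R q).
Proof.
have [Wm W0 Wp] := lact_theta_Omega1M q.
have [_ sD _ _ _] := linear_identities soldering_linear.
split.
- move=> x hx; rewrite soldering_component; apply: submodD; first apply: submodD.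
  + by apply: Wm; exact: component_coinv hx.
  + by apply: W0; exact: (component_coinv (i := Tzero)) hx.
  + by apply: Wp; exact: component_coinv hx.
- move=> x y _ _; rewrite !soldering_component => /theta_sum_inj[em e0 ep].
  by rewrite [x]componentK [y]componentK em e0 ep.
- move=> w /theta_sum_surj[pm [p0 [pp [hm h0 hp ->]]]].
  exists (pm \ox vm + p0 \ox v0 + pp \ox vp); last by rewrite !sD !soldering_pure.
  have cL : linear (coact (q := q)) by exact: linearP.
  have [_ tD _ _ _] := linear_identities (tens_coact_linear cL (coactV_linear hpr homega)).
  rewrite !tD !tpureDl.
  by rewrite (coinv_vector (i := Tminus)) // (coinv_vector (i := Tzero)) //
             (coinv_vector (i := Tplus)).
split; first exact: soldering_linear.
move=> m x; rewrite /soldering_map [LHS]tlift_tmap; last exact: soldering_bilinear.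
rewrite (tlift_comp _ _ (lact_linear _)); apply: tlift_ext => p v.
by rewrite lactM.
Qed.

Lemma framed_S2q : framed_quantum_manifold (@coactV R q) (@theta R q).
Proof.
split.
- exact: (quantum_principal_bundle_SUq2 hpr homega).
- exact: (coactV_comodule hpr homega).
- exact: theta_linear.
- exact: (P_Omega1M_theta hpr homega).
- exact: soldering_iso_theta.
Qed.

End Soldering.

(** * The cotangent bundle as a sum of line bundles, and its projectivity *)

Section Cotangent.
Variables (R : realType) (q : deformation R).
Variable pr : Uqsu2 q -> SUq2 q -> R[i].
Hypothesis hpr : dual_pairing pr.
Variables omega_m omega_0 omega_p omega_z : Omega1P q.
Hypothesis homega : dual_forms pr omega_m omega_0 omega_p omega_z.
Local Notation C := R[i].
Local Notation q' := (qC q).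
Local Notation P := (SUq2 q).
Local Notation a := (pa q).
Local Notation b := (pb q).
Local Notation c := (pc q).
Local Notation d := (pd q).
Local Notation Om := (Omega1P q).
Local Notation M := (S2q q).
Local Notation tpow := (tpow R).
Local Notation coord := (coord pr).
Local Notation vm := (classV (b_minus q)).
Local Notation v0 := (classV (b_zero q)).
Local Notation vp := (classV (b_plus q)).
Local Notation wt := tangent_weight.
Local Notation lb := (line_bundle q).
Local Notation LLL := (lb (- 2) * lb 0 * lb 2)%type.

(** An element of L_n has coaction t^(-n), so L_(-2), with coaction t^2, belongs to theta(b_-),
    whose coefficients carry t^(-2). *)
Definition cotangent_val (u : LLL) : Om :=
  (line_val u.1.1 <*: theta vm) + (line_val u.1.2 <*: theta v0)
  + (line_val u.2 <*: theta vp).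

Lemma cotangent_val_in u : cotangent_val u \in @Omega1M_pred R q.
Proof.
have [Wm W0 Wp] := lact_theta_Omega1M q; apply/submod_predP.
apply: submodD; first apply: submodD.
- by apply: Wm; exact/eqP/(line_valP u.1.1).
- by apply: W0; exact/eqP/(line_valP u.1.2).
- by apply: Wp; exact/eqP/(line_valP u.2).
Qed.

Definition cotangent (u : LLL) : Omega1M q := MkOmega1M (cotangent_val_in u).

Lemma cotangent_linear : linear cotangent.
Proof.
move=> m u v; apply: val_inj.
rewrite [RHS](linearP (val : Omega1M q -> over_S2q (left_Omega1P q))) /=.
change (cotangent_val (m *: u + v) =
  (S2q_val m <*: cotangent_val u) + cotangent_val v :> Om).
have lD p p' (w : Om) : (p + p') <*: w = (p <*: w) + (p' <*: w).
  by have [_ h _ _ _] := linear_identities (lact_linearl w); exact: h.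
have lD' p (w w' : Om) : p <*: (w + w') = (p <*: w) + (p <*: w').
  by have [_ h _ _ _] := linear_identities (lact_linear p); exact: h.
have E n (x y : lb n) : line_val (m *: x + y) =
    S2q_val m * (line_val x : P) + (line_val y : P) :> P.
  exact: (linearP (val : lb n -> over_S2q P^o)).
rewrite /cotangent_val.
rewrite [line_val (_ + _).1.1](E _ u.1.1 v.1.1) [line_val (_ + _).1.2](E _ u.1.2 v.1.2).
rewrite [line_val (_ + _).2](E _ u.2 v.2) !lD !lD' !lactM.
by rewrite [X in X + _ = _]addrACA [LHS]addrACA.
Qed.

HB.instance Definition _ :=
  GRing.isLinear.Build M LLL (Omega1M q) *:%R cotangent cotangent_linear.

Lemma cotangent_inj : injective cotangent.
Proof.
move=> [[x y] z] [[x' y'] z'] /(congr1 (@Omega1M_val R q)) /= e.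
have [ex ey ez] := theta_sum_inj hpr homega e.
by move: (val_inj ex) (val_inj ey) (val_inj ez) => /= -> -> ->.
Qed.

Lemma cotangent_surj w : exists u, cotangent u = w.
Proof.
have /submod_predP := Omega1M_valP w.
move=> /(theta_sum_surj hpr homega)[x [y [z [/eqP hx /eqP hy /eqP hz e]]]].
exists (LineBundle (n := -2) hx, LineBundle (n := 0) hy, LineBundle (n := 2) hz).
by apply: val_inj; rewrite /= e.
Qed.

Lemma cotangent_bij : bijective cotangent.
Proof.
have [g hg] := choice cotangent_surj.
by exists g => // u; apply: cotangent_inj; rewrite hg.
Qed.

(** Right multiplication by an element of opposite degree makes a coordinate coinvariant and
    preserves left M-linearity. *)
Lemma coord_functional i u : coact u = u \ox tpow (- wt i) ->
  exists phi : {linear Omega1M q -> M^o},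
    forall w, S2q_val (phi w) = coord i (Omega1M_val w) * u.
Proof.
move=> hu; have coinv w : coord i (Omega1M_val w) * u \in @coinvariant R q.
  have /submod_predP hw := Omega1M_valP w.
  apply/eqP; rewrite rmorphM /= (coord_Omega1M hpr i hw) hu tmulE.
  by rewrite tpowNK.
pose f w : M^o := MkS2q (coinv w).
have fL : linear f.
  move=> m x y; apply: val_inj.
  change (coord i (Omega1M_val (m *: x + y)) * u = S2q_val (m * f x + f y)).
  have [_ cD _ _ _] := linear_identities (coord_linear hpr i).
  have -> : Omega1M_val (m *: x + y) =
      (S2q_val m <*: Omega1M_val x) + Omega1M_val y :> Om.
    exact: (linearP (val : Omega1M q -> over_S2q (left_Omega1P q))).
  by rewrite S2q_valD S2q_valM cD (coord_lact hpr) mulrDl -mulrA.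
pose phi : {linear Omega1M q -> M^o} := HB.pack f (GRing.isLinear.Build _ _ _ _ f fL).
by exists phi.
Qed.

Lemma Omega1M_omega :
  [/\ forall p, coact p = p \ox tpow 2 -> Omega1M_set q (p <*: omega_m),
      forall p, coact p = p \ox 1 -> Omega1M_set q (p <*: omega_0) &
      forall p, coact p = p \ox tpow (- 2) -> Omega1M_set q (p <*: omega_p)].
Proof.
have [Wm W0 Wp] := lact_theta_Omega1M q.
have [tm t0 tp] := theta_omega hpr homega.
have inv (k : C) p (w : Om) : k != 0 ->
    Omega1M_set q (p <*: (k *: w)) -> Omega1M_set q (p <*: w).
  move=> k0 h; rewrite -[w]scale1r -(mulVf k0) -scalerA lactZ; exact: submodZ.
split=> p hp.
- by apply: (inv q' _ _ (qC_neq0 q)); rewrite -tm; exact: Wm.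
- by apply: (inv _ _ _ (frame_norm_neq0 q)); rewrite -t0; exact: W0.
- by rewrite -tp; exact: Wp.
Qed.

(* Partitions of unity for the line bundles: expand 1 = da - q^-1 bc twice in
   [1 = d 1 a - q^-1 b 1 c], and likewise 1 = ad - q cb. *)
Lemma unit_partition :
  [/\ (d * d) * (a * a) + (- q'^-1 *: (d * b)) * (c * a)
      + (- q'^-1 *: (b * d)) * (a * c) + (q' ^- 2 *: (b * b)) * (c * c) = 1 :> P &
      (a * a) * (d * d) + (- q' *: (a * c)) * (b * d)
      + (- q' *: (c * a)) * (d * b) + (q' ^+ 2 *: (c * c)) * (b * b) = 1 :> P].
Proof.
have [_ _ _ _ [cb ad da]] := su2_relE q; have q0 := qC_neq0 q.
have da1 : d * a - q'^-1 *: (b * c) = 1 by rewrite da addrK.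
have ad1 : a * d - q' *: (c * b) = 1 by rewrite cb ad addrK.
have h1 : d * (d * a - q'^-1 *: (b * c)) * a
    - q'^-1 *: (b * (d * a - q'^-1 *: (b * c)) * c) = 1.
  by rewrite da1 !mulr1 da1.
have h2 : a * (a * d - q' *: (c * b)) * d
    - q' *: (c * (a * d - q' *: (c * b)) * b) = 1.
  by rewrite ad1 !mulr1 ad1.
split; [rewrite -[RHS]h1 | rewrite -[RHS]h2].
all: rewrite !mulrBr !mulrBl -?scalerAr -?scalerAl -?scalerAr -?scalerAl !mulrA.
- move: (d * d * a * a) (d * b * c * a) (b * d * a * c) (b * b * c * c) => x y z w.
  by rewrite ?scalerBr ?scalerA; lmod_eq (R[i]); field.
- move: (a * a * d * d) (a * c * b * d) (c * a * d * b) (c * c * b * b) => x y z w.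
  by rewrite ?scalerBr ?scalerA; lmod_eq (R[i]); field.
Qed.

(** For each term u v of a partition of unity, the functional w |-> coord(w) u is paired with the
    form v omega. Four pairs serve omega_-, four serve omega_+, and one with u = v = 1 serves
    omega_0. *)
Lemma Omega1M_projective : projective (Omega1M q).
Proof.
have [Wm W0 Wp] := Omega1M_omega.
have [ha hb hc hd] := And4 (homog_a q) (homog_b q) (homog_c q) (homog_d q).
have elt w (h : Omega1M_set q w) : exists e : Omega1M q, Omega1M_val e = w :> Om.
  by have /submod_predP h' := h; exists (MkOmega1M h').
have pair i om k l (u v : P) : homog (- wt i) k u -> homog (wt i) l v ->
    (forall p, coact p = p \ox tpow (wt i) -> Omega1M_set q (p <*: om)) ->
    exists p : {linear Omega1M q -> M^o} * Omega1M q,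
      forall w, Omega1M_val (p.1 w *: p.2) =
        (coord i (Omega1M_val w) * (u * v)) <*: om :> Om.
  move=> /homog_coact hu /homog_coact hv W.
  have [phi hphi] := coord_functional hu; have [e he] := elt _ (W v hv).
  exists (phi, e) => w /=.
  rewrite -[LHS]/(S2q_val (phi w) <*: Omega1M_val e) he hphi lactM.
  by rewrite mulrA.
have [[fm1 hm1] [fm2 hm2]] :=
  (pair Tminus omega_m _ _ _ _ (homogM hd hd) (homogM ha ha) Wm,
   pair Tminus omega_m _ _ _ _ (homogZ (- q'^-1) (homogM hd hb)) (homogM hc ha) Wm).
have [fm3 hm3] :=
  pair Tminus omega_m _ _ _ _ (homogZ (- q'^-1) (homogM hb hd)) (homogM ha hc) Wm.
have [fm4 hm4] :=
  pair Tminus omega_m _ _ _ _ (homogZ (q' ^- 2) (homogM hb hb)) (homogM hc hc) Wm.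
have [f0 h0] :=
  pair Tzero omega_0 _ _ _ _ (homog_scalar q 1) (homog_scalar q 1) W0.
have [fp1 hp1] := pair Tplus omega_p _ _ _ _ (homogM ha ha) (homogM hd hd) Wp.
have [fp2 hp2] :=
  pair Tplus omega_p _ _ _ _ (homogZ (- q') (homogM ha hc)) (homogM hb hd) Wp.
have [fp3 hp3] :=
  pair Tplus omega_p _ _ _ _ (homogZ (- q') (homogM hc ha)) (homogM hd hb) Wp.
have [fp4 hp4] :=
  pair Tplus omega_p _ _ _ _ (homogZ (q' ^+ 2) (homogM hc hc)) (homogM hb hb) Wp.
apply: (@dual_basis_projective _ _ [:: fm1; fm2; fm3; fm4; f0; fp1; fp2; fp3; fp4]).
move=> w; apply: val_inj; rewrite !big_cons big_nil addr0.
have vD (x y : Omega1M q) : Omega1M_val (x + y) = Omega1M_val x + Omega1M_val y :> Om.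
  exact: (raddfD (val : Omega1M q -> over_S2q (left_Omega1P q))).
rewrite -![val _]/(Omega1M_val _) !vD.
have /submod_predP hw := Omega1M_valP w.
have lD p p' (om : Om) : (p <*: om) + (p' <*: om) = (p + p') <*: om.
  by have [_ h _ _ _] := linear_identities (lact_linearl om); rewrite h.
have [u1 u2] := unit_partition.
rewrite [LHS](Omega1M_decomp hpr homega hw).
have -> : Omega1M_val (f0.1 w *: f0.2) = coord Tzero (Omega1M_val w) <*: omega_0 :> Om.
  by rewrite h0 !scale1r !mulr1.
have -> : coord Tminus (Omega1M_val w) <*: omega_m =
    Omega1M_val (fm1.1 w *: fm1.2) + Omega1M_val (fm2.1 w *: fm2.2) +
    Omega1M_val (fm3.1 w *: fm3.2) + Omega1M_val (fm4.1 w *: fm4.2) :> Om.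
  by rewrite hm1 hm2 hm3 hm4 !lD -!mulrDr u1 mulr1.
have -> : coord Tplus (Omega1M_val w) <*: omega_p =
    Omega1M_val (fp1.1 w *: fp1.2) + Omega1M_val (fp2.1 w *: fp2.2) +
    Omega1M_val (fp3.1 w *: fp3.2) + Omega1M_val (fp4.1 w *: fp4.2) :> Om.
  by rewrite hp1 hp2 hp3 hp4 !lD -!mulrDr u2 mulr1.
by rewrite !addrA.
Qed.

End Cotangent.
Theorem theorem4p4 (R : realType) (q : deformation R)
    (pr : Uqsu2 q -> SUq2 q -> R[i]) (hpr : dual_pairing pr)
    (omega_m omega_0 omega_p omega_z : Omega1P q)
    (homega : dual_forms pr omega_m omega_0 omega_p omega_z) :
  let a := pa q in let b := pb q in let c := pc q in let d := pd q in
  let bp := b_plus q in let bm := b_minus q in let b0 := b_zero q in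
  let k := qC q in
  [/\ framed_quantum_manifold (@coactV R q) (@theta R q),
      (forall x, aug_M q x -> theta (classV x) = theta_lift x) /\
      [/\ coactV (classV bp) = classV bp \ox tpow R 2,
          coactV (classV b0) = classV b0 \ox 1 &
          coactV (classV bm) = classV bm \ox tpow R (- 2)],
      [/\ theta (classV bp) = (k ^+ 2 *: c ^+ 2) <*: dP bm
                            - ((k * mu q) *: (a * c)) <*: dP b0
                            + (a ^+ 2) <*: dP bp /\
          theta (classV bp) = omega_p,
          theta (classV b0) = - ((k *: (d * c)) <*: dP bm)
                            + (1 + mu q *: (b * c)) <*: dP b0
                            - (k^-1 *: (b * a)) <*: dP bp /\
          theta (classV b0) = (nu q ^+ 2 * k^-1) *: omega_0 &
          theta (classV bm) = (d ^+ 2) <*: dP bm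
                            - ((k^-1 * mu q) *: (b * d)) <*: dP b0
                            + (k ^- 2 *: b ^+ 2) <*: dP bp /\
          theta (classV bm) = k *: omega_m],
      exists Phi : {linear (line_bundle q (- 2) * line_bundle q 0
                            * line_bundle q 2)%type -> Omega1M q},
        bijective Phi /\
        forall x y z, Omega1M_val (Phi (x, y, z)) =
          (line_val x <*: theta (classV bm)) + (line_val y <*: theta (classV b0))
          + (line_val z <*: theta (classV bp)) :> Omega1P q &
      projective (Omega1M q)].
Proof.
move=> a b c d bp bm b0 k.
have [Mm M0 Mp] := aug_M_frame q.
have [ep e0 em] := theta_lift_explicit q.
have [tm t0 tp] := theta_omega hpr homega.
split.
- exact: (framed_S2q hpr homega).
- split; first exact: theta_class.
  exact: (coactV_frame hpr homega).
- split.
  + by split; [rewrite theta_class // | exact: tp].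
  + by split; [rewrite theta_class // | exact: t0].
  + by split; [rewrite theta_class // | exact: tm].
- exists (cotangent (q := q)); split; first exact: (cotangent_bij hpr homega).
  by [].
- exact: (Omega1M_projective hpr homega).
Qed.
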